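(* Let $F$ be a germ of a $C^1$-smooth map at a fixed point $x$ (of a finite-dimensional manifold) such that $x$ is an isolated fixed point of every iteration $F^k$, $k\ge1$ ($x$ is not assumed non-degenerate). Then for every integer $\kappa\ge 1$ the iterated index $I_\kappa(F)=I_\kappa(F,x)$ satisfies $$I_\kappa(F)=\frac{1}{\kappa}\sum_{d\mid\kappa}\varphi(\kappa/d)\,I(F^d),$$ where $\varphi$ is the Euler function, the sum is over the positive divisors $d$ of $\kappa$, and $I(F^d)=I(F^d,x)$ is the index of $x$ as an isolated fixed point of $F^d$.
   Context: The index $I(G,x)$ of an isolated fixed point $x$ of a (germ of a) map $G$ is the degree of the map $S^{n-1}\to S^{n-1}$, $z\mapsto (z-G(z))/\|z-G(z)\|$, with $z$ in a small sphere centered at $x$ in a local chart, $n$ being the dimension. A fixed point $y$ of $G$ is non-degenerate if $1$ is not an eigenvalue of $DG_y$. Iterated index of a germ: fix $\kappa$ and a small neighborhood $U$ of $x$ in which $x$ is the only fixed point of $F^\kappa$. Let $\tilde F$ be a sufficiently small perturbation of $F$ all of whose $\kappa$-periodic points (near $x$) are non-degenerate, i.e. non-degenerate as fixed points of $\tilde F^\kappa$. Set $$I_\kappa(F,x):=\sum_{\text{good }\mathcal O}I(\tilde F^\kappa,\mathcal O),$$ the sum being over all good $\kappa$-periodic orbits $\mathcal O$ of $\tilde F$ near $x$ (contained in $U$), not necessarily of minimal period $\kappa$. Here a $\kappa$-periodic point $y$ of $\tilde F$ is a fixed point of $\tilde F^\kappa$, its $\kappa$-periodic orbit is $\mathcal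 O=\{y,\tilde F(y),\dots,\tilde F^{\kappa-1}(y)\}$ (points not necessarily distinct), its minimal period $\tau$ is the smallest positive integer with $\tilde F^\tau(y)=y$ (so $\tau\mid\kappa$), and $I(\tilde F^\kappa,\mathcal O):=I(\tilde F^\kappa,y)$, which does not depend on the choice of $y\in\mathcal O$. A periodic point $y$ of minimal period $\tau$ is even (odd) if the number of real eigenvalues, counted with algebraic multiplicity, of $D\tilde F^\tau_y$ in $(-\infty,-1)$ is even (odd). A $\kappa$-periodic point $y$ of minimal period $\tau$ is bad if it is odd and $\kappa/\tau$ is even, and good otherwise; an orbit is good (bad) if one, equivalently all, of its points are. $\varphi(m)$ is the number of positive integers smaller than $m$ and relatively prime to $m$, with $\varphi(1)=1$. *)

(* Defs.v *)
From mathcomp Require Import all_boot all_order all_algebra.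
From mathcomp Require Import all_classical all_reals all_analysis.

Set Implicit Arguments.
Unset Strict Implicit.
Unset Printing Implicit Defensive.

Import Order.TTheory GRing.Theory Num.Theory.
Import numFieldNormedType.Exports.

Local Open Scope classical_set_scope.
Local Open Scope ring_scope.

Section Euclidean.
Context {R : realType}.

(* The norm of the library on 'rV[R]_n is the sup norm; spheres are round. *)
Definition enorm n (v : 'rV[R]_n) : R := Num.sqrt (\sum_i v ord0 i ^+ 2).

Definition sphere n : set 'rV[R]_n := [set z | enorm z = 1].

Definition C1_at m n (f : 'rV[R]_m -> 'rV[R]_n) (p : 'rV[R]_m) : Prop :=
  \forall q \near p, differentiable f q /\ {for q, continuous (jacobian f)}.

(* Self-maps of the sphere are represented by total functions, of which only
   the values on the sphere matter. *)
Definition sphere_homotopic n (f g : 'rV[R]_n -> 'rV[R]_n) : Prop :=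
  exists H : R * 'rV[R]_n -> 'rV[R]_n,
    [/\ {within `[0, 1]%classic `*` @sphere n, continuous H},
        forall t z, `[0, 1]%classic t -> sphere z -> sphere (H (t, z)),
        forall z, sphere z -> H (0, z) = f z &
        forall z, sphere z -> H (1, z) = g z].

(* The extension of g homogeneous of degree 1. At a point p of the sphere its
   differential maps p to g p and restricts to the differential of g from the
   tangent space at p to the one at g p, so that the sign of its determinant
   is the local orientation sign of g at p. *)
Definition radial n (g : 'rV[R]_n -> 'rV[R]_n) (v : 'rV[R]_n) : 'rV[R]_n :=
  enorm v *: g ((enorm v)^-1 *: v).

Definition C1_sphere_map n (g : 'rV[R]_n -> 'rV[R]_n) : Prop :=
  forall p, sphere p -> C1_at (radial g) p.

Definition sphere_regular_value n (g : 'rV[R]_n -> 'rV[R]_n) (y : 'rV[R]_n) :=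
  forall p, sphere p -> g p = y -> \det ('J (radial g) p) != 0.

(* Signed count of the preimages of a regular value of a C^1 map homotopic
   to f. *)
Definition is_degree n (f : 'rV[R]_n -> 'rV[R]_n) (m : int) : Prop :=
  exists g y, [/\ sphere_homotopic f g, C1_sphere_map g, sphere y,
    sphere_regular_value g y &
    m = \sum_(p \in [set p | sphere p /\ g p = y])
          sgz (\det ('J (radial g) p))].

(* For n = 0 the sphere is empty, and its only self-map has degree 1 (it is
   the identity of the reduced homology of the empty space). *)
Definition degree n (f : 'rV[R]_n -> 'rV[R]_n) : int :=
  if n == 0%N then 1 else xget 0 [set m | is_degree f m].

(* Rescaled to the unit sphere: z parametrizes the point p + r z of the sphere
   of radius r centered at p. *)
Definition displacement_direction n (g : 'rV[R]_n -> 'rV[R]_n)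
    (p : 'rV[R]_n) (r : R) (z : 'rV[R]_n) : 'rV[R]_n :=
  let v := (p + r *: z) - g (p + r *: z) in (enorm v)^-1 *: v.

Definition euclidean_index n (g : 'rV[R]_n -> 'rV[R]_n) (p : 'rV[R]_n) : int :=
  xget 0 [set m | \forall r \near 0^'+,
                    degree (displacement_direction g p r) = m].

Definition num_eigenvalues_lt_m1 n (A : 'M[R]_n) : nat :=
  \big[addn/0%N]_(a \in [set a : R | a < -1]) mup a (char_poly A).

End Euclidean.

Record chart (R : realType) (n : nat) (M : topologicalType) := Chart {
  chart_dom : set M;
  chart_map :> M -> 'rV[R]_n;
  chart_inv : 'rV[R]_n -> M;
  chart_dom_open : open chart_dom;
  chart_img_open : open (chart_map @` chart_dom);
  chart_map_continuous : {within chart_dom, continuous chart_map};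
  chart_inv_continuous :
    {within chart_map @` chart_dom, continuous chart_inv};
  chart_mapK : forall y, chart_dom y -> chart_inv (chart_map y) = y }.

Record C1_manifold (R : realType) (n : nat) := C1Manifold {
  carrier :> topologicalType;
  atlas : set (chart R n carrier);
  manifold_hausdorff : hausdorff_space carrier;
  manifold_second_countable : @second_countable carrier;
  atlas_cover : forall x, exists2 phi, atlas phi & chart_dom phi x;
  atlas_compatible : forall phi psi y, atlas phi -> atlas psi ->
    chart_dom phi y -> chart_dom psi y ->
    C1_at (psi \o chart_inv phi) (phi y) }.

Arguments atlas {R n} _ _.

(* A germ at x of a map is represented by a total function, of which only the
   restriction to a neighborhood of x matters. *)

Section Index.
Context {R : realType} {n : nat} {M : topologicalType}.
Implicit Types (phi : chart R n M) (G F : M -> M) (x y : M) (k : nat).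

Definition in_chart phi G : 'rV[R]_n -> 'rV[R]_n := phi \o G \o chart_inv phi.

Definition isolated_fixed_point G x : Prop :=
  G x = x /\ \forall y \near x, G y = y -> y = x.

(* The index I(G, x). *)
Definition fp_index phi G x : int := euclidean_index (in_chart phi G) (phi x).

Definition nondegenerate_fixed_point phi G y : Prop :=
  ~~ eigenvalue ('J (in_chart phi G) (phi y)) 1.

Definition minimal_period G y (t : nat) : Prop :=
  [/\ (0 < t)%N, iter t G y = y &
      forall j, (0 < j < t)%N -> iter j G y <> y].

Definition odd_point phi G y (t : nat) : Prop :=
  odd (num_eigenvalues_lt_m1 ('J (in_chart phi (iter t G)) (phi y))).

Definition bad_point phi k G y : Prop :=
  exists t, [/\ minimal_period G y t, odd_point phi G y t &
                ~~ odd (k %/ t)].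

Definition periodic_orbit k G y : set M := [set iter i G y | i in `I_k].

Definition periodic_in (U : set M) k G y : Prop :=
  iter k G y = y /\ periodic_orbit k G y `<=` U.

Definition good_orbits phi (U : set M) k G : set (set M) :=
  [set periodic_orbit k G y | y in [set y | periodic_in U k G y /\
                                   ~ bad_point phi k G y]].

(* I(G^k, O) = I(G^k, y) for a point y of O; x is a dummy default value. *)
Definition orbit_index phi k G x (O : set M) : int :=
  fp_index phi (iter k G) (xget x O).

Definition C1_close phi (U : set M) (e : R) F G : Prop :=
  forall y, U y ->
    [/\ chart_dom phi (G y), C1_at (in_chart phi G) (phi y),
        `|in_chart phi G (phi y) - in_chart phi F (phi y)| < e &
        `|'J (in_chart phi G) (phi y) - 'J (in_chart phi F) (phi y)| < e].

Definition admissible phi (U : set M) k (e : R) F G : Prop :=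
  C1_close phi U e F G /\
  forall y, periodic_in U k G y -> nondegenerate_fixed_point phi (iter k G) y.

Definition is_iterated_index phi k F x (m : int) : Prop :=
  exists2 U0, nbhs x U0 &
  forall U, open U -> U x -> U `<=` U0 ->
    (forall y, U y -> iter k F y = y -> y = x) ->
  exists2 e : R, 0 < e &
  forall G, admissible phi U k e F G ->
    \sum_(O \in good_orbits phi U k G) orbit_index phi k G x O = m.

(* The iterated index I_k(F, x). As xget is applied to a set that would be
   all of int if there were no admissible perturbations, a determined value
   includes their existence. *)
Definition iterated_index phi k F x : int :=
  xget 0 [set m | is_iterated_index phi k F x m].

End Index.

Definition C1_germ (R : realType) (n : nat) (M : C1_manifold R n)
    (F : M -> M) (x : M) : Prop :=
  forall phi, atlas M phi -> chart_dom phi x ->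
    (\forall y \near x, chart_dom phi (F y)) /\
    C1_at (in_chart phi F) (phi x).

(* Main.v *)
Require Import Defs.
From mathcomp Require Import all_boot all_order all_fingroup all_algebra.
From mathcomp Require Import all_classical all_reals all_analysis.
From mathcomp Require Import cyclic zify ring lra.
From mathcomp Require complex polyrcf.
Set Implicit Arguments.
Unset Strict Implicit.
Unset Printing Implicit Defensive.
Import Order.TTheory GRing.Theory Num.Theory.
Import numFieldNormedType.Exports.
Local Open Scope classical_set_scope.
Local Open Scope ring_scope.

(* A map of the sphere has a degree that can be computed by a count in the style
   of Sperner: label the vertices of the Kuhn triangulation of a fine grid of the
   cube by the signs of the radial extension of the map, and count with
   orientation the simplices that see all the labels. The count depends only on
   the labels on the boundary, hence is invariant under homotopies, and a
   nondegenerate zero contributes the sign of its Jacobian determinant. So the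
   index of F^d at x is the sum of sgn det(1 - D(G^d)_y) over the fixed points y
   of G^d near x, for every nondegenerate perturbation G.

   A point y of minimal period t, where kappa = t m, thus contributes
   sum_{d | m} phi(m/d) sgn det(1 - A^d) to the right-hand side, A being the
   differential of G^t at y. If b is the number of eigenvalues of A below -1,
   then sgn det(1 - A^d) is sgn det(1 - A) for d odd and (-1)^b sgn det(1 - A) for
   d even. Since sum_{d | m} phi(m/d) = m, the contribution is
   m sgn det(1 - A^m) when y is good and 0 when y is bad, and a good orbit, which
   has t points, contributes kappa times its index.

   Nondegenerate perturbations are found by induction on the period: by Sard's
   theorem, bumps added near the last points of the orbits make the points of
   period d nondegenerate for G^d, and a rescaling of G near these points makes
   them nondegenerate for G^kappa. *)

(** * Kuhn triangulations *)

(** The index is defined through a regular value of some $C^1$ map homotopic to the displacement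
    direction, so its independence of choices has to come from elsewhere. The label count is an
    integer computed from finitely many signs, for every map and every grid; each fact about it is
    an equality valid for all fine grids, and any value allowed by the definition of the degree is
    such a count.

    Each period takes two perturbations because nondegeneracy for $G^d$ does not prevent the
    differential of $G^d$ along an orbit from having another root of unity as an eigenvalue, which
    can make the point degenerate for $G^\kappa$. Translations move the orbits without controlling
    this, so the second perturbation keeps the orbits and rescales the differential.

    In increasing order of the periods, the points of smaller period are already nondegenerate for
    $G^\kappa$, an open condition. A bump then acts only on orbits of exact period d, whose points
    are distinct, so that it can act on the last one alone. *)

Section Kuhn.
Variables (n N : nat).
Notation cell := {ffun 'I_n.+1 -> 'I_N}.
Notation vertex := {ffun 'I_n.+1 -> nat}.
Implicit Types (k : cell) (s : 'S_n.+1) (u : vertex -> 'rV[int]_n.+1).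

(* The Kuhn triangulation of the grid {0..N}^(n+1): the vertices of the simplex
   (k, s) run from k to k + (1, ..., 1), the coordinate i increasing at step
   s i. *)
Definition kuhn_vertex k s (j : nat) : vertex := [ffun i => (k i + (s i < j))%N].

Definition kuhn_values u k s : 'M[int]_(n.+2, n.+1) :=
  \matrix_(j, i) u (kuhn_vertex k s j) ord0 i.

(** (n+1)! times the oriented volume of the image simplex; in [kuhn_sum] the sign of [s] is the
    orientation of the simplex of the grid. *)
Definition kuhn_det u k s : int :=
  \det (row_mx (const_mx 1 : 'cV[int]_n.+2) (kuhn_values u k s) : 'M[int]_(n.+2)).

Definition kuhn_sum u : int := \sum_(k : cell) \sum_(s : 'S_n.+1) (-1) ^+ s * kuhn_det u k s.

Definition facet_det u k s (j : 'I_n.+2) : int :=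
  \det (row' j (kuhn_values u k s)).

(** Expansion along the column of ones: the volume of a simplex is the signed sum of the volumes of
    the cones from the origin over its facets. This is what reduces the count to a boundary term. *)
Lemma kuhn_det_facets u k s :
  kuhn_det u k s = \sum_(j < n.+2) (-1) ^+ j * facet_det u k s j.
Proof.
rewrite /kuhn_det (expand_det_col _ ord0); apply: eq_bigr => j _.
rewrite [X in X * _](_ : _ = 1); last first.
  by rewrite mxE; case: splitP => // -[i ? /=]; rewrite mxE.
rewrite mul1r /cofactor addn0; congr (_ * \det _).
apply/matrixP => a b; rewrite !mxE.
case: splitP => [[i i1] /= ilift|i /=].
  by move: i1; rewrite -ilift.
by rewrite /bump /= => /addnI/val_inj ->; rewrite mxE.
Qed.

Lemma facet_det_inner u k (j : 'I_n.+2) : (0 < j < n.+1)%N ->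
  \sum_(s : 'S_n.+1) (-1) ^+ s * facet_det u k s j = 0.
Proof.
case/andP=> j0 jn.
have aP : (j.-1 < n.+1)%N by lia.
pose a := Ordinal aP; pose b := Ordinal jn.
have ab : a != b by apply/eqP => /(congr1 val) /=; lia.
set x := \sum_(s : 'S_n.+1) _.
suff : x = - x by lia.
rewrite {1}/x (reindex_inj (mulIg (tperm a b))) -sumrN /=.
apply: eq_bigr => s _; rewrite odd_permM odd_tperm ab addbT signrN mulNr.
congr (- (_ * \det _)); apply/matrixP => c i; rewrite !mxE /=; congr (u _ _ _).
apply/ffunP => l; rewrite !ffunE permM; congr (_ + nat_of_bool _)%N.
have := neq_bump j c; move: (bump j c) => m mj.
by case: tpermP => [->|->|//] /=; lia.
Qed.

(** The cyclic shift that makes the first step the last one. Without its first vertex, [(k, s)] has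
    the same vertices as [(step k i0, s * rot)] without its last one, [i0] being the coordinate that
    moves first. *)
Let rot : 'S_n.+1 := lift_perm ord0 ord_max 1.

Let rot0 : rot ord0 = ord_max.
Proof. exact: lift_perm_id. Qed.

Let rotS (r : 'I_n.+1) : r != ord0 -> (rot r).+1 = r :> nat.
Proof.
case: (unliftP ord0 r) => [r' ->|-> /eqP//] _.
by rewrite lift_perm_lift perm1 /= /bump leqNgt ltn_ord add0n add1n.
Qed.

(** [ordS] is cyclic, so that [step] permutes the cells. The facets that it pairs by wrapping around
    lie on opposite faces of the grid, where the two families of values agree and both differences
    vanish. *)
Let step k (i0 : 'I_n.+1) : cell :=
  [ffun i => if i == i0 then ordS (k i) else k i].

Let step_inj i0 : injective (step^~ i0).
Proof.
move=> k k' /ffunP e; apply/ffunP => i; have := e i; rewrite !ffunE.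
by case: eqP => // _; exact: ordS_inj.
Qed.

Let step_facet u k s (i0 : 'I_n.+1) : s i0 = ord0 -> (k i0).+1 <> N ->
  facet_det u (step k i0) (s * rot)%g ord_max = facet_det u k s ord0.
Proof.
move=> si0 kN; congr (\det _); apply/matrixP => c i; rewrite !mxE.
congr (u _ _ _); apply/ffunP => l; rewrite !ffunE permM.
rewrite [lift ord_max c : nat]lift_max [lift ord0 c : nat]lift0 ltnS.
have cn : (c <= n)%N by rewrite -ltnS.
case: eqP => [->|li].
  rewrite si0 rot0 /= ltnNge cn /= addn0 modn_small ?addn1//.
  by rewrite ltn_neqAle ltn_ord andbT; apply/eqP.
rewrite -[in RHS](@rotS (s l)) //.
by apply/eqP => sl; apply: li; apply: (@perm_inj _ s); rewrite si0.
Qed.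

(* In the difference of two sums that agree on the boundary, the facets cancel
   in pairs: an inner facet (of index 0 < j <= n) with the one of the same cell
   obtained by exchanging two consecutive steps, and a facet of index 0 with one
   of index n+1 of the next cell. *)
Lemma kuhn_sum_boundary u u' :
  (forall v : vertex, (forall i, v i <= N)%N ->
     (exists i, v i = 0%N \/ v i = N) -> u v = u' v) ->
  kuhn_sum u = kuhn_sum u'.
Proof.
move=> uu'; apply/eqP; rewrite -subr_eq0; apply/eqP.
pose g k s j := facet_det u k s j - facet_det u' k s j.
rewrite /kuhn_sum -sumrB.
transitivity (\sum_(k : cell) \sum_(s : 'S_n.+1) (-1) ^+ s * (\sum_(j < n.+2) (-1) ^+ j * g k s j)).
  apply: eq_bigr => k _; rewrite -sumrB; apply: eq_bigr => s _.
  rewrite !kuhn_det_facets -mulrBr -sumrB; congr (_ * _).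
  by apply: eq_bigr => j _; rewrite -mulrBr.
have vle k s j i : (kuhn_vertex k s j i <= N)%N.
  by rewrite ffunE; have := ltn_ord (k i); case: (s i < j)%N; lia.
have g_ends k s i0 : s i0 = ord0 ->
    g (step k i0) (s * rot)%g ord_max = g k s ord0.
  move=> si0; rewrite /g; have [kN|/eqP kN] := eqVneq (k i0).+1 N; last first.
    by rewrite !step_facet.
  rewrite (_ : facet_det u (step k i0) _ _ =
               facet_det u' (step k i0) (s * rot)%g ord_max) ?subrr; last first.
    congr (\det _); apply/matrixP => c i; rewrite !mxE uu'//.
    exists i0; left; rewrite ffunE permM si0 rot0 ffunE eqxx /=.
    by rewrite kN modnn [bump _ _]lift_max ltnNge -ltnS ltn_ord.
  rewrite (_ : facet_det u k s _ = facet_det u' k s ord0) ?subrr//.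
  congr (\det _); apply/matrixP => c i; rewrite !mxE uu'//.
  by exists i0; right; rewrite ffunE si0 /= addn1.
transitivity (\sum_(k : cell) \sum_(s : 'S_n.+1) (-1) ^+ s * (g k s ord0 + (-1) ^+ n.+1 * g k s ord_max)).
  apply: eq_bigr => k _; under eq_bigr do rewrite mulr_sumr.
  rewrite exchange_big big_ord_recl big_ord_recr /=.
  rewrite [X in _ + (X + _)]big1 ?add0r => [|j _].
    by rewrite -big_split; apply: eq_bigr => s _ /=; rewrite mul1r -mulrDr.
  transitivity (\sum_(s : 'S_n.+1) (-1) ^+ (widen_ord (leqnSn n.+1) (lift ord0 j) : nat) *
    ((-1) ^+ s * facet_det u k s (lift ord0 (widen_ord (leqnSn n) j)) -
    (-1) ^+ s * facet_det u' k s (lift ord0 (widen_ord (leqnSn n) j)))).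
    by apply: eq_bigr => s _; rewrite mulrCA mulrBr.
  rewrite -mulr_sumr sumrB !facet_det_inner ?subrr ?mulr0//.
  - by rewrite /= /bump; have := ltn_ord j; lia.
  - by rewrite /= /bump; have := ltn_ord j; lia.
rewrite exchange_big /=.
under eq_bigr => s _ do (rewrite -mulr_sumr big_split mulrDr /=).
rewrite big_split /= [X in _ + X](reindex_inj (mulIg rot)) -big_split big1 //= => s _.
have si0 : s ((s^-1)%g ord0) = ord0 by rewrite permKV.
rewrite [X in _ + _ * X](reindex_inj (@step_inj ((s^-1)%g ord0))) /=.
under [X in _ + _ * X]eq_bigr do rewrite g_ends//.
(* [rot] has the parity of [n], so a facet of index n+1 enters with the sign (-1)^n (-1)^(n+1) = -1
   relative to its partner of index 0. *)
rewrite -mulr_sumr odd_permM odd_lift_perm odd_perm1 addbF signr_addb /=.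
rewrite signr_odd exprS mulN1r mulNr mulrN -!mulrA (mulrA ((-1) ^+ n)).
by rewrite -signr_odd -expr2 sqrr_sign mul1r subrr.
Qed.

End Kuhn.

(** * The labelled simplex count of a map *)

Section RowVectorNorm.
Variables (R : realType).

Lemma rV_norm_coord n (x : 'rV[R]_n) i : `|x ord0 i| <= `|x|.
Proof.
rewrite [leRHS]/Num.Def.normr /= mx_normrE; apply/bigmax_geP; right => /=.
by exists (ord0, i).
Qed.

Lemma rV_norm_le n (x : 'rV[R]_n) (e : R) :
  0 <= e -> (forall i, `|x ord0 i| <= e) -> `|x| <= e.
Proof.
move=> e0 xe; rewrite [leLHS]/Num.Def.normr /= mx_normrE; apply/bigmax_leP; split=> //.
by case=> i j _ /=; rewrite (ord1 i).
Qed.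

Lemma rV_norm_attained n (x : 'rV[R]_n.+1) : exists i, `|x| = `|x ord0 i|.
Proof.
have [/mx_norm_eq0 ->|/mx_norm_neq0[[i j] xij]] := eqVneq (mx_norm x) 0.
  by exists ord0; rewrite mxE !normr0.
by exists j; rewrite [LHS]xij (ord1 i).
Qed.

End RowVectorNorm.

Section CompactUniformity.
Variables (R : realType) (V W : normedModType R) (f : V -> W) (A : set V).
Hypotheses (cA : compact A) (cf : {within A, continuous f}).

Lemma compact_unif_continuous (e : R) : 0 < e ->
  \forall d \near 0^'+, forall x y, A x -> A y -> `|x - y| < d ->
    `|f x - f y| < e.
Proof.
move=> e0.
suff : \forall d \near 0^'+, A `<=` [set x | forall y, A x -> A y ->
    `|x - y| < d -> `|f x - f y| < e].
  by apply: filterS => d H x y Ax; exact: H.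
move/compact_near_coveringP : cA; apply => x0 Ax0.
have : f @ within A (nbhs x0) --> f x0 by move/subspace_continuousP : cf; apply.
move=> /cvgrPdist_lt/(_ (e / 2)); rewrite divr_gt0// => /(_ isT).
rewrite near_withinE near_simpl => /nbhs_normP[r /= r0 H].
have r2 : 0 < r / 2 by rewrite divr_gt0.
near=> x d => y Ax Ay xy.
have dr : d < r / 2 by near: d; apply: nbhs_right_lt.
have xr : `|x0 - x| < r / 2 by near: x; apply/nbhs_normP; exists (r / 2).
have /= fx : `|f x0 - f x| < e / 2.
  by apply: H => //=; apply: (lt_trans xr); rewrite gtr_pMr// invf_lt1// ltr1n.
have /= fy : `|f x0 - f y| < e / 2.
  apply: H => //=; rewrite -(subrKA x) (splitr r).
  by rewrite (le_lt_trans (ler_normD _ _))// ltrD// (lt_trans xy).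
rewrite /= -(subrKA (f x0)) (splitr e) (le_lt_trans (ler_normD _ _))//.
by rewrite distrC ltrD.
Unshelve. all: by end_near. Qed.

Lemma compact_norm_gt : (forall x, A x -> f x != 0) ->
  \forall e \near 0^'+, forall x, A x -> e < `|f x|.
Proof.
move=> f0; suff : \forall e \near 0^'+, A `<=` [set x | A x -> e < `|f x|].
  by apply: filterS => e H x Ax; exact: H.
move/compact_near_coveringP : cA; apply => x0 Ax0.
have fx0 : 0 < `|f x0| / 2 by rewrite divr_gt0// normr_gt0 f0.
have : f @ within A (nbhs x0) --> f x0 by move/subspace_continuousP : cf; apply.
move=> /cvgrPdist_lt/(_ _ fx0).
rewrite near_withinE near_simpl => H.
near=> x e => Ax.
have eh : e < `|f x0| / 2 by near: e; apply: nbhs_right_lt.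
have /(_ Ax) : A x -> `|f x0 - f x| < `|f x0| / 2 by near: x.
have := ler_normD (f x0 - f x) (f x); rewrite subrK /=; lra.
Unshelve. all: by end_near. Qed.

End CompactUniformity.

Lemma det_mulmx_eq0 m (A : 'M[int]_m) (w : 'cV[int]_m) :
  A *m w = 0 -> w != 0 -> \det A = 0.
Proof.
move=> Aw /eqP w0; apply: contrapT => /eqP dA; apply: w0.
have : \adj A *m (A *m w) = 0 by rewrite Aw mulmx0.
rewrite mulmxA mul_adj_mx mul_scalar_mx => /matrixP e.
apply/matrixP => i j; have := e i j; rewrite !mxE => /eqP.
by rewrite mulf_eq0 (negbTE dA) => /eqP.
Qed.

Section Labels.
Variables (R : realType) (n : nat).
Implicit Types x : 'rV[R]_n.+1.
Notation vertex := {ffun 'I_n.+1 -> nat}.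

(* The label of x is the vertex of the standard simplex that is indexed by the
   last nonnegative coordinate of x, or the origin when there is none. *)
Definition sign_label x : 'rV[int]_n.+1 :=
  \row_i ((0 <= x ord0 i) &&
          [forall i' : 'I_n.+1, (i < i')%N ==> (x ord0 i' < 0)] : nat)%:Z.

Lemma sum_sign_label x : (exists i, 0 <= x ord0 i) ->
  \sum_i sign_label x ord0 i = 1.
Proof.
case=> i0 xi0.
have [i xi imax0] := @arg_maxnP _ i0 (fun i => 0 <= x ord0 i) val xi0.
have imax j : 0 <= x ord0 j -> (j <= i)%N by exact: imax0.
rewrite (bigD1 i)//= big1 => [|j ji]; rewrite mxE.
  rewrite xi /= addr0; case: forallP => // -[] j; apply/implyP => ij.
  by rewrite ltNge; apply/negP => /imax; rewrite leqNgt ij.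
case: (boolP (0 <= x ord0 j)) => //= xj; case: forallP => // /(_ i)/implyP.
have := imax _ xj; rewrite leq_eqVlt => /predU1P[/val_inj ij|ij /(_ ij)].
  by rewrite ij eqxx in ji.
by rewrite ltNge xi.
Qed.

Variable N : nat.
Implicit Types (f : vertex -> 'rV[R]_n.+1).
Implicit Types (k : {ffun 'I_n.+1 -> 'I_N}) (s : 'S_n.+1).

(** A missing label makes the columns dependent: the column of coordinate [i] is zero when no vertex
    has the [i]-th label, and when no vertex is labelled by the origin the other columns add up to
    the column of ones. *)
Lemma kuhn_det_label_neq0 f k s :
  kuhn_det (sign_label \o f) k s != 0 ->
  (forall i, exists j : 'I_n.+2, 0 <= f (kuhn_vertex k s j) ord0 i /\
     forall i' : 'I_n.+1, (i < i')%N -> f (kuhn_vertex k s j) ord0 i' < 0) /\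
  (exists j : 'I_n.+2, forall i, f (kuhn_vertex k s j) ord0 i < 0).
Proof.
move=> /eqP d0; split.
  move=> i; apply: contrapT => fi; apply: d0.
  apply: (@det_mulmx_eq0 _ _ (col_mx 0 (delta_mx i ord0) : 'cV_(1 + n.+1))).
    rewrite [LHS]mul_row_col mulmx0 add0r; apply/matrixP => a b; rewrite !mxE.
    rewrite (bigD1 i)//= big1 => [|c ci]; last first.
      by rewrite [X in _ * X]mxE (negbTE ci) mulr0.
    rewrite !mxE /=; case: andP => [[fa /forallP fb]|_]; last first.
      by rewrite mul0r addr0.
    by exfalso; apply: fi; exists a; split => // i'; exact/implyP.
  apply/eqP => /matrixP/(_ (rshift 1 i) ord0); rewrite col_mxEd !mxE !eqxx//.
apply: contrapT => fi; apply: d0.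
apply: (@det_mulmx_eq0 _ _ (col_mx 1 (const_mx (- 1)) : 'cV_(1 + n.+1))).
  rewrite [LHS]mul_row_col mulmx1; apply/matrixP => a b; rewrite !mxE.
  under eq_bigr do rewrite !mxE mulrN mulr1.
  have -> : forall x y : int, y = - 1 -> x = 1 -> x + y = 0 by lia.
  - by [].
  - rewrite sumrN; congr (- _).
    rewrite -[RHS](@sum_sign_label (f (kuhn_vertex k s a))).
      by apply: eq_bigr => c _; rewrite mxE.
    apply: contrapT => fa; apply: fi; exists a => i.
    by rewrite ltNge; apply/negP => fai; apply: fa; exists i.
  - by [].
by apply/eqP => /matrixP/(_ (lshift _ ord0) ord0); rewrite col_mxEu !mxE.
Qed.

(** A simplex with all the labels sees both signs of every coordinate, so a small oscillation forces
    small values: on a fine grid only simplices near the zeros of the map are counted. *)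
Lemma kuhn_det_label_small f k s (e : R) :
  kuhn_det (sign_label \o f) k s != 0 ->
  (forall j j' : 'I_n.+2,
     `|f (kuhn_vertex k s j) - f (kuhn_vertex k s j')| <= e) ->
  forall j : 'I_n.+2, `|f (kuhn_vertex k s j)| <= e.
Proof.
move=> /kuhn_det_label_neq0[fpos [j1 fneg]] fe j.
have e0 : 0 <= e by apply: le_trans (fe j j).
apply: rV_norm_le => // i.
have [j2 [fj2 _]] := fpos i.
have := fneg i => fj1.
have := le_trans (rV_norm_coord _ i) (fe j j1).
have := le_trans (rV_norm_coord _ i) (fe j j2).
rewrite !mxE !ler_norml; move: (f _ _ _) (f _ _ _) (f _ _ _) fj1 fj2 => a b c.
by move=> ? ?; move=> /andP[? ?] /andP[? ?]; apply/andP; split; lra.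
Qed.

End Labels.

Section LabelCount.
Variables (R : realType) (n : nat).
Notation vertex := {ffun 'I_n.+1 -> nat}.
Notation cube := [set x : 'rV[R]_n.+1 | `|x| <= 1].
Implicit Types (w : 'rV[R]_n.+1 -> 'rV[R]_n.+1).

Definition grid_point N (v : vertex) : 'rV[R]_n.+1 :=
  \row_i (2 * (v i)%:R / N%:R - 1).

Definition label_count N w : int :=
  kuhn_sum N (fun v => sign_label (w (grid_point N v))).

Lemma kuhn_vertex_le N (k : {ffun 'I_n.+1 -> 'I_N}) (s : 'S_n.+1) j i :
  (kuhn_vertex k s j i <= N)%N.
Proof. by rewrite ffunE; have := ltn_ord (k i); case: (s i < j)%N; lia. Qed.

Lemma grid_point_cube N (v : vertex) : (0 < N)%N -> (forall i, v i <= N)%N ->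
  cube (grid_point N v).
Proof.
move=> N0 vN /=; apply: rV_norm_le => // i; rewrite mxE ler_norml.
have : 0 <= 2 * (v i)%:R / N%:R :> R by rewrite divr_ge0// mulr_ge0.
have : 2 * (v i)%:R / N%:R <= 2 :> R.
  by rewrite ler_pdivrMr ?ltr0n// ler_pM2l// ler_nat.
by move=> ? ?; apply/andP; split; lra.
Qed.

Lemma grid_point_boundary N (v : vertex) : (0 < N)%N -> (forall i, v i <= N)%N ->
  (exists i, v i = 0%N \/ v i = N) -> `|grid_point N v| = 1.
Proof.
move=> N0 vN [i vi]; apply/eqP; rewrite eq_le grid_point_cube//=.
apply: le_trans (rV_norm_coord _ i); rewrite mxE.
case: vi => ->; first by rewrite mulr0 mul0r sub0r normrN normr1.
rewrite mulfK ?pnatr_eq0 -?lt0n// (_ : 2 - 1 = 1) ?normr1//; lra.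
Qed.

Lemma grid_point_dist N (k : {ffun 'I_n.+1 -> 'I_N}) (s : 'S_n.+1) j j' :
  `|grid_point N (kuhn_vertex k s j) - grid_point N (kuhn_vertex k s j')|
    <= 2 / N%:R.
Proof.
apply: rV_norm_le => [|i]; first by rewrite divr_ge0.
rewrite !mxE !ffunE opprB addrA subrK -mulrBl -mulrBr.
rewrite mulrAC normrM ger0_norm ?divr_ge0// ler_piMr ?divr_ge0//.
rewrite !natrD opprD addrACA subrr add0r.
by case: (s i < j)%N; case: (s i < j')%N; rewrite ?subrr ?subr0 ?sub0r ?normrN ?normr1 ?normr0.
Qed.

Lemma mesh_lt (d : R) : 0 < d -> \forall N \near \oo, 2 / N%:R < d :> R.
Proof.
move=> d0; near=> N.
have N0 : 0 < N%:R :> R by rewrite ltr0n; near: N; exact: nbhs_infty_gt.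
rewrite ltr_pdivrMr// mulrC -ltr_pdivrMr//.
by near: N; exact: nbhs_infty_gtr.
Unshelve. all: by end_near. Qed.

Lemma compact_cube : compact cube.
Proof.
apply: bounded_closed_compact.
  by exists 1; split => // r r1 x /=; move/le_trans; apply; exact: ltW.
have -> : cube = closed_ball (0 : 'rV[R]_n.+1) 1.
  by rewrite closed_ballE//; apply/seteqP; split => x /=;
    rewrite /closed_ball_ /= sub0r normrN.
exact: closed_ball_closed.
Qed.

(** Two consecutive times are compared through a labelling that uses the later time on the boundary
    of the grid and the earlier one inside. Passing to it changes only simplices that touch the
    boundary, which contribute 0 because [W] is not small there; passing from it to the later time
    keeps the boundary labels. *)
Lemma label_count_homotopy (W : R * 'rV[R]_n.+1 -> 'rV[R]_n.+1) :
  {within `[0, 1]%classic `*` cube, continuous W} ->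
  (forall t x, `[0, 1]%classic t -> `|x| = 1 -> W (t, x) != 0) ->
  \forall N \near \oo,
    label_count N (fun x => W (0, x)) = label_count N (fun x => W (1, x)).
Proof.
move=> cW W0.
have cI : compact (`[0, 1]%classic `*` cube : set (R * 'rV[R]_n.+1)).
  by apply: compact_setX; [exact: segment_compact | exact: compact_cube].
have cS : closed [set p : R * 'rV[R]_n.+1 | `|p.2| = 1].
  apply: (@closed_comp _ _ (fun p : R * 'rV[R]_n.+1 => `|p.2|) [set 1]).
    by move=> p _; apply: continuous_comp; [exact: cvg_snd|exact: norm_continuous].
  exact: closed_eq.
have : \forall e \near 0^'+, forall p,
    (`[0, 1]%classic `*` cube `&` [set p | `|p.2| = 1]) p -> e < `|W p|.
  apply: compact_norm_gt; first exact: compact_closedI.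
    by apply: continuous_subspaceW cW => p [].
  by move=> [t x] [[/= It _] x1]; exact: W0.
move=> /(filterI (nbhs_right_gt 0))/filter_ex[e [/= e0 eW]].
have /(filterI (nbhs_right_gt 0))/filter_ex[d [/= d0 dW]] :=
  compact_unif_continuous cI cW e0.
near=> N.
have N0 : (0 < N)%N by near: N; exact: nbhs_infty_gt.
have Nd : 2 / N%:R < d by near: N; exact: mesh_lt.
(* Time is cut into as many steps as the side of the grid, so that the single condition on [N]
   controls both variables. *)
pose T i : R := i%:R / N%:R.
have TI i : (i <= N)%N -> `[0, 1]%classic (T i).
  move=> iN; rewrite /= in_itv /= divr_ge0//=.
  by rewrite ler_pdivrMr ?ltr0n// mul1r ler_nat.
suff step i : (i < N)%N -> label_count N (fun x => W (T i, x)) =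
                           label_count N (fun x => W (T i.+1, x)).
  have -> : (0 : R) = T 0%N by rewrite /T mul0r.
  have -> : (1 : R) = T N by rewrite /T divff// pnatr_eq0 -lt0n.
  suff H i : (i <= N)%N -> label_count N (fun x => W (T 0%N, x)) =
                          label_count N (fun x => W (T i, x)) by exact: H.
  elim: i => // i IH iN; exact: (etrans (IH (ltnW iN)) (step _ iN)).
move=> iN.
have dT j j' : (j == i) || (j == i.+1) -> (j' == i) || (j' == i.+1) ->
    `|T j - T j'| < d.
  have h0 : `|0 : R| < d by rewrite normr0.
  have h1 : `|1 / N%:R : R| < d.
    rewrite ger0_norm ?divr_ge0//; apply: le_lt_trans Nd.
    by rewrite ler_pM2r ?invr_gt0 ?ltr0n// ler1n.
  move=> /orP[]/eqP-> /orP[]/eqP->; rewrite -mulrBl ?subrr ?mul0r//.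
    by rewrite mulrSr opprD addrA subrr sub0r mulNr normrN.
  by rewrite mulrSr addrAC subrr add0r.
pose bd (v : vertex) := [exists l, (v l == 0%N) || (v l == N)].
have zero (k : {ffun 'I_n.+1 -> 'I_N}) (s : 'S_n.+1) (tau : vertex -> nat) :
    (forall v, (tau v == i) || (tau v == i.+1)) ->
    [exists j : 'I_n.+2, bd (kuhn_vertex k s j)] ->
    kuhn_det (fun v => sign_label (W (T (tau v), grid_point N v))) k s = 0.
  move=> taui /existsP[j0 bj0]; apply: contrapT => /eqP k0.
  have TI' v : `[0, 1]%classic (T (tau v)).
    by have /orP[/eqP->|/eqP->] := taui v; apply: TI => //; exact: ltnW.
  have QI j : cube (grid_point N (kuhn_vertex k s j)).
    by apply: grid_point_cube => // l; exact: kuhn_vertex_le.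
  have H : forall j : 'I_n.+2, `|W (T (tau (kuhn_vertex k s j)),
      grid_point N (kuhn_vertex k s j))| <= e.
    apply: (kuhn_det_label_small
      (f := fun v => W (T (tau v), grid_point N v)) k0) => j j'.
    apply: ltW; apply: dW; [by split; [exact: TI'|exact: QI]|by split; [exact: TI'|exact: QI]|].
    rewrite prod_normE gt_max dT//=.
    exact: le_lt_trans (grid_point_dist _ _ _ _) Nd.
  have := H j0; rewrite leNgt => /negP; apply; apply: eW; split.
    by split; [exact: TI'|exact: QI].
  apply: grid_point_boundary => // [l|]; first exact: kuhn_vertex_le.
  by move/existsP : bj0 => [l /orP[]/eqP ?]; exists l; [left|right].
pose tau v := if bd v then i.+1 else i.
transitivity (kuhn_sum N
    (fun v => sign_label (W (T (tau v), grid_point N v)))).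
  apply: eq_bigr => k _; apply: eq_bigr => s _; congr (_ * _).
  case: (boolP [exists j : 'I_n.+2, bd (kuhn_vertex k s j)]) => bk.
    rewrite (zero k s tau)// => [|v]; last by rewrite /tau; case: ifP; rewrite eqxx ?orbT.
    by rewrite (zero k s (fun=> i))// => v; rewrite eqxx.
  congr (\det _); apply/matrixP => a b; rewrite !mxE; case: splitP => // c _.
  rewrite !mxE /tau ifF//; apply/negbTE.
  by apply: contra bk => ba; apply/existsP; exists a.
apply: kuhn_sum_boundary => v _ [l vl]; rewrite /tau ifT//.
by apply/existsP; exists l; case: vl => ->; rewrite eqxx ?orbT.
Unshelve. all: by end_near. Qed.

End LabelCount.

(** * Paths of invertible matrices *)

Section GLPath.
Variable F : realFieldType.

(* Impredicative encoding of: A and B are joined by a polygonal path of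
   invertible matrices. *)
Definition gl_path d (A B : 'M[F]_d) : Prop :=
  forall P : 'M[F]_d -> Prop,
    (forall X Y, (forall t, 0 <= t <= 1 -> (1 - t) *: X + t *: Y \in unitmx) ->
       P X -> P Y) ->
    P A -> P B.

Lemma gl_path_trans d (B A C : 'M[F]_d) :
  gl_path A B -> gl_path B C -> gl_path A C.
Proof. by move=> AB BC P HP PA; apply: (BC P HP); exact: (AB P HP). Qed.

Lemma gl_path_segment d (A B : 'M[F]_d) :
  (forall t, 0 <= t <= 1 -> (1 - t) *: A + t *: B \in unitmx) -> gl_path A B.
Proof. by move=> AB P HP; exact: HP. Qed.

Lemma gl_path_block d (a : F) (A B : 'M[F]_d) : a != 0 -> gl_path A B ->
  gl_path (block_mx (a%:M : 'M[F]_1) 0 0 A) (block_mx (a%:M : 'M[F]_1) 0 0 B).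
Proof.
move=> a0 AB P HP; apply: (AB (fun X => P (block_mx (a%:M : 'M[F]_1) 0 0 X))).
move=> X Y XY; apply: HP => t t01; rewrite !scale_block_mx add_block_mx.
rewrite !scaler0 !addr0 unitmxE det_ublock unitrM -!unitmxE XY// andbT.
by rewrite -scalerDl subrK scale1r unitmxE det_scalar expr1 unitfE.
Qed.

Lemma unitmx_unipotent d (E : 'M[F]_d) (t : F) :
  E *m E = 0 -> 1%:M + t *: E \in unitmx.
Proof.
move=> E0; suff /mulmx1_unit[] : (1%:M + t *: E) *m (1%:M - t *: E) = 1%:M by [].
rewrite mulmxDl !mulmxBr mul1mx mulmx1 mul1mx -scalemxAl -scalemxAr E0.
by rewrite !scaler0 subr0 subrK.
Qed.

(** The matrix is the square of [1 + E / 2]. *)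
Lemma det_unipotent_gt0 d (E : 'M[F]_d) : E *m E = 0 -> 0 < \det (1%:M + E).
Proof.
move=> E0; have -> : 1%:M + E = (1%:M + 2^-1 *: E) *m (1%:M + 2^-1 *: E).
  rewrite mulmxDl !mulmxDr mul1mx mulmx1 mul1mx -scalemxAl -scalemxAr E0.
  by rewrite !scaler0 addr0 -addrA -scalerDl (_ : 2^-1 + 2^-1 = 1) ?scale1r//; lra.
rewrite det_mulmx -expr2 lt_neqAle sqr_ge0 andbT eq_sym expf_eq0 /=.
by rewrite -unitfE -unitmxE unitmx_unipotent.
Qed.

Lemma gl_path_unipotentr d (A E : 'M[F]_d) : A \in unitmx -> E *m E = 0 ->
  gl_path A (A *m (1%:M + E)).
Proof.
move=> uA E0; apply: gl_path_segment => t _.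
rewrite -{1}[A]mulmx1 !scalemxAr -mulmxDr unitmx_mul uA /=.
by rewrite scalerDr addrA -scalerDl subrK scale1r unitmx_unipotent.
Qed.

Lemma gl_path_unipotentl d (A E : 'M[F]_d) : A \in unitmx -> E *m E = 0 ->
  gl_path A ((1%:M + E) *m A).
Proof.
move=> uA E0; apply: gl_path_segment => t _.
rewrite -{1}[A]mul1mx !scalemxAl -mulmxDl unitmx_mul uA andbT.
by rewrite scalerDr addrA -scalerDl subrK scale1r unitmx_unipotent.
Qed.

Lemma sgr_unitmx d (A : 'M[F]_d) : A \in unitmx -> Num.sg (\det A) != 0.
Proof. by rewrite unitmxE unitfE sgr_eq0. Qed.

(** Adding a multiple of another column to column 0 gives any corner entry, provided that the first
    row is nonzero off the corner; if it is not, column 0 is first added to column 1. Column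
    operations are products with [1 + E] where [E] has square zero, hence paths. *)
Lemma gl_path_pivot d (A : 'M[F]_(1 + d.+1)) (c : F) : A \in unitmx ->
  exists B, [/\ gl_path A B, B \in unitmx, Num.sg (\det B) = Num.sg (\det A) &
                B ord0 ord0 = c].
Proof.
move=> uA.
have dsq (i j : 'I_(1 + d.+1)) (e : F) : i != j ->
    (e *: delta_mx i j) *m (e *: delta_mx i j) = 0.
  move=> ij; rewrite -scalemxAl -scalemxAr mul_delta_mx_0 ?scaler0//.
  by rewrite eq_sym.
have tr (B E : 'M[F]_(1 + d.+1)) : B \in unitmx -> E *m E = 0 ->
    [/\ gl_path B (B *m (1%:M + E)), B *m (1%:M + E) \in unitmx &
        Num.sg (\det (B *m (1%:M + E))) = Num.sg (\det B)].
  move=> uB E0; split; first exact: gl_path_unipotentr.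
    by rewrite unitmx_mul uB -[E]scale1r unitmx_unipotent.
  by rewrite det_mulmx sgrM (gtr0_sg (det_unipotent_gt0 E0)) mulr1.
have col (B : 'M[F]_(1 + d.+1)) (e : F) i j :
    (B *m (1%:M + e *: delta_mx i j)) ord0 j = B ord0 j + e * B ord0 i.
  rewrite mulmxDr mulmx1 -scalemxAr !mxE; congr (_ + _ * _).
  by rewrite (bigD1 i)//= big1 ?mxE ?eqxx ?mulr1 ?addr0// => l li;
     rewrite mxE (negbTE li) mulr0.
have step (B : 'M[F]_(1 + d.+1)) j : B \in unitmx -> j != ord0 -> B ord0 j != 0 ->
  exists C, [/\ gl_path B C, C \in unitmx, Num.sg (\det C) = Num.sg (\det B) &
                C ord0 ord0 = c].
  move=> uB j0 Bj; pose E : 'M[F]_(1 + d.+1) := ((c - B ord0 ord0) / B ord0 j) *: delta_mx j ord0.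
  have [? ? ?] := tr B E uB (dsq j ord0 _ j0).
  by exists (B *m (1%:M + E)); split=> //; rewrite col divfK// addrC subrK.
have [[j [j0 Aj]]|H] := pselect (exists j, j != ord0 /\ A ord0 j != 0).
  exact: step Aj.
have A00 : A ord0 ord0 != 0.
  apply/eqP => A0; have : row ord0 A = 0.
    apply/rowP => j; rewrite !mxE; have [->//|j0] := eqVneq j ord0.
    by apply: contrapT => /eqP Aj; apply: H; exists j.
  move=> /(congr1 (fun r => r *m invmx A)); rewrite -row_mul mulmxV// mul0mx.
  by move=> /rowP/(_ ord0)/eqP; rewrite !mxE eqxx oner_eq0.
pose j1 : 'I_(1 + d.+1) := lift ord0 ord0.
have [p u s] := tr A (1 *: delta_mx ord0 j1) uA (dsq _ _ _ (neq_lift _ _)).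
have A1 : A ord0 j1 = 0.
  by apply: contrapT => /eqP Aj; apply: H; exists j1.
have [//||C [pC uC sC Cc]] := step _ j1 u; first by rewrite col A1 add0r mul1r.
by exists C; split=> //; [exact: gl_path_trans pC | rewrite sC].
Qed.

(** Pivoting on a corner equal to the sign of the determinant leaves a Schur complement of positive
    determinant, which the induction joins to the identity. *)
Lemma gl_path_sign d (A : 'M[F]_(1 + d)) : A \in unitmx ->
  gl_path A (block_mx ((Num.sg (\det A))%:M : 'M[F]_1) 0 0 1%:M).
Proof.
elim: d A => [|d IH] A uA.
  have det1 (X : 'M[F]_(1 + 0)) : \det X = X ord0 ord0 by exact: det_mx11.
  apply: gl_path_segment => t /andP[t0 t1].
  move: uA; rewrite !unitmxE !unitfE !det1 2!mxE mxE [X in _ + t * X]mxE.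
  case: splitP => // i _; rewrite mxE; case: splitP => // j _.
  rewrite mxE (ord1 i) (ord1 j) eqxx mulr1n; move: (A _ _) => a a0.
  have [a1|a1] : a < 0 \/ 0 < a by apply/orP; rewrite -neq_lt.
    rewrite ltr0_sg//; apply: ltr0_neq0; have [->|?] := eqVneq t 1; nra.
  rewrite gtr0_sg//; apply: lt0r_neq0; have [->|?] := eqVneq t 1; nra.
set c := Num.sg _; have c0 : c != 0 by exact: sgr_unitmx.
have [B [AB uB sB Bc]] := gl_path_pivot c uA.
pose r : 'rV[F]_d.+1 := ursubmx (B : 'M[F]_(1 + d.+1, 1 + d.+1)).
pose l : 'cV[F]_d.+1 := dlsubmx (B : 'M[F]_(1 + d.+1, 1 + d.+1)).
pose D : 'M[F]_d.+1 := drsubmx (B : 'M[F]_(1 + d.+1, 1 + d.+1)).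
have BE : B = block_mx c%:M r l D.
  rewrite -[LHS]submxK; congr (block_mx _ _ _ _).
  apply/matrixP => i j; rewrite (ord1 i) (ord1 j) !mxE eqxx mulr1n -Bc.
  by congr (B _ _); apply: val_inj.
pose E : 'M[F]_(1 + d.+1) := block_mx 0 (- c^-1 *: r) 0 0.
have E0 : E *m E = 0.
  by rewrite mulmx_block !mul0mx !mulmx0 !addr0 block_mx0.
pose E' : 'M[F]_(1 + d.+1) := block_mx 0 0 (- c^-1 *: l) 0.
have E'0 : E' *m E' = 0.
  by rewrite mulmx_block !mul0mx !mulmx0 !addr0 block_mx0.
have uB' : B *m (1%:M + E) \in unitmx.
  by rewrite unitmx_mul uB -[E]scale1r unitmx_unipotent.
pose S := D - c^-1 *: (l *m r).
have BS : (1%:M + E') *m (B *m (1%:M + E)) = block_mx c%:M 0 0 S.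
  rewrite BE (scalar_mx_block 1 d.+1) !add_block_mx !mulmx_block.
  rewrite !(addr0, add0r, mul1mx, mulmx1, mul0mx, mulmx0).
  have e1 : c%:M *m (- c^-1 *: r) + r = 0.
    by rewrite mul_scalar_mx scalerA mulrN divff// scaleN1r addNr.
  have e2 : (- c^-1 *: l) *m c%:M + l = 0.
    by rewrite mul_mx_scalar scalerA mulrN divff// scaleN1r addNr.
  by rewrite e1 e2 mulmx0 add0r -scalemxAr scaleNr /S addrC.
have sS : Num.sg (\det S) = 1.
  have := congr1 (fun M => Num.sg (\det M)) BS.
  rewrite !det_mulmx !sgrM (gtr0_sg (det_unipotent_gt0 E0)).
  rewrite (gtr0_sg (det_unipotent_gt0 E'0)) mul1r mulr1 sB.
  rewrite det_ublock sgrM det_scalar expr1 -/c {2}/c sgr_id -/c.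
  by move=> /esym/eqP; rewrite -[X in _ == X]mulr1 => /eqP/(mulfI c0).
have uS : S \in unitmx by rewrite unitmxE unitfE -sgr_eq0 sS oner_eq0.
apply: gl_path_trans AB _.
apply: gl_path_trans (gl_path_unipotentr uB E0) _.
apply: gl_path_trans (gl_path_unipotentl uB' E'0) _.
rewrite BS; apply: gl_path_block => //.
by move: (IH S uS); rewrite sS -(scalar_mx_block 1 d 1).
Qed.

End GLPath.

(** * The label count of a diagonal matrix of signs *)

Section CountSigns.
Variables (R : realType) (n N : nat).
Notation vertex := {ffun 'I_n.+1 -> nat}.

Lemma perm_increasing (s : 'S_n.+1) :
  (forall i i' : 'I_n.+1, (i < i')%N -> (s i < s i')%N) -> s = 1%g.
Proof.
have le (t : 'S_n.+1) : (forall i i' : 'I_n.+1, (i < i')%N -> (t i < t i')%N) ->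
    forall i : 'I_n.+1, (i <= t i)%N.
  move=> tinc [i iP]; elim: i iP => // i IH iP.
  exact: leq_ltn_trans (IH (ltnW iP)) (tinc _ _ _).
move=> sinc; apply/permP => i; rewrite perm1; apply/eqP; rewrite -val_eqE /=.
rewrite eqn_leq (le s)// andbT.
suff /le/(_ (s i)) : forall j j' : 'I_n.+1, (j < j')%N -> ((s^-1)%g j < (s^-1)%g j')%N.
  by rewrite permK.
move=> j j' jj'.
rewrite ltnNge leq_eqVlt; apply/negP => /orP[/eqP/val_inj/perm_inj e|/sinc].
  by rewrite e ltnn in jj'.
by rewrite !permKV ltnNge ltnW.
Qed.

(** Coordinate [i] changes sign between the grid values [m i] and [m i + 1], upwards except for
    coordinate 0 when [b] holds. Only the cell [m] sees both signs of all coordinates, and the rule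
    of the last nonnegative coordinate fixes the order of the steps: a single simplex is counted. *)
Lemma kuhn_sum_threshold (m : {ffun 'I_n.+1 -> 'I_N}) (b : bool)
    (f : vertex -> 'rV[R]_n.+1) :
  (forall v i, (0 <= f v ord0 i) = ((m i < v i)%N (+) ((i == ord0) && b))) ->
  kuhn_sum N (fun v => sign_label (f v)) = (-1) ^+ b.
Proof.
move=> fE.
have fneg v i : (f v ord0 i < 0) = ~~ ((m i < v i)%N (+) ((i == ord0) && b)).
  by rewrite ltNge fE.
have uniq (k : {ffun 'I_n.+1 -> 'I_N}) (s : 'S_n.+1) :
      kuhn_det (fun v => sign_label (f v)) k s != 0 -> k = m /\ s = 1%g.
  move=> /kuhn_det_label_neq0[lab [j0 lab0]].
  have km : k = m.
    apply/ffunP => i; apply: val_inj => /=.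
    have [j [pj _]] := lab i; have := lab0 i.
    move: pj; rewrite fneg fE !ffunE.
    by case: (_ && _); case: (s i < j)%N; case: (s i < j0)%N; rewrite ?addn0 ?addn1; lia.
  split=> //; move: lab lab0; rewrite km => lab lab0; apply: perm_increasing.
  have mE i j : (m i < kuhn_vertex m s j i)%N = (s i < j)%N.
    by rewrite ffunE -{1}[m i : nat]addn0 ltn_add2l lt0b.
  move=> i i' ii'; have i'0 : i' == ord0 = false.
    by apply/negbTE/eqP => i'0; rewrite i'0 in ii'.
  have [bi|bi] := boolP ((i == ord0) && b).
    have := lab0 i; have := lab0 i'; rewrite !fneg !mE bi i'0 /= addbF addbT negbK.
    by rewrite -leqNgt => /[swap]; exact: leq_trans.
  have [j []] := lab i; rewrite fE mE (negbTE bi) addbF => sij /(_ _ ii').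
  by rewrite fneg mE i'0 addbF -leqNgt; exact: leq_trans.
rewrite /kuhn_sum (bigD1 m)//= [X in _ + X]big1 ?addr0 => [|k km]; last first.
  apply: big1 => s _; apply/eqP; rewrite mulf_eq0; apply/orP; right.
  by apply: contraNT km => /uniq[->].
rewrite (bigD1 1%g)//= [X in _ + X]big1 ?addr0 => [|s s1]; last first.
  apply/eqP; rewrite mulf_eq0; apply/orP; right.
  by apply: contraNT s1 => /uniq[_ ->].
rewrite odd_perm1 mul1r.
(* The matrix of the remaining simplex when [b] is false: vertex 0 is labelled by the origin and
   vertex j by the (j-1)-st unit vector. Reversing coordinate 0 exchanges the labels of vertices 0
   and 1. *)
pose T : 'M[int]_(n.+2) := \matrix_(j, l) ((l == ord0) || (j == l) : nat)%:Z.
have dT : \det T = 1.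
  rewrite det_trig; last first.
    apply/is_trig_mxP => i j ij; rewrite mxE.
    case: eqVneq => [j0|_]; first by rewrite j0 in ij.
    by rewrite -val_eqE ltn_eqF.
  by apply: big1 => i _; rewrite mxE eqxx orbT.
have labE (j : 'I_n.+2) (i : 'I_n.+1) :
    sign_label (f (kuhn_vertex m 1%g j)) ord0 i =
    ((j == (if (i == ord0) && b then 0 else i.+1) :> nat)%N : nat)%:Z.
  rewrite mxE fE ffunE perm1 -{1}[m i : nat]addn0 ltn_add2l lt0b.
  have -> : [forall i' : 'I_n.+1, (i < i')%N ==>
      (f (kuhn_vertex m 1%g j) ord0 i' < 0)] =
      [forall i' : 'I_n.+1, (i < i')%N ==> (j <= i')%N].
    apply: eq_forallb => i'; case: ltnP => //= ii'.
    have i'0 : i' == ord0 = false.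
      by apply/negbTE/eqP => i'0; rewrite i'0 in ii'.
    rewrite fneg ffunE perm1 -{1}[m i' : nat]addn0 ltn_add2l lt0b i'0 addbF.
    by rewrite -leqNgt.
  have -> : [forall i' : 'I_n.+1, (i < i')%N ==> (j <= i')%N] = (j <= i.+1)%N.
    apply/forallP/idP => [h|ji i']; last first.
      by apply/implyP; exact: leq_trans.
    have [iP|iP] := ltnP i.+1 n.+1; last by have := ltn_ord j; lia.
    by have /implyP := h (Ordinal iP); exact.
  have : (i == ord0) && b -> i = 0%N :> nat by case/andP => /eqP ->.
  move: ((i == ord0) && b) => c ci0; congr (nat_of_bool _)%:Z.
  case: c ci0 => [-> //|_]; first by rewrite addbT; case: (j : nat) => [|[]].
  by rewrite addbF; apply/andP/eqP; lia.
have [b1|b0] := boolP b; last first.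
  rewrite expr0 -dT; congr (\det _); apply/matrixP => j l; rewrite !mxE.
  case: splitP => [[[]//= ?] l0|l' /= l1].
    by rewrite mxE -!val_eqE /= l0.
  rewrite mxE labE (negbTE b0) andbF.
  rewrite -[l == ord0]val_eqE -[j == l]val_eqE /= l1 add1n /=.
  by [].
rewrite expr1 -dT.
have -> : - \det T = \det (xrow ord0 (lift ord0 ord0) T).
  by rewrite xrowE det_mulmx det_perm odd_tperm /= mulN1r.
congr (\det _); apply/matrixP => j l; rewrite !mxE.
case: splitP => [[[]//= ?] l0|l' /= l1].
  by rewrite mxE -!val_eqE /= l0.
rewrite mxE labE b1 andbT.
rewrite -[l == ord0]val_eqE -[_ == l]val_eqE /= l1 add1n /=.
case: tpermP => [->|->|/eqP j0 /eqP j1] /=.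
- by rewrite -[l' == ord0]val_eqE /=; case: (nat_of_ord l') => [|[|?]].
- by rewrite -[l' == ord0]val_eqE /=; case: (nat_of_ord l') => [|[|?]].
move: j0 j1; rewrite -!val_eqE /= => j0 j1.
by case: (nat_of_ord l') => [|?] //=; rewrite (negbTE j0) (negbTE j1).
Qed.

Lemma label_count_sign_mx (z : 'rV[R]_n.+1) (c : R) :
  (0 < N)%N -> `|z| < 1 -> c = 1 \/ c = - 1 ->
  label_count N (fun x => (x - z) *m block_mx (c%:M : 'M[R]_1) 0 0 1%:M) = sgz c.
Proof.
move=> N0 z1 c1; pose b := c < 0.
have NR : 0 < N%:R :> R by rewrite ltr0n.
(* For the reversed coordinate, [- (x - z)] is nonnegative exactly when [x - z] is not positive,
   hence the strict inequality in that case. *)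
pose p (i : 'I_n.+1) (v : nat) : bool :=
  let x := 2 * v%:R / N%:R - 1 - z ord0 i in
  if (i == ord0) && b then 0 < x else 0 <= x.
have pN i : p i N.
  rewrite /p /= mulfK ?(gt_eqF NR)//; have := le_lt_trans (rV_norm_coord z i) z1.
  rewrite ltr_norml. case: ((i == ord0) && b); lra.
have p0 i : p i 0%N = false.
  rewrite /p /= mulr0 mul0r; have := le_lt_trans (rV_norm_coord z i) z1.
  by rewrite ltr_norml; case: ((i == ord0) && b) => ?; apply/negbTE/negP => ?; lra.
have pinc i v v' : (v <= v')%N -> p i v -> p i v'.
  rewrite /p /= => vv'; have : 2 * v%:R / N%:R <= 2 * v'%:R / N%:R :> R.
    by rewrite ler_pM2r ?invr_gt0// ler_pM2l// ler_nat.
  by case: ((i == ord0) && b); lra.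
have /all_sig[m mP] (i : 'I_n.+1) : {m : 'I_N | forall v, p i v = (m < v)%N}.
  have ex : exists v, p i v by exists N.
  pose v0 := ex_minn ex.
  have [pv0 vmin] : p i v0 /\ forall v, p i v -> (v0 <= v)%N.
    by rewrite /v0; case: ex_minnP.
  have v0N : (v0.-1 < N)%N by have := vmin _ (pN i); lia.
  exists (Ordinal v0N) => v /=.
  have v00 : v0 != 0%N by apply: contraTneq pv0 => ->; rewrite p0.
  apply/idP/idP => [/vmin|]; first by lia.
  by move=> vv; apply: pinc pv0; lia.
rewrite /label_count (@kuhn_sum_threshold [ffun i => m i] b) => [|v i].
  by rewrite /b; case: c1 => ->; rewrite ?ltrN10 ?ltr10 ?sgz1 ?sgzN1// ltxx.
rewrite ffunE -mP /p /=.
pose y := grid_point R N v - z.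
have -> : (y *m block_mx (c%:M : 'M[R]_1) 0 0 1%:M) ord0 i =
    (if i == ord0 then c else 1) * y ord0 i.
  have := mul_row_block (lsubmx (y : 'rV[R]_(1 + n))) (rsubmx (y : 'rV[R]_(1 + n)))
    (c%:M : 'M[R]_1) 0 0 1%:M.
  rewrite hsubmxK !mulmx0 addr0 add0r mulmx1 mul_mx_scalar.
  move=> /(congr1 (fun M : 'rV[R]_(1 + n) => M ord0 i)) ->.
  rewrite mxE; case: splitP => [j i0|j i1]; rewrite !mxE.
    have -> : i = ord0 by apply: val_inj; rewrite /= i0; case: j {i0} => -[].
    by rewrite /=; congr (_ * (2 * (v _)%:R / _ - 1 - z _ _)); apply: val_inj;
       case: j {i0} => -[].
  have -> : i == ord0 = false by apply/negbTE; rewrite -val_eqE /= i1.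
  have -> : i = rshift 1 j by apply: val_inj.
  by rewrite mul1r.
rewrite !mxE; case: eqP => _ /=; last by rewrite mul1r addbF.
rewrite /b; case: c1 => -> /=; first by rewrite ltNge ler01 /= mul1r addbF.
by rewrite ltrN10 addbT mulN1r oppr_ge0 leNgt.
Qed.

End CountSigns.

Lemma near_all_seq (I : Type) (F : set_system I) (T : eqType) (s : seq T)
    (P : I -> T -> Prop) : Filter F ->
  (forall z, z \in s -> \forall i \near F, P i z) ->
  \forall i \near F, forall z, z \in s -> P i z.
Proof.
move=> FF; elim: s => [|a s IH] H; first by apply: filterE => i z; rewrite in_nil.
have Ha := H _ (mem_head _ _).
have Hs : \forall i \near F, forall z, z \in s -> P i z.
  by apply: IH => z zs; apply: H; rewrite in_cons zs orbT.
apply: filterS2 Ha Hs => i Pa Ps z; rewrite in_cons => /predU1P[->//|]; exact: Ps.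
Qed.

(** * Limits of matrices *)

Section MatrixLimits.
Variable R : realType.

Lemma mx_norm_coord m n (A : 'M[R]_(m, n)) i j : `|A i j| <= `|A|.
Proof.
rewrite [leRHS]/Num.Def.normr /= mx_normrE; apply/bigmax_geP; right => /=.
by exists (i, j).
Qed.

Lemma mx_norm_le m n (A : 'M[R]_(m, n)) (e : R) :
  0 <= e -> (forall i j, `|A i j| <= e) -> `|A| <= e.
Proof.
move=> e0 Ae; rewrite [leLHS]/Num.Def.normr /= mx_normrE.
by apply/bigmax_leP; split=> // -[i j] _ /=.
Qed.

Lemma mulmx_norm_le m n p (A : 'M[R]_(m, n)) (B : 'M[R]_(n, p)) :
  `|A *m B| <= n%:R * (`|A| * `|B|).
Proof.
apply: mx_norm_le => [|i j]; first by rewrite mulr_ge0// mulr_ge0.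
rewrite mxE (le_trans (ler_norm_sum _ _ _))//.
rewrite (le_trans (ler_sum _ (G := fun=> `|A| * `|B|) _))//.
  by move=> k _; rewrite normrM ler_pM// mx_norm_coord.
by rewrite sumr_const card_ord mulr_natl.
Qed.

Lemma cvg_mulmx (I : Type) (F : set_system I) {FF : Filter F} m n p
    (f : I -> 'M[R]_(m, n)) (g : I -> 'M[R]_(n, p))
    (A : 'M[R]_(m, n)) (B : 'M[R]_(n, p)) :
  f x @[x --> F] --> A -> g x @[x --> F] --> B -> f x *m g x @[x --> F] --> A *m B.
Proof.
move=> fA gB; apply/cvgrPdist_le => e e0.
pose c := n%:R * (`|A| + `|B| + 1) + 1.
have c0 : 0 < c by rewrite ltr_wpDl// mulr_ge0// !addr_ge0.
pose d := Num.min 1 (e / c / 2).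
have d0 : 0 < d by rewrite lt_min ltr01 !divr_gt0.
move/cvgrPdist_lt : fA => /(_ _ d0) fA; move/cvgrPdist_lt : gB => /(_ _ d0) gB.
apply: filterS2 fA gB => x fx gx.
have -> : A *m B - f x *m g x = (A - f x) *m g x + A *m (B - g x).
  by rewrite mulmxBl mulmxBr [RHS]addrC subrKA.
have gx1 : `|g x| <= `|B| + 1.
  have := ler_normD B (g x - B); rewrite addrC subrK => /le_trans; apply.
  rewrite lerD2l distrC; apply: ltW; apply: lt_le_trans gx _.
  by rewrite ge_min lexx.
rewrite (le_trans (ler_normD _ _))// (le_trans (lerD (mulmx_norm_le _ _) (mulmx_norm_le _ _)))//.
have n0 : 0 <= n%:R :> R by [].
have H1 : `|A - f x| * `|g x| <= d * (`|B| + 1) by rewrite ler_pM// ltW.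
have H2 : `|A| * `|B - g x| <= d * `|A| by rewrite mulrC ler_pM// ltW.
have dc : d * c <= e / 2.
  rewrite -ler_pdivlMr// mulrAC ge_min; apply/orP; right.
  by rewrite -!mulrA [c^-1 * _]mulrC.
have A0 := normr_ge0 A; have B0 := normr_ge0 B.
have H3 : n%:R * (`|A - f x| * `|g x|) + n%:R * (`|A| * `|B - g x|) <= d * c.
  rewrite -mulrDr (le_trans (ler_wpM2l n0 (lerD H1 H2)))//.
  have -> : d * c = n%:R * (d * (`|B| + 1) + d * `|A|) + d by rewrite /c; ring.
  by rewrite lerDl ltW.
apply: le_trans H3 _; apply: le_trans dc _; lra.
Qed.

Lemma continuous_mulmxr m n p (B : 'M[R]_(n, p)) :
  continuous (fun A : 'M[R]_(m, n) => A *m B).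
Proof.
move=> A; have H := cvg_mulmx (f := id) (g := fun=> B) (A := A) (FF := nbhs_filter A).
by apply: H => //; exact: cvg_cst.
Qed.

Lemma continuous_det n : continuous (fun A : 'M[R]_n => \det A).
Proof.
have cD (f g : 'M[R]_n -> R) : continuous f -> continuous g ->
    continuous (fun A => f A + g A).
  by move=> cf cg A; exact: (continuousD (cf A) (cg A)).
have cM (f g : 'M[R]_n -> R) : continuous f -> continuous g ->
    continuous (fun A => f A * g A).
  by move=> cf cg A; exact: (continuousM (cf A) (cg A)).
have cbig (I : Type) (s : seq I) (f : I -> 'M[R]_n -> R) :
    (forall i, continuous (f i)) -> continuous (fun A => \sum_(i <- s) f i A).
  move=> cf; elim: s => [|i s IH].
    by under eq_fun do rewrite big_nil; exact: cst_continuous.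
  by under eq_fun do rewrite big_cons; exact: cD.
have cprod (I : Type) (s : seq I) (f : I -> 'M[R]_n -> R) :
    (forall i, continuous (f i)) -> continuous (fun A => \prod_(i <- s) f i A).
  move=> cf; elim: s => [|i s IH].
    by under eq_fun do rewrite big_nil; exact: cst_continuous.
  by under eq_fun do rewrite big_cons; exact: cM.
apply: cbig => s; apply: cM; first exact: cst_continuous.
by apply: cprod => i; exact: coord_continuous.
Qed.

Lemma within_continuousP (V W : normedModType R) (A : set V) (f : V -> W) :
  {within A, continuous f} <->
  (forall x0, A x0 -> forall e, 0 < e ->
     \forall x \near x0, A x -> `|f x0 - f x| < e).
Proof.
rewrite subspace_continuousP; split=> H x Ax.
  by move=> e e0; have /cvgrPdist_lt/(_ _ e0) := H x Ax; rewrite near_withinE.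
apply/cvgrPdist_lt => e e0; rewrite near_withinE; exact: H.
Qed.

End MatrixLimits.

(** * Maps with a single nondegenerate zero *)

Section ZeroCount.
Variables (R : realType) (n : nat).
Notation cube := [set x : 'rV[R]_n.+1 | `|x| <= 1].
Implicit Types (w : 'rV[R]_n.+1 -> 'rV[R]_n.+1) (A : 'M[R]_n.+1).

Definition linear_part w (z : 'rV[R]_n.+1) A : Prop :=
  forall e : R, 0 < e -> \forall y \near z, `|w y - (y - z) *m A| <= e * `|y - z|.

Lemma mulmx_unit_eq0 A (x : 'rV[R]_n.+1) :
  A \in unitmx -> x *m A = 0 -> x = 0.
Proof. by move=> uA xA; rewrite -[x](mulmxK uA) xA mul0mx. Qed.

Lemma label_count_linear (z : 'rV[R]_n.+1) A : `|z| < 1 -> A \in unitmx ->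
  \forall N \near \oo,
    label_count N (fun x => (x - z) *m A) = sgz (\det A).
Proof.
move=> z1 uA.
have := @gl_path_sign _ n A uA => /(_ (fun X => \forall N \near \oo,
  label_count N (fun x => (x - z) *m A) = label_count N (fun x => (x - z) *m X))).
set D := block_mx _ _ _ _ => H.
suff H' : \forall N \near \oo,
    label_count N (fun x => (x - z) *m A) = label_count N (fun x => (x - z) *m D).
  near=> N; rewrite (near H' N)// label_count_sign_mx//.
  - rewrite sgz_sgr//.
  - by near: N; exact: nbhs_infty_gt.
  - have : \det A != 0 by rewrite -unitfE -unitmxE.
    by rewrite neq_lt => /orP[/ltr0_sg|/gtr0_sg] ->; [right|left].
apply: H; last exact: filterE.
move=> X Y XY AX; near=> N; rewrite (near AX N)//; near: N.
pose W (p : R * 'rV[R]_n.+1) := (p.2 - z) *m ((1 - p.1) *: X + p.1 *: Y).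
have W0 : (fun x => W (0, x)) = (fun x => (x - z) *m X).
  by apply/funext => x; rewrite /W /= subr0 scale1r scale0r addr0.
have W1 : (fun x => W (1, x)) = (fun x => (x - z) *m Y).
  by apply/funext => x; rewrite /W /= subrr scale1r scale0r add0r.
have := @label_count_homotopy R n W; rewrite W0 W1; apply.
  apply: continuous_subspaceT => p; apply: cvg_mulmx.
    by apply: cvgB; [exact: cvg_snd | exact: cvg_cst].
  apply: cvgD; apply: cvgZr_tmp.
    by apply: cvgB; [exact: cvg_cst | exact: cvg_fst].
  exact: cvg_fst.
move=> t x; rewrite /= in_itv /= => t01 x1; apply/eqP => /mulmx_unit_eq0.
move/(_ (XY _ t01))/eqP; rewrite subr_eq0 => /eqP xz.
by move: z1; rewrite -xz x1 ltxx.
Unshelve. all: by end_near. Qed.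

(** The homotopy [w (z + t (x - z)) / t] zooms in on the zero and extends to t = 0 by the linear
    part. As [z] is the only zero in the cube, it never vanishes on the boundary. *)
Lemma label_count_unique_zero w (z : 'rV[R]_n.+1) A :
  {within cube, continuous w} -> `|z| < 1 ->
  (forall x, cube x -> w x = 0 -> x = z) -> w z = 0 -> linear_part w z A ->
  A \in unitmx ->
  \forall N \near \oo, label_count N w = sgz (\det A).
Proof.
move=> cw z1 w0 wz wA uA.
pose W (p : R * 'rV[R]_n.+1) :=
  if p.1 == 0 then (p.2 - z) *m A else p.1^-1 *: w (z + p.1 *: (p.2 - z)).
have := @label_count_homotopy R n W.
have -> : (fun x => W (0, x)) = (fun x => (x - z) *m A).
  by apply/funext => x; rewrite /W eqxx.
have -> : (fun x => W (1, x)) = w.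
  apply/funext => x.
  by rewrite /W /= oner_eq0 invr1 !scale1r addrC subrK.
move=> H; suff : \forall N \near \oo, label_count N (fun x => (x - z) *m A) = label_count N w.
  by apply: filterS2 (label_count_linear z1 uA) => N -> ->.
have phiQ t x : 0 <= t <= 1 -> `|x| <= 1 -> `|z + t *: (x - z)| <= 1.
  move=> /andP[t0 t1] x1; have -> : z + t *: (x - z) = (1 - t) *: z + t *: x.
    by rewrite scalerBr scalerBl scale1r addrA addrAC.
  rewrite (le_trans (ler_normD _ _))// !normrZ (ger0_norm t0) ger0_norm ?subr_ge0//.
  by have := ltW z1; have := normr_ge0 z; have := normr_ge0 x; nra.
apply: H; last first.
  move=> t x; rewrite /= in_itv /= => t01 x1.
  have xz : x - z != 0.
    by apply/eqP => /subr0_eq xz; move: z1; rewrite -xz x1 ltxx.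
  rewrite /W /=; case: (eqVneq t 0) => [_|t0].
    by apply/eqP => /(mulmx_unit_eq0 uA) /eqP; rewrite (negbTE xz).
  rewrite scaler_eq0 invr_eq0 (negbTE t0) /=; apply/eqP => /w0.
  move=> /(_ (phiQ _ _ t01 _)); rewrite x1 lexx => /(_ isT) /eqP.
  by rewrite -subr_eq0 addrAC subrr add0r scaler_eq0 (negbTE t0) (negbTE xz).
apply/within_continuousP => -[t0 x0] [/= It0 Qx0] e e0.
move: (It0); rewrite in_itv /= => t01.
have [t00|t0N] := eqVneq t0 0; last first.
  pose y0 := z + t0 *: (x0 - z).
  pose phi (p : R * 'rV[R]_n.+1) := z + p.1 *: (p.2 - z).
  have cphi : phi p @[p --> (t0, x0)] --> y0.
    apply: cvgD; first exact: cvg_cst.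
    apply: cvgZ; first exact: cvg_fst.
    by apply: cvgB; [exact: cvg_snd | exact: cvg_cst].
  have cwphi : w (phi p) @[p --> within (`[0, 1]%classic `*` cube) (nbhs (t0, x0))]
      --> w y0.
    apply/cvgrPdist_lt => e' e'0; rewrite near_withinE.
    have : \forall y \near y0, cube y -> `|w y0 - w y| < e'.
      by move/within_continuousP : cw; apply => //; exact: phiQ.
    move=> /cphi Hc.
    have {}Hc : \forall p \near (t0, x0), cube (phi p) -> `|w y0 - w (phi p)| < e'.
      exact: Hc.
    apply: filterS Hc => -[t x] /= H [/= It Qx].
    by apply: H; apply: phiQ => //; move: It; rewrite in_itv.
  have cinv : (fun p : R * 'rV[R]_n.+1 => p.1^-1) p
      @[p --> within (`[0, 1]%classic `*` cube) (nbhs (t0, x0))] --> t0^-1.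
    by apply: cvg_within_filter; apply: cvgV => //; exact: cvg_fst.
  have H1 : p.1^-1 *: w (phi p) @[p --> within (`[0, 1]%classic `*` cube)
      (nbhs (t0, x0))] --> t0^-1 *: w y0 by exact: cvgZ.
  move/cvgrPdist_lt : H1 => /(_ _ e0); rewrite near_withinE => H1.
  have H2 : \forall p \near (t0, x0), p.1 != 0.
    exists ([set t | t != 0], setT) => /=; last by case=> t x [].
    by split; [exact: (open_nbhs_nbhs (conj (@open_neq _ 0) t0N)) | exact: filterT].
  apply: filterS2 H1 H2 => -[t x] /= H1 tN It.
  by rewrite /W /= (negbTE t0N) (negbTE tN); exact: H1.
rewrite t00 {t0 t00 It0 t01} /W eqxx.
have e4 : 0 < e / 4 by rewrite divr_gt0.
have /nbhs_normP[d /= d0 dw] := wA _ e4.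
have cA := @continuous_mulmxr R 1 _ _ A (x0 - z).
near=> p => -[/= It Qx].
have x2 : `|p.2 - z| <= 2.
  by rewrite (le_trans (ler_normB _ _))//; have := ltW z1; move: Qx => /= ?; lra.
have H1 : `|(x0 - z) *m A - (p.2 - z) *m A| < e / 4.
  near: p.
  have : (p.2 - z) *m A @[p --> (0 : R, x0)] --> (x0 - z) *m A.
    apply: cvg_mulmx; last exact: cvg_cst.
    by apply: cvgB; [exact: cvg_snd | exact: cvg_cst].
  by move=> /cvgrPdist_lt/(_ _ e4).
have H2 : `|p.1| < d / 3.
  near: p; have d3 : 0 < d / 3 by rewrite divr_gt0.
  exists ([set t : R | `|t| < d / 3], setT) => /=; last by case=> t x [].
  by split; [exact: (@nbhs0_lt R R^o _ d3) | exact: filterT].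
have [p0|p0] := eqVneq p.1 0; first by apply: lt_trans H1 _; lra.
have H3 : `|(p.2 - z) *m A - p.1^-1 *: w (z + p.1 *: (p.2 - z))| <= e / 4 * 2.
  have := dw (z + p.1 *: (p.2 - z)).
  rewrite /= opprD addNKr normrN [z + _]addrC addrK -[p.1 *: _ + z]addrC.
  set y := z + _; set v := p.2 - z in x2 y *.
  have -> : w y - p.1 *: v *m A = - (p.1 *: (v *m A - p.1^-1 *: w y)).
    by rewrite [in RHS]scalerBr scalerA divff// scale1r opprB -scalemxAl.
  rewrite normrN !normrZ => H; have {}/H : `|p.1| * `|v| < d.
    rewrite (le_lt_trans (ler_wpM2l _ x2))//.
    by have := normr_ge0 p.1; lra.
  rewrite mulrCA ler_pM2l ?normr_gt0//.
  by move=> /le_trans; apply; rewrite ler_pM2l.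
have -> : (x0 - z) *m A - p.1^-1 *: w (z + p.1 *: (p.2 - z)) =
  ((x0 - z) *m A - (p.2 - z) *m A) +
  ((p.2 - z) *m A - p.1^-1 *: w (z + p.1 *: (p.2 - z))) by rewrite subrKA.
by rewrite (le_lt_trans (ler_normD _ _))//; lra.
Unshelve. all: by end_near. Qed.

End ZeroCount.

(** * Additivity over several zeros *)

Section ZeroSum.
Variables (R : realType) (n : nat).
Notation cube := [set x : 'rV[R]_n.+1 | `|x| <= 1].
Implicit Types (w : 'rV[R]_n.+1 -> 'rV[R]_n.+1) (x y z : 'rV[R]_n.+1).

Definition clamp (z : 'rV[R]_n.+1) (r : R) (x : 'rV[R]_n.+1) : 'rV[R]_n.+1 :=
  \row_i Num.max (z ord0 i - r) (Num.min (x ord0 i) (z ord0 i + r)).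

Let clampE (a r b : R) : 0 <= r ->
  Num.max (a - r) (Num.min b (a + r)) =
  if b <= a - r then a - r else if b <= a + r then b else a + r.
Proof.
move=> r0; rewrite minEle maxEle.
by case: (leP b (a - r)); case: (leP b (a + r)); case: ifP; lra.
Qed.

Lemma clamp_le z r x : 0 <= r -> `|clamp z r x - z| <= r.
Proof.
move=> r0; apply: rV_norm_le => // i; rewrite !mxE clampE// ler_norml.
by case: (leP (x ord0 i) (z ord0 i - r)); case: (leP (x ord0 i) (z ord0 i + r)) => ? ?;
   apply/andP; split; lra.
Qed.

Lemma clamp_id z r x : `|x - z| <= r -> clamp z r x = x.
Proof.
move=> xr; have r0 : 0 <= r by apply: le_trans xr.
apply/rowP => i; rewrite !mxE clampE//.
have := le_trans (rV_norm_coord _ i) xr; rewrite !mxE ler_norml => /andP[? ?].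
by case: (leP (x ord0 i) (z ord0 i - r)); case: (leP (x ord0 i) (z ord0 i + r)) => ? ?; lra.
Qed.

Lemma clamp_lipschitz z r x y : 0 <= r -> `|clamp z r x - clamp z r y| <= `|x - y|.
Proof.
move=> r0; apply: rV_norm_le => // i; rewrite !mxE !clampE//.
have := rV_norm_coord (x - y) i; rewrite !mxE !ler_norml => /andP[? ?].
by case: (leP (x ord0 i) (z ord0 i - r)); case: (leP (x ord0 i) (z ord0 i + r));
   case: (leP (y ord0 i) (z ord0 i - r)); case: (leP (y ord0 i) (z ord0 i + r));
   move=> ? ? ? ?; apply/andP; split; lra.
Qed.

Lemma clamp_ge z r r' x : r' <= r -> 0 <= r -> r' <= `|x - z| ->
  r' <= `|clamp z r x - z|.
Proof.
move=> r'r r0; have [i ->] := rV_norm_attained (x - z).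
move=> H; apply: le_trans (rV_norm_coord _ i); move: H; rewrite !mxE clampE//.
rewrite !ler_normr.
by case: (leP (x ord0 i) (z ord0 i - r)); case: (leP (x ord0 i) (z ord0 i + r));
   move=> ? ? /orP[?|?]; apply/orP; try (by left; lra); try (by right; lra).
Qed.

(* The zeros are separated by replacing w with its compositions with the
   retractions onto small cubes around each zero. *)
Theorem label_count_zeros w (Z : seq 'rV[R]_n.+1) (A : 'rV[R]_n.+1 -> 'M[R]_n.+1) :
  {within cube, continuous w} -> uniq Z ->
  (forall x, cube x -> w x = 0 -> x \in Z) ->
  (forall z, z \in Z -> [/\ `|z| < 1, w z = 0, linear_part w z (A z) &
                            A z \in unitmx]) ->
  \forall N \near \oo, label_count N w = \sum_(z <- Z) sgz (\det (A z)).
Proof.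
move=> cw uZ w0 Zw.
have : \forall r \near 0^'+, forall z, z \in Z -> `|z| + r <= 1 /\
    (forall z', z' \in Z -> z' != z -> 2 * r < `|z - z'|).
  apply: near_all_seq => z zZ; have [z1 _ _ _] := Zw z zZ.
  have H1 : \forall r \near 0^'+, `|z| + r <= 1.
    near=> r; rewrite addrC -lerBrDr; near: r.
    by apply: nbhs_right_le; rewrite subr_gt0.
  have H2 : \forall r \near 0^'+, forall z', z' \in Z -> z' != z -> 2 * r < `|z - z'|.
    apply: near_all_seq => z' _; have [->|zz'] := eqVneq z' z; first exact: filterE.
    near=> r => _; rewrite mulrC -ltr_pdivlMr//; near: r; apply: nbhs_right_lt.
    by rewrite divr_gt0// normr_gt0 subr_eq0 eq_sym.
  exact: filterS2 H1 H2.
move=> /(filterI (nbhs_right_gt 0))/filter_ex[r [/= r0 rZ]].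
have r2 : 0 < r / 2 by rewrite divr_gt0.
pose wz z x := w (clamp z r x).
have clampQ z x : z \in Z -> cube (clamp z r x).
  move=> zZ /=; rewrite -(subrK z (clamp z r x)) (le_trans (ler_normD _ _))//.
  rewrite addrC; have [+ _] := rZ z zZ; apply: le_trans.
  by rewrite lerD2l clamp_le// ltW.
have Hz : \forall N \near \oo, forall z, z \in Z ->
    label_count N (wz z) = sgz (\det (A z)).
  apply: near_all_seq => z zZ; have [z1 wz0 Az uz] := Zw z zZ.
  apply: (label_count_unique_zero (z := z)) => //.
  - apply/within_continuousP => x0 Qx0 e e0.
    have := compact_unif_continuous (@compact_cube R n) cw e0.
    move=> /(filterI (nbhs_right_gt 0))/filter_ex[d [/= d0 dw]].
    have xd : \forall x \near x0, `|x0 - x| < d.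
      by apply/nbhs_normP; exists d.
    apply: filterS xd => x xd Qx.
    apply: dw; [exact: clampQ|exact: clampQ|].
    by apply: le_lt_trans xd; apply: clamp_lipschitz; exact: ltW.
  - move=> x Qx wx; apply: contrapT => /eqP xz.
    have cZ : clamp z r x \in Z by apply: w0 => //; exact: clampQ.
    have [_ /(_ _ cZ)] := rZ z zZ.
    have [cz _|cz /(_ isT)] := eqVneq (clamp z r x) z; last first.
      rewrite distrC ltNge (le_trans (clamp_le _ _ _)) ?(ltW r0)//; lra.
    have xz0 : 0 < `|x - z| by rewrite normr_gt0 subr_eq0.
    have := @clamp_ge z r (Num.min r `|x - z|) x.
    rewrite !ge_min !lexx orbT (ltW r0) cz subrr normr0 => /(_ isT isT isT).
    by rewrite !leNgt r0 xz0.
  - by rewrite /wz clamp_id// subrr normr0 ltW.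
  move=> e e0; have := Az e e0.
  have zr : \forall y \near z, `|y - z| < r.
    by apply/nbhs_normP; exists r => // y /=; rewrite distrC.
  by apply: filterS2 zr => y yr; rewrite /wz clamp_id// ltW.
(* On this compact set [w] is bounded away from 0, so no simplex with a vertex in it is counted when
   the mesh is fine. *)
pose C := cube `&` [set x | forall z, z \in Z -> r / 2 <= `|x - z|].
have cC : compact C.
  apply: compact_closedI; first exact: compact_cube.
  have -> : [set x | forall z, z \in Z -> r / 2 <= `|x - z|] =
     \bigcap_(z in [set z | z \in Z]) [set x | r / 2 <= `|x - z|].
    by apply/seteqP; split => x /= H z; exact: H.
  apply: closed_bigI => z _.
  apply: (@closed_comp _ _ (fun x : 'rV[R]_n.+1 => `|x - z|) [set t | r / 2 <= t]).
    move=> x _; apply: continuous_comp; last exact: norm_continuous.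
    by apply: continuousB; [exact: cvg_id | exact: cst_continuous].
  exact: closed_ge.
have : \forall e \near 0^'+, forall x, C x -> e < `|w x|.
  apply: compact_norm_gt => //.
    by apply: continuous_subspaceW cw => x [].
  move=> x [Qx xZ]; apply/eqP => /(w0 _ Qx)/xZ; rewrite subrr normr0; lra.
move=> /(filterI (nbhs_right_gt 0))/filter_ex[e [/= e0 eC]].
have := compact_unif_continuous (@compact_cube R n) cw e0.
move=> /(filterI (nbhs_right_gt 0))/filter_ex[d [/= d0 dw]].
near=> N.
have N0 : (0 < N)%N by near: N; exact: nbhs_infty_gt.
have Nd : 2 / N%:R < d by near: N; exact: mesh_lt.
have Nr : 2 / N%:R < r / 2 by near: N; exact: mesh_lt.
transitivity (\sum_(z <- Z) label_count N (wz z)); last first.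
  by apply: eq_big_seq => z zZ; rewrite (near Hz N).
rewrite /label_count /kuhn_sum [RHS]exchange_big /=; apply: eq_bigr => k _.
rewrite [RHS]exchange_big /=; apply: eq_bigr => s _; rewrite -mulr_sumr; congr (_ * _).
pose v j := grid_point R N (kuhn_vertex k s j).
have vQ j : cube (v j) by apply: grid_point_cube => // l; exact: kuhn_vertex_le.
have vd j j' : `|v j - v j'| <= 2 / N%:R by exact: grid_point_dist.
have zeroz z : z \in Z -> r / 2 <= `|v 0%N - z| ->
    kuhn_det (fun u => sign_label (wz z (grid_point R N u))) k s = 0.
  move=> zZ vz; apply: contrapT => /eqP k0.
  have /(_ ord0) : forall j : 'I_n.+2, `|wz z (v j)| <= e.
    apply: (kuhn_det_label_small (f := fun u => wz z (grid_point R N u)) k0).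
    move=> j j'; apply: ltW; apply: dw; [exact: clampQ|exact: clampQ|].
    apply: le_lt_trans Nd; apply: le_trans (vd j j').
    by apply: clamp_lipschitz; exact: ltW.
  rewrite leNgt => /negP; apply; apply: eC; split; first exact: clampQ.
  move=> z' z'Z; have [->|z'z] := eqVneq z' z.
    by apply: clamp_ge => //; lra.
  have [_ /(_ _ z'Z z'z)] := rZ z zZ.
  have := clamp_le z (v 0%N) (ltW r0).
  have := ler_normB (z' - clamp z r (v 0%N)) (z - clamp z r (v 0%N)).
  rewrite opprB addrA subrK distrC [`|z' - clamp _ _ _|]distrC [`|z - clamp _ _ _|]distrC.
  by move=> *; lra.
(* The identity holds simplex by simplex. Near a zero [z0], retracting towards [z0] fixes the
   vertices and the other retractions contribute 0; away from all the zeros every term vanishes. *)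
have [[z0 z0Z vz0]|H] := pselect (exists2 z, z \in Z & `|v 0%N - z| < r / 2).
  rewrite (bigD1_seq z0)//= big1_seq ?addr0 => [|z /andP[zz0 zZ]]; last first.
    apply: zeroz => //; have [_ /(_ _ zZ zz0)] := rZ z0 z0Z.
    have := ler_normB (v 0%N - z) (v 0%N - z0).
    by rewrite opprB addrC subrKA => *; lra.
  congr (\det _); apply/matrixP => a b; rewrite !mxE.
  case: splitP => // c _; rewrite !mxE /wz clamp_id//.
  rewrite -(subrKA (v 0%N)) (le_trans (ler_normD _ _))// (splitr r).
  by apply: lerD; [apply: le_trans (vd _ _) _; exact: ltW|exact: ltW].
rewrite big1_seq => [|z /andP[_ zZ]]; last first.
  by apply: zeroz => //; rewrite leNgt; apply/negP => ?; apply: H; exists z.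
apply: contrapT => /eqP k0.
have /(_ ord0) : forall j : 'I_n.+2, `|w (v j)| <= e.
  apply: (kuhn_det_label_small (f := fun u => w (grid_point R N u)) k0).
  move=> j j'; apply: ltW; apply: dw; [exact: vQ|exact: vQ|].
  exact: le_lt_trans (vd j j') Nd.
rewrite leNgt => /negP; apply; apply: eC; split; first exact: vQ.
by move=> z zZ; rewrite leNgt; apply/negP => ?; apply: H; exists z.
Unshelve. all: by end_near. Qed.

End ZeroSum.

(** * Jacobians and C^1 maps *)

Section Jacobian.
Variable R : realType.

(** Vectors are rows and matrices act on the right, so the chain rule multiplies Jacobians in the
    order in which the maps are applied. *)
Definition has_jacobian m n (f : 'rV[R]_m -> 'rV[R]_n) (x : 'rV[R]_m)
    (A : 'M[R]_(m, n)) : Prop :=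
  forall e : R, 0 < e ->
    \forall y \near x, `|f y - f x - (y - x) *m A| <= e * `|y - x|.

Lemma differentiable_eps (V W : normedModType R) (f : V -> W)
    (L : {linear V -> W}) (x : V) : continuous L ->
  (forall e : R, 0 < e ->
     \forall y \near x, `|f y - f x - L (y - x)| <= e * `|y - x|) ->
  differentiable f x /\ 'd f x = L :> (V -> W).
Proof.
move=> cL fA.
have fL : f \o shift x = cst (f x) + L +o_ 0 id.
  apply/eqaddoP => e e0; have /nbhs_normP[d /= d0 dH] := fA e e0.
  apply/nbhs_normP; exists d => //= h; rewrite /= sub0r normrN => hd.
  have /= := dH (h + x); rewrite /= opprD addrCA subrr addr0 normrN addrK => /(_ hd).
  rewrite -[X in _ -> `|X| <= _]/(f (h + x) - (f x + L h)).
  by rewrite opprD addrA.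
have dL := diff_unique cL fL.
by split=> //; apply/diff_locallyP; rewrite dL.
Qed.

Lemma differentiable_epsV (V W : normedModType R) (f : V -> W) (x : V) :
  differentiable f x -> forall e : R, 0 < e ->
    \forall y \near x, `|f y - f x - 'd f x (y - x)| <= e * `|y - x|.
Proof.
move=> /diff_locallyP[_ /eqaddoP H] e e0.
have /nbhs_normP[d /= d0 dH] := H e e0.
apply/nbhs_normP; exists d => //= y; rewrite /= => xy.
have /= := dH (y - x); rewrite /= sub0r normrN distrC => /(_ xy).
rewrite -[X in `|X| <= _ -> _]/(f (y - x + x) - (f x + 'd f x (y - x))).
by rewrite subrK opprD addrA.
Qed.

Lemma mulmx_jacobian m n (f : 'rV[R]_m -> 'rV[R]_n) x v :
  v *m 'J f x = 'd f x v.
Proof. by rewrite /jacobian mul_rV_lin1. Qed.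

Lemma eq_mulmx m n (A B : 'M[R]_(m, n)) :
  (forall v : 'rV[R]_m, v *m A = v *m B) -> A = B.
Proof. by move=> AB; apply/row_matrixP => i; rewrite !rowE. Qed.

Lemma differentiable_has_jacobian m n (f : 'rV[R]_m -> 'rV[R]_n) x :
  differentiable f x -> has_jacobian f x ('J f x).
Proof.
move=> /differentiable_epsV H e e0; apply: filterS (H e e0) => y.
by rewrite mulmx_jacobian.
Qed.

Lemma has_jacobian_differentiable m n (f : 'rV[R]_m -> 'rV[R]_n) x A :
  has_jacobian f x A -> differentiable f x /\ 'J f x = A.
Proof.
move=> fA.
pose L : {linear 'rV[R]_m -> 'rV[R]_n} := mulmxr A.
have cL : continuous L by move=> y; exact: continuous_mulmxr.
have [df dL] := differentiable_eps cL fA.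
by split=> //; apply: eq_mulmx => v; rewrite mulmx_jacobian dL.
Qed.

Lemma has_jacobian_unique m n (f : 'rV[R]_m -> 'rV[R]_n) x A :
  has_jacobian f x A -> 'J f x = A.
Proof. by case/has_jacobian_differentiable. Qed.

Lemma has_jacobian_continuous m n (f : 'rV[R]_m -> 'rV[R]_n) x A :
  has_jacobian f x A -> {for x, continuous f}.
Proof. by case/has_jacobian_differentiable => /differentiable_continuous. Qed.

Lemma has_jacobian_near m n (f g : 'rV[R]_m -> 'rV[R]_n) x A :
  (\forall y \near x, f y = g y) -> has_jacobian f x A -> has_jacobian g x A.
Proof.
move=> fg fA e e0; have fgx := nbhs_singleton fg.
by apply: filterS2 fg (fA e e0) => y <-; rewrite fgx.
Qed.

Lemma has_jacobian_cst m n (c : 'rV[R]_n) (x : 'rV[R]_m) :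
  has_jacobian (fun=> c) x 0.
Proof.
move=> e e0; apply: filterE => y.
by rewrite subrr mulmx0 subr0 normr0 mulr_ge0// ltW.
Qed.

Lemma has_jacobian_mulmxr m n (A : 'M[R]_(m, n)) (x : 'rV[R]_m) :
  has_jacobian (fun y => y *m A) x A.
Proof.
move=> e e0; apply: filterE => y.
by rewrite mulmxBl subrr normr0 mulr_ge0// ltW.
Qed.

Lemma has_jacobian_id m (x : 'rV[R]_m) : has_jacobian id x 1%:M.
Proof.
have := @has_jacobian_mulmxr m m 1%:M x; apply: has_jacobian_near.
by apply: filterE => y; rewrite mulmx1.
Qed.

Lemma has_jacobianD m n (f g : 'rV[R]_m -> 'rV[R]_n) x A B :
  has_jacobian f x A -> has_jacobian g x B ->
  has_jacobian (fun y => f y + g y) x (A + B).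
Proof.
move=> fA gB e e0; have e2 : 0 < e / 2 by rewrite divr_gt0.
apply: filterS2 (fA _ e2) (gB _ e2) => y fy gy.
rewrite mulmxDr !opprD [f y + _ + _]addrACA (addrACA (f y - f x)).
apply: le_trans (ler_normD _ _) _; rewrite (splitr e) mulrDl.
exact: lerD fy gy.
Qed.

Lemma has_jacobianZ m n (f : 'rV[R]_m -> 'rV[R]_n) (c : R) x A :
  has_jacobian f x A -> has_jacobian (fun y => c *: f y) x (c *: A).
Proof.
move=> fA e e0; have ec : 0 < e / (`|c| + 1) by rewrite divr_gt0// ltr_wpDl.
apply: filterS (fA _ ec) => y fy.
rewrite -scalemxAr -!scalerBr normrZ.
rewrite (le_trans (ler_wpM2l _ fy))// mulrA ler_wpM2r//.
rewrite mulrCA ler_piMr ?(ltW e0)// ler_pdivrMr ?mul1r ?ltr_wpDl//.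
by rewrite lerDl.
Qed.

Lemma has_jacobianN m n (f : 'rV[R]_m -> 'rV[R]_n) x A :
  has_jacobian f x A -> has_jacobian (fun y => - f y) x (- A).
Proof.
move=> fA; have := has_jacobianZ (-1) fA; rewrite scaleN1r.
apply: has_jacobian_near.
by apply: filterE => y; rewrite scaleN1r.
Qed.

Lemma has_jacobianB m n (f g : 'rV[R]_m -> 'rV[R]_n) x A B :
  has_jacobian f x A -> has_jacobian g x B ->
  has_jacobian (fun y => f y - g y) x (A - B).
Proof. by move=> fA gB; apply: has_jacobianD => //; exact: has_jacobianN. Qed.

Lemma has_jacobian_comp m n p (f : 'rV[R]_m -> 'rV[R]_n)
    (g : 'rV[R]_n -> 'rV[R]_p) x A B :
  has_jacobian f x A -> has_jacobian g (f x) B ->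
  has_jacobian (g \o f) x (A *m B).
Proof.
move=> /has_jacobian_differentiable[df <-] /has_jacobian_differentiable[dg <-].
have dgf : differentiable (g \o f) x by exact: differentiable_comp.
rewrite (_ : _ *m _ = 'J (g \o f) x); first exact: differentiable_has_jacobian.
by apply: eq_mulmx => v; rewrite mulmxA !mulmx_jacobian [in RHS]diff_comp.
Qed.

Lemma has_jacobian_lipschitz m n (f : 'rV[R]_m -> 'rV[R]_n) x A :
  has_jacobian f x A ->
  \forall y \near x, `|f y - f x| <= (m%:R * `|A| + 1) * `|y - x|.
Proof.
move=> /(_ 1 ltr01); apply: filterS => y.
have := ler_normD (f y - f x - (y - x) *m A) ((y - x) *m A); rewrite subrK.
move=> /le_trans H h; apply: H; rewrite mulrDl addrC lerD//.
by rewrite (le_trans (mulmx_norm_le _ _))// mulrA mulrAC.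
Qed.

(* Scalar functions are seen as maps into 1 x 1 matrices. *)
Lemma has_jacobian_scale m n (s : 'rV[R]_m -> R) (f : 'rV[R]_m -> 'rV[R]_n) x S A :
  has_jacobian (fun y => (s y)%:M) x S -> has_jacobian f x A ->
  has_jacobian (fun y => s y *: f y) x (S *m f x + s x *: A).
Proof.
move=> sS fA e e0.
pose K := m%:R * `|S| + 1; have K0 : 0 <= K by rewrite addr_ge0// mulr_ge0.
pose c := `|s x| + `|f x| + K + 1.
have c0 : 0 < c by rewrite ltr_wpDl// !addr_ge0.
have ec : 0 < e / c by rewrite divr_gt0.
have cf : \forall y \near x, `|f y - f x| <= e / c.
  have /cvgrPdist_le/(_ _ ec) := has_jacobian_continuous fA.
  by apply: filterS => y; rewrite distrC.
have sx := has_jacobian_lipschitz sS.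
apply: filterS3 (sS _ ec) (fA _ ec) (filterI sx cf).
move=> y sy fy [sxy fxy].
have -> : s y *: f y - s x *: f x - (y - x) *m (S *m f x + s x *: A) =
    ((s y)%:M - (s x)%:M - (y - x) *m S) *m f x +
    s x *: (f y - f x - (y - x) *m A) + ((s y)%:M - (s x)%:M : 'M[R]_1) *m (f y - f x).
  rewrite !mulmxBl !mulmxDr ?mulmxBr !mul_scalar_mx !mulmxA -!scalemxAr !scalerBr.
  move: (y *m S *m f x) (x *m S *m f x) (y *m A) (x *m A) => p q r t.
  apply/matrixP => i j; rewrite !mxE. ring.
rewrite (le_trans (ler_normD _ _))// (le_trans (lerD (ler_normD _ _) (lexx _)))//.
have -> : e = e / c * `|f x| + e / c * `|s x| + e / c * K + e / c.
  by rewrite -[LHS](divfK (lt0r_neq0 c0)) {2}/c; ring.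
have yx0 := normr_ge0 (y - x); have ec0 := ltW ec.
have H1 (a : 'M[R]_1) (v : 'rV[R]_n) : `|a *m v| <= `|a| * `|v|.
  by rewrite (le_trans (mulmx_norm_le _ _))// mul1r.
have H2 : 0 <= e / c * `|y - x| by rewrite mulr_ge0.
rewrite !mulrDl -[leLHS]addr0; apply: lerD; last exact: H2.
apply: lerD; [apply: lerD|].
- by apply: le_trans (H1 _ _) _; rewrite [leRHS]mulrAC; exact: ler_wpM2r.
- by rewrite normrZ mulrC [leRHS]mulrAC; exact: ler_wpM2r.
- apply: le_trans (H1 _ _) _; rewrite [leRHS]mulrAC -mulrA [leRHS]mulrC.
  by apply: ler_pM => //; rewrite mulrC.
Qed.

End Jacobian.

Section RealDerivative.
Variable R : realType.

Lemma is_derive_eps (h : R -> R) (s d : R) :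
  (forall e : R, 0 < e ->
     \forall t \near s, `|h t - h s - d * (t - s)| <= e * `|t - s|) ->
  is_derive s 1 h d.
Proof.
move=> hd.
have cv : k^-1 *: (h (k *: (1 : R) + s) - h s) @[k --> 0^'] --> d.
  apply/cvgrPdist_le => e e0; have /nbhs_normP[r /= r0 H] := hd e e0.
  rewrite near_withinE; apply/nbhs_normP; exists r => //= k.
  rewrite /= sub0r normrN => kr k0.
  have := H (k *: (1 : R) + s).
  rewrite /= opprD addrCA subrr addr0 normrN addrK [k *: _]mulr1.
  move=> /(_ kr) => Hk; rewrite -(ler_pM2r (x := `|k|)) ?normr_gt0//.
  rewrite -[k^-1 *: _]/(k^-1 * _) distrC -normrM mulrBl mulrAC mulVf// mul1r.
  by [].
apply: DeriveDef; first by apply/cvg_ex; exists d.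
exact: cvg_lim cv.
Qed.

Lemma is_derive_epsV (h : R -> R) (s d : R) : is_derive s 1 h d ->
  forall e : R, 0 < e ->
     \forall t \near s, `|h t - h s - d * (t - s)| <= e * `|t - s|.
Proof.
move=> hd e e0; have dh : derivable h s 1 by [].
have /derivable1_diffP/differentiable_epsV/(_ e e0) := dh.
apply: filterS => t; rewrite deriv1E// derive1E (@derive_val _ _ _ _ _ _ _ hd).
by rewrite -[_ *: _]/(_ * _) mulrC.
Qed.

(** A $C^1$ function that vanishes on a half-line, from which the cutoffs are built. *)
Definition sqpos (t : R) : R := Num.max 0 t ^+ 2.

Lemma is_derive_sqpos (s : R) : is_derive s 1 sqpos (2 * Num.max 0 s).
Proof.
apply: is_derive_eps => e e0; apply/nbhs_normP; exists e => // t /=.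
rewrite distrC => te.
have H : `|sqpos t - sqpos s - 2 * Num.max 0 s * (t - s)| <= (t - s) ^+ 2.
  rewrite /sqpos !maxEle ler_norml.
  have sq := sqr_ge0 (t - s); have sq' := sqr_ge0 s; have sq2 := sqr_ge0 t.
  case: (leP 0 t) => t0; case: (leP 0 s) => s0 /=; apply/andP.
  - by split; nra.
  - by have : 0 <= t * (- s) by [rewrite mulr_ge0// oppr_ge0 ltW]; split; nra.
  - by have : 0 <= (- t) * s by [rewrite mulr_ge0// oppr_ge0 ltW]; split; nra.
  - by split; nra.
apply: le_trans H _; rewrite -real_normK ?num_real// expr2 ler_wpM2r//.
exact: ltW.
Qed.

End RealDerivative.

(** * Calculus of $C^1$ maps *)

Section C1.
Variable R : realType.

Lemma C1_atP m n (f : 'rV[R]_m -> 'rV[R]_n) p :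
  C1_at f p -> \forall q \near p,
    has_jacobian f q ('J f q) /\ {for q, continuous (jacobian f)}.
Proof.
by apply: filterS => q [df cf]; split=> //; exact: differentiable_has_jacobian.
Qed.

Lemma C1_at_intro m n (f : 'rV[R]_m -> 'rV[R]_n) p (A : 'rV[R]_m -> 'M[R]_(m, n)) :
  (\forall q \near p, has_jacobian f q (A q) /\ {for q, continuous A}) -> C1_at f p.
Proof.
move=> fA; near=> q; split.
  by have [/has_jacobian_differentiable[]] : has_jacobian f q (A q) /\
    {for q, continuous A} by near: q.
have E : \forall y \near q, A y = 'J f y.
  have : \forall y \near q, has_jacobian f y (A y) /\ {for y, continuous A}.
    by near: q; exact: (near_join fA).
  by apply: filterS => y [/has_jacobian_unique].
have [_ cA] : has_jacobian f q (A q) /\ {for q, continuous A} by near: q.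
have Eq := nbhs_singleton E.
rewrite /prop_for /continuous_at -Eq.
exact: (cvg_trans (near_eq_cvg E) cA).
Unshelve. all: by end_near. Qed.

Lemma C1_at_near m n (f g : 'rV[R]_m -> 'rV[R]_n) p :
  (\forall y \near p, f y = g y) -> C1_at f p -> C1_at g p.
Proof.
move=> /near_join fg /C1_atP fp; apply: (@C1_at_intro _ _ _ _ (jacobian f)).
apply: filterS2 fg fp => q fg [fq cq]; split=> //.
exact: has_jacobian_near fq.
Qed.

Lemma C1_at_nbhs m n (f : 'rV[R]_m -> 'rV[R]_n) p :
  C1_at f p -> \forall q \near p, C1_at f q.
Proof. exact: near_join. Qed.

Lemma C1_at_jacobian m n (f : 'rV[R]_m -> 'rV[R]_n) p :
  C1_at f p -> has_jacobian f p ('J f p).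
Proof. by move=> /C1_atP/nbhs_singleton[]. Qed.

Lemma C1_at_cjacobian m n (f : 'rV[R]_m -> 'rV[R]_n) p :
  C1_at f p -> {for p, continuous (jacobian f)}.
Proof. by move=> /nbhs_singleton[]. Qed.

Lemma C1_at_continuous m n (f : 'rV[R]_m -> 'rV[R]_n) p :
  C1_at f p -> {for p, continuous f}.
Proof. by move=> /C1_at_jacobian/has_jacobian_continuous. Qed.

Lemma C1_at_mulmxr m n (A : 'M[R]_(m, n)) p : C1_at (fun x => x *m A) p.
Proof.
apply: (@C1_at_intro _ _ _ _ (fun=> A)); apply: filterE => q; split.
  exact: has_jacobian_mulmxr.
exact: cst_continuous.
Qed.

Lemma C1_at_id m (p : 'rV[R]_m) : C1_at id p.
Proof.
apply: (@C1_at_intro _ _ _ _ (fun=> 1%:M)); apply: filterE => q; split.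
  exact: has_jacobian_id.
exact: cst_continuous.
Qed.

Lemma C1_at_cst m n (c : 'rV[R]_n) (p : 'rV[R]_m) : C1_at (fun=> c) p.
Proof.
apply: (@C1_at_intro _ _ _ _ (fun=> 0)); apply: filterE => q; split.
  exact: has_jacobian_cst.
exact: cst_continuous.
Qed.

Lemma C1_atD m n (f g : 'rV[R]_m -> 'rV[R]_n) p :
  C1_at f p -> C1_at g p -> C1_at (fun x => f x + g x) p.
Proof.
move=> /C1_atP fp /C1_atP gp.
apply: (@C1_at_intro _ _ _ _ (fun x => 'J f x + 'J g x)).
apply: filterS2 fp gp => q [fq cfq] [gq cgq]; split; first exact: has_jacobianD.
exact: (continuousD cfq cgq).
Qed.

Lemma C1_atZ m n (c : R) (f : 'rV[R]_m -> 'rV[R]_n) p :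
  C1_at f p -> C1_at (fun x => c *: f x) p.
Proof.
move=> /C1_atP fp; apply: (@C1_at_intro _ _ _ _ (fun x => c *: 'J f x)).
apply: filterS fp => q [fq cfq]; split; first exact: has_jacobianZ.
exact: (continuousZl_tmp cfq).
Qed.

Lemma C1_atN m n (f : 'rV[R]_m -> 'rV[R]_n) p :
  C1_at f p -> C1_at (fun x => - f x) p.
Proof.
move=> /(C1_atZ (-1)); apply: C1_at_near.
by apply: filterE => y; rewrite scaleN1r.
Qed.

Lemma C1_atB m n (f g : 'rV[R]_m -> 'rV[R]_n) p :
  C1_at f p -> C1_at g p -> C1_at (fun x => f x - g x) p.
Proof. move=> fp gp; exact: (C1_atD fp (C1_atN gp)). Qed.

Lemma C1_at_comp m n p (f : 'rV[R]_m -> 'rV[R]_n) (g : 'rV[R]_n -> 'rV[R]_p) q :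
  C1_at f q -> C1_at g (f q) -> C1_at (g \o f) q.
Proof.
move=> fq /C1_atP gq; have cf := C1_at_continuous fq; move/C1_atP : fq => fq.
have gf := cf _ gq; rewrite nbhs_simpl /= in gf.
apply: (@C1_at_intro _ _ _ _ (fun x => 'J f x *m 'J g (f x))).
apply: filterS2 fq gf => x [fx cfx] [gx cgx]; split; first exact: has_jacobian_comp.
have cfx' : {for x, continuous f} by exact: has_jacobian_continuous fx.
have H : {for x, continuous (jacobian g \o f)} by exact: continuous_comp cfx' cgx.
exact: (cvg_mulmx (FF := nbhs_filter x) cfx H).
Qed.

Lemma continuous_scalar_mx (T : topologicalType) (s : T -> R) (x : T) :
  {for x, continuous (fun y => (s y)%:M : 'rV[R]_1)} -> {for x, continuous s}.
Proof.
move=> cs.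
have -> : s = (fun M : 'rV[R]_1 => M ord0 ord0) \o (fun y => (s y)%:M : 'rV[R]_1).
  by apply/funext => y /=; rewrite mxE eqxx mulr1n.
by apply: continuous_comp; [exact: cs | exact: coord_continuous].
Qed.

Lemma continuous_scalar_mxV (T : topologicalType) (s : T -> R) (x : T) :
  {for x, continuous s} -> {for x, continuous (fun y => (s y)%:M : 'rV[R]_1)}.
Proof.
move=> /cvgrPdist_le cs; apply/cvgrPdist_le => e e0; apply: filterS (cs e e0) => w H.
apply: mx_norm_le => [|i j]; first exact: ltW.
by rewrite (ord1 i) (ord1 j) !mxE eqxx !mulr1n.
Qed.

Lemma C1_at_scale m n (s : 'rV[R]_m -> R) (f : 'rV[R]_m -> 'rV[R]_n) p :
  C1_at (fun y => (s y)%:M : 'rV[R]_1) p -> C1_at f p -> C1_at (fun y => s y *: f y) p.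
Proof.
move=> /C1_atP sp /C1_atP fp.
pose S y : 'rV[R]_1 := (s y)%:M.
apply: (@C1_at_intro _ _ _ _ (fun x => 'J S x *m f x + s x *: 'J f x)).
apply: filterS2 sp fp => q [sq csq] [fq cfq]; split.
  exact: has_jacobian_scale.
have cs : {for q, continuous s}.
  by apply: continuous_scalar_mx; exact: has_jacobian_continuous sq.
have cf : {for q, continuous f} by exact: has_jacobian_continuous fq.
have c1 : {for q, continuous (fun x => 'J S x *m f x)}.
  exact: (cvg_mulmx (FF := nbhs_filter q) csq cf).
have c2 : {for q, continuous (fun x => s x *: 'J f x)}.
  exact: (continuousZ cs cfq).
exact: (continuousD c1 c2).
Qed.

Lemma C1_at_scalarM m (s t : 'rV[R]_m -> R) p :
  C1_at (fun y => (s y)%:M : 'rV[R]_1) p -> C1_at (fun y => (t y)%:M : 'rV[R]_1) p ->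
  C1_at (fun y => (s y * t y)%:M : 'rV[R]_1) p.
Proof.
move=> sp tp; have := C1_at_scale sp tp; apply: C1_at_near.
by apply: filterE => y; rewrite scale_scalar_mx.
Qed.

Lemma C1_at_real m (s : 'rV[R]_m -> R) (h h' : R -> R) p :
  C1_at (fun y => (s y)%:M : 'rV[R]_1) p ->
  (\forall t \near s p, is_derive (t : R) 1 h (h' t) /\ {for t, continuous h'}) ->
  C1_at (fun y => (h (s y))%:M : 'rV[R]_1) p.
Proof.
move=> sp hs; pose g (v : 'rV[R]_1) : 'rV[R]_1 := (h (v ord0 ord0))%:M.
have gs : g \o (fun y => (s y)%:M : 'rV[R]_1) = (fun y => (h (s y))%:M : 'rV[R]_1).
  by apply/funext => y; rewrite /g /= mxE eqxx mulr1n.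
rewrite -gs; apply: C1_at_comp; first exact: sp.
apply: (@C1_at_intro _ _ _ _ (fun v : 'rV[R]_1 => (h' (v ord0 ord0))%:M)).
have cc := @coord_continuous R 1 1 ord0 ord0.
have : nbhs ((s p)%:M : 'rV[R]_1) (fun v : 'rV[R]_1 =>
    is_derive (v ord0 ord0 : R) 1 h (h' (v ord0 ord0)) /\
    {for (v ord0 ord0 : R), continuous h'}).
  have hs' : nbhs (((s p)%:M : 'rV[R]_1) ord0 ord0) (fun t : R =>
      is_derive t 1 h (h' t) /\ {for t, continuous h'}).
    by rewrite mxE eqxx mulr1n; exact: hs.
  exact: (cc _ _ hs').
apply: filterS => v [hv cv]; split.
  move=> e e0; have /is_derive_epsV/(_ e e0) H := hv.
  have {}H : nbhs v (fun w : 'rV[R]_1 => `|h (w ord0 ord0) - h (v ord0 ord0) -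
      h' (v ord0 ord0) * (w ord0 ord0 - v ord0 ord0)| <=
      e * `|w ord0 ord0 - v ord0 ord0|) by exact: (cc _ _ H).
  apply: filterS H => w H; apply: mx_norm_le => [|i j]; first by rewrite mulr_ge0// ltW.
  rewrite (ord1 i) (ord1 j) !mxE big_ord1 !mxE eqxx !mulr1n [_ * h' _]mulrC.
  apply: le_trans H _; rewrite ler_wpM2l ?(ltW e0)//.
  by have := mx_norm_coord (w - v) ord0 ord0; rewrite !mxE.
have cv' : {for v, continuous (h' \o (fun v : 'rV[R]_1 => v ord0 ord0))}.
  by apply: continuous_comp; [exact: cc | exact: cv].
exact: (continuous_scalar_mxV cv').
Qed.

Lemma C1_at_coord m (i : 'I_m) p : C1_at (fun y : 'rV[R]_m => (y ord0 i)%:M : 'rV[R]_1) p.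
Proof.
have := @C1_at_mulmxr m 1 (delta_mx i ord0) p; apply: C1_at_near.
apply: filterE => y; apply/matrixP => a b; rewrite (ord1 a) (ord1 b) !mxE eqxx mulr1n.
rewrite (bigD1 i)//= big1 ?mxE ?eqxx ?mulr1 ?addr0// => j ji.
by rewrite mxE (negbTE ji) mulr0.
Qed.

Lemma C1_at_sqnorm m (z : 'rV[R]_m) p :
  C1_at (fun y : 'rV[R]_m => (\sum_i (y ord0 i - z ord0 i) ^+ 2)%:M : 'rV[R]_1) p.
Proof.
elim: (index_enum _) => [|i s IH].
  by under eq_fun do rewrite big_nil; exact: C1_at_cst.
under eq_fun do rewrite big_cons raddfD /=; apply: C1_atD; last exact: IH.
under eq_fun do rewrite expr2.
suff H : C1_at (fun y : 'rV[R]_m => (y ord0 i - z ord0 i)%:M : 'rV[R]_1) p.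
  exact: C1_at_scalarM.
under eq_fun do rewrite raddfB /=; apply: C1_atB; first exact: C1_at_coord.
exact: C1_at_cst.
Qed.

(** The one-variable mean value theorem for each coordinate of [f - L] along the segment; the factor
    [m] is the cost of bounding a matrix product in the sup norm. *)
Lemma mean_value_le m n (f : 'rV[R]_m -> 'rV[R]_n) (x y : 'rV[R]_m)
    (L : 'M[R]_(m, n)) (e : R) (J : 'rV[R]_m -> 'M[R]_(m, n)) :
  (forall t : R, 0 <= t <= 1 ->
     has_jacobian f (x + t *: (y - x)) (J (x + t *: (y - x))) /\
     `|J (x + t *: (y - x)) - L| <= e) ->
  `|f y - f x - (y - x) *m L| <= m%:R * (`|y - x| * e).
Proof.
move=> fJ.
have e0 : 0 <= e by have [|_] := fJ 0; [rewrite lexx ler01 | exact: le_trans].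
apply: mx_norm_le => [|i j]; first by rewrite !mulr_ge0.
rewrite (ord1 i) {i}; pose c (t : R) := x + t *: (y - x).
pose phi (t : R) := f (c t) ord0 j - t * ((y - x) *m L) ord0 j.
have dphi (t : R) : 0 <= t <= 1 ->
    is_derive t 1 phi (((y - x) *m (J (c t) - L)) ord0 j).
  move=> t01; apply: is_derive_eps => a a0; have [fc _] := fJ t t01.
  have b0 : 0 < a / (`|y - x| + 1) by rewrite divr_gt0// ltr_wpDl.
  have cc : {for t, continuous c}.
    apply: cvgD; first exact: cvg_cst.
    by apply: cvgZr_tmp; exact: cvg_id.
  have H : \forall s \near t, `|f (c s) - f (c t) - (c s - c t) *m J (c t)| <=
      a / (`|y - x| + 1) * `|c s - c t| by exact: cc _ (fc _ b0).
  apply: filterS H => s.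
  have -> : c s - c t = (s - t) *: (y - x).
    by rewrite /c opprD addrACA subrr add0r -scalerBl.
  move=> Hs.
  have -> : phi s - phi t - ((y - x) *m (J (c t) - L)) ord0 j * (s - t) =
     (f (c s) - f (c t) - (s - t) *: (y - x) *m J (c t)) ord0 j.
    rewrite mulmxBr -scalemxAl /phi.
    move: ((y - x) *m J (c t)) ((y - x) *m L) => u v; rewrite !mxE; ring.
  apply: le_trans (mx_norm_coord _ ord0 j) _; apply: le_trans Hs _.
  rewrite normrZ mulrCA mulrC ler_wpM2r// -mulrA ler_piMr ?(ltW a0)//.
  by rewrite ler_pdivrMl ?ltr_wpDl// mulr1 lerDl.
have cphi : {within `[0, 1], continuous phi}.
  apply: derivable_within_continuous => t; rewrite in_itv /= => t01.
  by have := dphi t t01.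
have [t|t t01 E] := @MVT_segment R phi (fun t => ((y - x) *m (J (c t) - L)) ord0 j) 0 1 ler01 _ cphi.
  by rewrite in_itv /= => /andP[t0 t1]; apply: dphi; rewrite !ltW.
have -> : (f y - f x - (y - x) *m L) ord0 j = phi 1 - phi 0.
  rewrite /phi /c scale1r scale0r addr0 [x + _]addrC subrK; move: (_ *m L) => v.
  by rewrite !mxE; ring.
rewrite E subr0 mulr1; apply: le_trans (mx_norm_coord _ ord0 j) _.
apply: le_trans (mulmx_norm_le _ _) _; rewrite ler_wpM2l// ler_wpM2l//.
by have [|//] := fJ t; move: t01; rewrite in_itv.
Qed.

End C1.

(** * Sard's theorem *)

Section Sard.
Variables (R : realType) (n : nat).
Implicit Types (g : 'rV[R]_n.+1 -> 'rV[R]_n.+1) (K : set 'rV[R]_n.+1).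

(** Near each point of [K] the Jacobian varies little, and the mean value inequality makes the
    first-order expansion uniform. Only [x] has to lie in [K], as [C1_at] concerns a whole
    neighbourhood. *)
Lemma C1_unif_differentiable g K : compact K -> (forall x, K x -> C1_at g x) ->
  forall e : R, 0 < e -> \forall d \near 0^'+, forall x y, K x -> `|y - x| < d ->
    `|g y - g x - (y - x) *m 'J g x| <= e * `|y - x|.
Proof.
move=> cK gK e e0.
suff : \forall d \near 0^'+, K `<=` [set x | forall y, `|y - x| < d ->
    `|g y - g x - (y - x) *m 'J g x| <= e * `|y - x|].
  by apply: filterS => d H x y Kx; exact: H.
move/compact_near_coveringP : cK; apply => x0 Kx0.
have e1 : 0 < e / (2 * n.+1%:R) by rewrite divr_gt0// mulr_gt0.
have /C1_atP g0 := gK _ Kx0.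
have [_ cJ0] := nbhs_singleton g0.
move/cvgrPdist_lt : cJ0 => /(_ _ e1) cJ0.
have : \forall q \near x0,
    (has_jacobian g q ('J g q) /\ {for q, continuous (jacobian g)}) /\
    `|'J g x0 - 'J g q| < e / (2 * n.+1%:R) by exact: filterI g0 cJ0.
move/nbhs_normP => [r /= r0 H].
have r2 : 0 < r / 2 by rewrite divr_gt0.
have xnear : \forall x \near x0, `|x0 - x| < r / 2.
  by apply/nbhs_normP; exists (r / 2).
near=> x d => y /= yx.
have dr : d < r / 2 by near: d; apply: nbhs_right_lt.
have xr : `|x0 - x| < r / 2 by near: x; exact: xnear.
have seg (t : R) : 0 <= t <= 1 -> `|x0 - (x + t *: (y - x))| < r.
  move=> /andP[t0 t1]; rewrite opprD addrA (splitr r).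
  rewrite (le_lt_trans (ler_normB _ _))// ltrD// normrZ (ger0_norm t0).
  by apply: le_lt_trans dr; apply: ltW; apply: le_lt_trans yx; rewrite ler_piMl.
have Hx : `|'J g x0 - 'J g x| < e / (2 * n.+1%:R).
  by have [] := H x _ => //=; apply: lt_trans xr _; rewrite gtr_pMr// invf_lt1// ltr1n.
have -> : e * `|y - x| = n.+1%:R * (`|y - x| * (e / n.+1%:R)).
  by rewrite mulrCA [n.+1%:R * _]mulrC divfK ?pnatr_eq0// mulrC.
apply: (mean_value_le (J := jacobian g)) => t t01.
have [[gt _] Jt] := H _ (seg t t01); split; first exact: gt.
rewrite -(subrKA ('J g x0)) (le_trans (ler_normD _ _))//.
have -> : e / n.+1%:R = e / (2 * n.+1%:R) + e / (2 * n.+1%:R).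
  have : n.+1%:R != 0 :> R by rewrite pnatr_eq0.
  by move: (n.+1%:R) => N N0; field.
by apply: lerD; apply: ltW; [rewrite distrC; exact: Jt | exact: Hx].
Unshelve. all: by end_near. Qed.

Lemma compact_bound_nat (T : topologicalType) (K : set T) (f : T -> R) :
  compact K -> (forall x, K x -> {for x, continuous f}) ->
  exists C : nat, forall x, K x -> f x <= C%:R.
Proof.
move=> cK cf.
have : \forall C \near \oo, K `<=` [set x | f x <= C%:R].
  move/compact_near_coveringP : cK; apply => x0 Kx0.
  have /cvgrPdist_lt/(_ 1 ltr01) := cf _ Kx0 => H.
  near=> x C => /=.
  have : `|f x0 - f x| < 1 by near: x.
  have : f x0 + 1 <= C%:R by near: C; exact: nbhs_infty_ger.
  by rewrite ltr_norml => ? /andP[? ?]; lra.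
by move=> /filter_ex[C HC]; exists C => x /HC.
Unshelve. all: by end_near. Qed.

Lemma inord_shift_inj (p q r t : nat) : (r <= p + t)%N -> (p <= r + t)%N ->
  (r <= q + t)%N -> (q <= r + t)%N ->
  inord (p + t - r) = inord (q + t - r) :> 'I_(2 * t).+1 -> p = q.
Proof.
move=> p1 p2 q1 q2 /(congr1 (@nat_of_ord _)); rewrite !inordK; lia.
Qed.

(** The contradiction in Sard's theorem: cells times the possible codes within a cell grow like
    [Q ^ d], the lattice like [Q ^ d.+1], and [Q] beats the constant. *)
Lemma lattice_card_gt (d C m : nat) (Q := ((2 * C + 1) ^ d).+1) : (0 < m)%N ->
  (m ^ d.+1 * (2 * (C * Q)).+1 ^ d < (Q * m) ^ d.+1)%N.
Proof.
move=> m0; rewrite expnMn mulnC ltn_pmul2r ?expn_gt0 ?m0//.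
have H : ((2 * (C * Q)).+1 <= (2 * C + 1) * Q)%N.
  by rewrite mulnDl mul1n mulnA -addn1 leq_add2l.
have {}H : ((2 * (C * Q)).+1 ^ d <= ((2 * C + 1) * Q) ^ d)%N.
  by elim: d {Q} (Q) H => // d IH Q H; rewrite !expnS leq_mul// IH.
by apply: leq_ltn_trans H _; rewrite expnMn expnS ltn_pmul2r ?expn_gt0.
Qed.

(* Sard's theorem in equal dimensions: cut the source into cells of side h;
   the critical values coming from one cell lie in a thin slab, which contains
   few points of a lattice of mesh proportional to h. *)
Lemma sard g K : compact K -> (forall x, K x -> C1_at g x) ->
  forall (c : 'rV[R]_n.+1) (b : R), 0 < b ->
  exists y, `|y - c| < b /\ forall x, K x -> g x = y -> \det ('J g x) != 0.
Proof.
move=> cK gK c b b0; apply: contrapT => noy.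
have crit y : `|y - c| < b -> exists x, [/\ K x, g x = y & \det ('J g x) = 0].
  move=> yc; apply: contrapT => nox; apply: noy; exists y; split=> // x Kx gx.
  by apply/eqP => d0; apply: nox; exists x.
have [C HC] : exists C : nat, forall x, K x -> `|'J g x| <= C%:R.
  apply: compact_bound_nat cK _ => x Kx.
  apply: (@continuous_comp _ _ _ (jacobian g) (fun A => `|A|)).
    exact: C1_at_cjacobian (gK _ Kx).
  exact: norm_continuous.
have [L' HL] : exists L : nat, forall x, K x -> `|x| <= L%:R.
  apply: compact_bound_nat cK _ => x Kx; exact: norm_continuous.
pose L : R := L'%:R + 1.
have L0 : 0 < L by rewrite ltr_wpDl.
have xL x : K x -> `|x| < L by move=> /HL xl; apply: le_lt_trans xl _; rewrite ltrDl.
(* Bounds the variation of [g] in a cell relative to [h]: the first term comes from the Jacobian,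
   the 1 from the error of the expansion. *)
pose C2 : R := n.+1%:R * C%:R + 1.
have C20 : 0 < C2 by rewrite ltr_wpDl// mulr_ge0.
have [C1 C1P] : exists C1 : nat, 2 * L * C2 / b <= C1%:R.
  by have /filter_ex[C1 H] := nbhs_infty_gtr (2 * L * C2 / b); exists C1; exact: ltW.
(* The lattice has [Q * m] points on a side against [m] cells, so the ratio of the cell side to the
   mesh does not depend on [m]. [T] will bound, in lattice steps, the distance of two values that
   come from one cell. *)
pose Q := ((2 * C1 + 1) ^ n).+1.
pose T := (C1 * Q)%N.
have QR : 0 < Q%:R :> R by rewrite ltr0n.
(* With the 8, two lattice points of a slab that differ in a single coordinate, the largest one of
   its normal, are at most half a lattice step apart, hence equal. *)
pose e : R := Num.min 1 (b / (8 * n.+1%:R * L * Q%:R)).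
have e0 : 0 < e by rewrite lt_min ltr01 divr_gt0// !mulr_gt0.
have := C1_unif_differentiable cK gK e0.
move=> /(filterI (nbhs_right_gt 0))/filter_ex[d [/= d0 dg]].
have [m [m0 md]] : exists m : nat, (0 < m)%N /\ 2 * L / m%:R < d.
  have /filter_ex[m Hm] := nbhs_infty_gtr (2 * L / d).
  have m0 : 0 < m%:R :> R by apply: lt_trans Hm; rewrite divr_gt0// mulr_gt0.
  exists m; split; first by rewrite ltr0n in m0.
  by rewrite ltr_pdivrMr// [d * _]mulrC -ltr_pdivrMr.
have mR : 0 < m%:R :> R by rewrite ltr0n.
pose h : R := 2 * L / m%:R.
have h0 : 0 < h by rewrite !divr_gt0// mulr_gt0.
pose P := (Q * m)%N.
have PR : 0 < P%:R :> R by rewrite ltr0n muln_gt0.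
pose eta : R := b / P%:R.
have eta0 : 0 < eta by rewrite divr_gt0.
have heta : h / eta = 2 * L * Q%:R / b.
  by rewrite /h /eta /P natrM; field; rewrite !gt_eqF.
have hm : h * m%:R = 2 * L by rewrite /h divfK// gt_eqF.
have etaP : eta * P%:R = b by rewrite /eta divfK// gt_eqF.
have hd : h < d by exact: md.
clearbody h eta; clear md.
pose lat := {ffun 'I_n.+1 -> 'I_P}.
pose cell := {ffun 'I_n.+1 -> 'I_m}.
pose y (l : lat) : 'rV[R]_n.+1 := \row_i (c ord0 i + eta * (l i)%:R).
have yb l : `|y l - c| < b.
  have [i ->] := rV_norm_attained (y l - c).
  rewrite !mxE addrAC subrr add0r ger0_norm; last by rewrite mulr_ge0// ltW.
  by rewrite -etaP ltr_pM2l// ltr_nat.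
have /choice[x xP] : forall l : lat, exists z, [/\ K z, g z = y l & \det ('J g z) = 0].
  by move=> l1; exact: (crit _ (yb l1)).
pose u l i : R := (x l ord0 i + L) / h.
have u_ge0 l i : 0 <= u l i.
  have [Kx _ _] := xP l; have := le_lt_trans (rV_norm_coord (x l) i) (xL _ Kx).
  by rewrite ltr_norml => /andP[? ?]; rewrite divr_ge0 ?(ltW h0)//; lra.
have kP l i : (Num.truncn (u l i) < m)%N.
  rewrite truncn_lt_nat//.
  have [Kx _ _] := xP l; have := le_lt_trans (rV_norm_coord (x l) i) (xL _ Kx).
  rewrite ltr_norml => /andP[? ?]; rewrite ltr_pdivrMr// mulrC hm.
  lra.
pose kap l : cell := [ffun i => Ordinal (kP l i)].
have kap_dist l l' : kap l = kap l' -> `|x l - x l'| <= h.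
  move=> /ffunP kk; apply: rV_norm_le => [|i]; first exact: ltW.
  have := congr1 val (kk i); rewrite !ffunE /= => tt.
  have /andP[a1 a2] := truncn_itv (u_ge0 l i).
  have /andP[b1 b2] := truncn_itv (u_ge0 l' i).
  rewrite tt in a1 a2; move: (Num.truncn (u l' i)) a1 a2 b1 b2 => k a1 a2 b1 b2.
  rewrite -addn1 natrD /u ltr_pdivrMr// in a2; rewrite /u ler_pdivlMr// in a1.
  rewrite -addn1 natrD /u ltr_pdivrMr// in b2; rewrite /u ler_pdivlMr// in b1.
  by rewrite !mxE ler_norml; apply/andP; split; lra.
have xdiff l l' : kap l = kap l' ->
    `|y l - y l' - (x l - x l') *m 'J g (x l')| <= e * h.
  move=> /kap_dist xx; have [Kx gx _] := xP l; have [Kx' gx' _] := xP l'.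
  rewrite -gx -gx'; apply: le_trans (dg _ _ Kx' (le_lt_trans xx hd)) _.
  by rewrite ler_pM2l.
have ydist l l' i : kap l = kap l' -> `|(l i)%:R - (l' i)%:R : R| <= T%:R.
  move=> kk; have [Kx' _ _] := xP l'.
  have : `|y l - y l'| <= C2 * h.
    have := ler_normD (y l - y l' - (x l - x l') *m 'J g (x l')) ((x l - x l') *m 'J g (x l')).
    rewrite subrK => /le_trans; apply.
    rewrite addrC /C2 mulrDl mul1r lerD//.
      apply: le_trans (mulmx_norm_le _ _) _; rewrite -mulrA ler_pM2l// mulrC.
      by rewrite ler_pM// ?HC// kap_dist.
    apply: le_trans (xdiff _ _ kk) _; rewrite -[leRHS]mul1r ler_pM2r//.
    by rewrite /e ge_min lexx.
  move=> /(le_trans (rV_norm_coord _ i)); rewrite !mxE opprD addrACA subrr add0r.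
  rewrite -mulrBr normrM gtr0_norm// mulrC -ler_pdivlMr// -mulrA heta.
  move=> /le_trans; apply; rewrite /T natrM.
  have -> : C2 * (2 * L * Q%:R / b) = 2 * L * C2 / b * Q%:R.
    by field; rewrite gt_eqF.
  by rewrite ler_pM2r.
(* The differential at a critical point takes its values in the hyperplane orthogonal to [v], which
   is the middle of the slab; [i0] is a coordinate where [v] is largest. *)
have /choice[v vP] : forall l, exists v : 'rV[R]_n.+1,
    v != 0 /\ 'J g (x l) *m v^T = 0.
  move=> l1; have [_ _ d00] := xP l1.
  have /det0P[v v0 vJ] : \det ('J g (x l1))^T == 0 by rewrite det_tr d00.
  exists v; split=> //; apply: trmx_inj.
  by rewrite trmx_mul trmxK vJ trmx0.
have /choice[i0 i0P] : forall l, exists i, `|v l| = `|v l ord0 i|.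
  by move=> l1; exact: rV_norm_attained.
have slab l l' : kap l = kap l' ->
    `|(y l - y l') *m (v l')^T| <= n.+1%:R * (e * h * `|v l'|).
  move=> kk; have [v0 vJ] := vP l'.
  have -> : (y l - y l') *m (v l')^T =
     (y l - y l' - (x l - x l') *m 'J g (x l')) *m (v l')^T.
    by rewrite [RHS]mulmxBl -[X in _ = _ - X]mulmxA vJ mulmx0 subr0.
  apply: le_trans (mulmx_norm_le _ _) _; rewrite ler_pM2l// ler_pM// ?xdiff//.
  by apply: mx_norm_le => // i j; rewrite mxE mx_norm_coord.
have slab_inj l l' l0 : kap l = kap l0 -> kap l' = kap l0 ->
    (forall j, l (lift (i0 l0) j) = l' (lift (i0 l0) j)) -> l = l'.
  move=> k1 k2 ll; apply/ffunP => i; case: (unliftP (i0 l0) i) => [j ->//|->].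
  have [v0 _] := vP l0; have vn : 0 < `|v l0| by rewrite normr_gt0.
  have H : `|(y l - y l') *m (v l0)^T| <= 2 * (n.+1%:R * (e * h * `|v l0|)).
    have -> : y l - y l' = (y l - y l0) - (y l' - y l0) by rewrite opprB addrA subrK.
    rewrite mulmxBl mulr_natl mulr2n; apply: le_trans (ler_normB _ _) _.
    by rewrite lerD// slab.
  have : ((y l - y l') *m (v l0)^T) ord0 ord0 =
      eta * ((l (i0 l0))%:R - (l' (i0 l0))%:R) * v l0 ord0 (i0 l0).
    rewrite mxE (bigD1 (i0 l0))//= big1 ?addr0 => [|j ji].
      by rewrite !mxE; ring.
    case: (unliftP (i0 l0) j) => [j' jE|jE]; last by rewrite jE eqxx in ji.
    by rewrite !mxE jE ll; ring.
  move=> E; have := le_trans (mx_norm_coord _ ord0 ord0) H; rewrite E.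
  rewrite !normrM -i0P !mulrA ler_pM2r// gtr0_norm// => H'.
  apply/eqP; rewrite -val_eqE /= -(eqr_nat R) -subr_eq0 -normr_eq0.
  have : `|(l (i0 l0))%:R - (l' (i0 l0))%:R : R| < 1.
    have : `|(l (i0 l0))%:R - (l' (i0 l0))%:R : R| <= 2 * n.+1%:R * e * (h / eta).
      by rewrite mulrA ler_pdivlMr// [_ * eta]mulrC.
    rewrite heta => /le_lt_trans; apply.
    have eb : e <= b / (8 * n.+1%:R * L * Q%:R) by rewrite /e ge_min lexx orbT.
    have n0 : 0 < n.+1%:R :> R by [].
    have -> : 2 * n.+1%:R * e * (2 * L * Q%:R / b) =
        e * (4 * n.+1%:R * L * Q%:R / b) by field; rewrite gt_eqF.
    apply: (@le_lt_trans _ _ (2^-1)); last by rewrite invf_lt1// ltr1n.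
    apply: le_trans (ler_wpM2r _ eb) _; first by rewrite divr_ge0 ?(ltW b0)// !mulr_ge0 ?ltW.
    by rewrite le_eqVlt; apply/orP; left; apply/eqP; field; rewrite !gt_eqF.
  move: (nat_of_ord (l (i0 l0))) (nat_of_ord (l' (i0 l0))) => p q.
  rewrite ltr_norml normr_eq0 subr_eq0 eqr_nat => /andP[lo hi].
  have qp : (q <= p)%N.
    by rewrite -ltnS -(ltr_nat R) -natr1; lra.
  have pq : (p <= q)%N.
    by rewrite -ltnS -(ltr_nat R) -natr1; lra.
  by rewrite eqn_leq qp pq.
(* A slab depends on the critical point at which it is taken, so one representative is fixed per
   cell. The code stores the offsets from it in the coordinates other than [i0], shifted by [T] to
   become natural numbers. *)
pose rep (l : lat) : lat := odflt l [pick l' | kap l' == kap l].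
have repK l : kap (rep l) = kap l.
  by rewrite /rep; case: pickP => [l' /eqP//|].
have rep_eq l l' : kap l = kap l' -> rep l = rep l'.
  by move=> kk; rewrite /rep kk; case: pickP => // /(_ l'); rewrite eqxx.
pose code (l : lat) : {ffun 'I_n -> 'I_(2 * T).+1} :=
  [ffun j => inord (l (lift (i0 (rep l)) j) + T - rep l (lift (i0 (rep l)) j))].
have kc_inj : injective (fun l => (kap l, code l)).
  move=> l l' [kk /ffunP cc].
  apply: (slab_inj _ _ (rep l)); rewrite ?repK// => j.
  apply: val_inj => /=; have := cc j; rewrite !ffunE -(rep_eq _ _ kk).
  set i := lift _ _.
  have H1 := ydist l (rep l) i (esym (repK l)).
  have H2 := ydist l' (rep l) i (esym (etrans (repK l) kk)).
  have bd (a r : nat) : `|a%:R - r%:R : R| <= T%:R -> (r <= a + T)%N /\ (a <= r + T)%N.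
    rewrite ler_norml => /andP[A B]; split; rewrite -(ler_nat R) natrD; lra.
  have [B1 B2] := bd _ _ H1; have [B3 B4] := bd _ _ H2.
  exact: inord_shift_inj.
have := leq_card _ kc_inj; rewrite card_prod !card_ffun !card_ord.
by rewrite leqNgt lattice_card_gt.
Qed.

End Sard.

(** * The degree of a map of the sphere *)

(** Compactness in its near-covering form, applied to the filter of the sets of centres that contain
    a given finite set. *)
Lemma compact_finite_cover (T : topologicalType) (K : set T) (N : T -> set T) :
  compact K -> (forall x, K x -> nbhs x (N x)) ->
  exists s : seq T, forall y, K y -> exists2 x, x \in s & N x y.
Proof.
move=> cK KN.
pose F := filter_from [set A : set T | finite_set A] (fun A => [set B | A `<=` B]).
have FF : Filter F.
  apply: filter_from_filter; first by exists set0; exact: finite_set0.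
  move=> A B /= fA fB; exists (A `|` B); first by rewrite /= finite_setU.
  by move=> C /= ABC; split=> x Ax; apply: ABC; [left|right].
have : \forall B \near F, K `<=` [set y | exists2 x, B x & N x y].
  move/compact_near_coveringP : cK; apply => x Kx.
  exists (N x, [set B | [set x] `<=` B]) => /=.
    by split; [exact: KN | exists [set x] => //; exact: finite_set1].
  by move=> [y B] [/= Ny xB]; exists x => //; exact: xB.
move=> [A /finite_seqP[s ->] HA]; exists s => y Ky.
by have [x] := HA [set` s] (fun _ => id) y Ky; exists x.
Qed.

Lemma finite_isolated (T : topologicalType) (K : set T) (P : T -> Prop) :
  compact K -> (forall x, K x -> \forall y \near x, P y -> y = x) ->
  finite_set (K `&` P).
Proof.
move=> cK iso.
have [s Ks] := compact_finite_cover (N := fun x => [set y | P y -> y = x]) cK iso.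
apply: (@sub_finite_set _ _ [set` s]); last exact: finite_seq.
by move=> y [Ky Py]; have [x xs /(_ Py) ->] := Ks y Ky.
Qed.

Lemma finite_set_seq (T : choiceType) (S : set T) : finite_set S ->
  exists2 s : seq T, uniq s & S = [set` s].
Proof.
move=> /finite_seqP[s ->]; exists (undup s); first exact: undup_uniq.
by apply/seteqP; split=> x /=; rewrite mem_undup.
Qed.

Lemma continuous_pair (T U V : topologicalType) (f : T -> U) (g : T -> V) x :
  {for x, continuous f} -> {for x, continuous g} ->
  {for x, continuous (fun y => (f y, g y))}.
Proof. by move=> cf cg; apply: cvg_pair. Qed.

Lemma continuous_dist_lt (R : realType) (T : topologicalType) (V : normedModType R)
    (f : T -> V) x : (forall e : R, 0 < e -> \forall y \near x, `|f x - f y| < e) ->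
  {for x, continuous f}.
Proof. by move=> H; apply/cvgrPdist_lt. Qed.

(** * The Euclidean norm *)

Section Enorm.
Variable R : realType.

Lemma enorm_ge0 n (v : 'rV[R]_n) : 0 <= enorm v.
Proof. exact: sqrtr_ge0. Qed.

Lemma enormZ n (c : R) (v : 'rV[R]_n) : enorm (c *: v) = `|c| * enorm v.
Proof.
rewrite /enorm -sqrtr_sqr -sqrtrM ?sqr_ge0//; congr Num.sqrt.
by rewrite mulr_sumr; apply: eq_bigr => i _; rewrite mxE exprMn.
Qed.

Lemma enorm0 n : enorm (0 : 'rV[R]_n) = 0.
Proof. by rewrite -(scale0r 0) enormZ normr0 mul0r. Qed.

Lemma coord_le_enorm n (v : 'rV[R]_n) i : `|v ord0 i| <= enorm v.
Proof.
rewrite -sqrtr_sqr ler_wsqrtr// (bigD1 i)//= lerDl sumr_ge0// => j _.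
exact: sqr_ge0.
Qed.

Lemma norm_le_enorm n (v : 'rV[R]_n) : `|v| <= enorm v.
Proof. by apply: rV_norm_le => [|i]; [exact: enorm_ge0 | exact: coord_le_enorm]. Qed.

Lemma enorm_le_norm n (v : 'rV[R]_n) : enorm v <= n%:R * `|v|.
Proof.
rewrite -[leRHS]ger0_norm ?mulr_ge0// -sqrtr_sqr ler_wsqrtr//.
apply: (@le_trans _ _ (\sum_(i < n) `|v| ^+ 2)).
  apply: ler_sum => i _; rewrite -real_normK ?num_real// lerXn2r ?nnegrE//.
  exact: rV_norm_coord.
rewrite sumr_const card_ord -[leLHS]mulr_natl exprMn ler_wpM2r ?sqr_ge0//.
by rewrite -natrX ler_nat; case: n {v} => // n; rewrite expnS leq_pmulr// expn1.
Qed.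

Lemma enorm_gt0 n (v : 'rV[R]_n) : (0 < enorm v) = (v != 0).
Proof.
apply/idP/idP => [|v0]; first by apply: contraTneq => ->; rewrite enorm0 ltxx.
by apply: lt_le_trans (norm_le_enorm v); rewrite normr_gt0.
Qed.

Lemma enorm_continuous n : continuous (@enorm R n).
Proof.
move=> v; have := C1_at_continuous (C1_at_sqnorm 0 v).
move=> /continuous_scalar_mx cs.
have H : {for v, continuous (Num.sqrt \o (fun y : 'rV[R]_n => \sum_i (y ord0 i - (0 : 'rV[R]_n) ord0 i) ^+ 2))}.
  by apply: continuous_comp; [exact: cs | exact: sqrt_continuous].
suff -> : @enorm R n = Num.sqrt \o (fun y : 'rV[R]_n => \sum_i (y ord0 i - (0 : 'rV[R]_n) ord0 i) ^+ 2) by exact: H.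
apply/funext => y; rewrite /enorm /=; congr Num.sqrt.
by apply: eq_bigr => i _; rewrite mxE subr0.
Qed.

Lemma C1_at_inv_enorm n (v : 'rV[R]_n) : v != 0 ->
  C1_at (fun y : 'rV[R]_n => (enorm y)^-1%:M : 'rV[R]_1) v.
Proof.
move=> v0; have s0 : 0 < \sum_i (v ord0 i - (0 : 'rV[R]_n) ord0 i) ^+ 2.
  rewrite -sqrtr_gt0 (_ : Num.sqrt _ = enorm v) ?enorm_gt0//.
  by congr Num.sqrt; apply: eq_bigr => i _; rewrite mxE subr0.
have := @C1_at_real R n _ (fun t => (Num.sqrt t)^-1)
  (fun t => - (Num.sqrt t) ^- 2 * (2 * Num.sqrt t)^-1) v (C1_at_sqnorm 0 v).
have -> : (fun y : 'rV[R]_n => (enorm y)^-1%:M : 'rV[R]_1) = (fun y : 'rV[R]_n =>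
    (Num.sqrt (\sum_i (y ord0 i - (0 : 'rV[R]_n) ord0 i) ^+ 2))^-1%:M : 'rV[R]_1).
  apply/funext => y; congr (_^-1%:M); congr Num.sqrt.
  by apply: eq_bigr => i _; rewrite mxE subr0.
apply; near=> t.
have t0 : 0 < t by near: t; exact: lt_nbhsr.
have st0 : Num.sqrt t != 0 by rewrite gt_eqF// sqrtr_gt0.
split.
  have dt := @is_derive1_sqrt R t t0.
  have ddt : derivable Num.sqrt t 1 by [].
  by apply: DeriveDef; [exact: derivableV | rewrite deriveV// derive_val].
have cs : {for t, continuous (@Num.sqrt R)} by exact: sqrt_continuous.
apply: continuousM.
  apply: continuousN; apply: continuousV; first by rewrite expf_neq0.
  by apply: continuousM; exact: cs.
apply: continuousV; first by rewrite mulf_neq0.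
by apply: continuousM; [exact: cst_continuous | exact: cs].
Unshelve. all: by end_near. Qed.

Lemma C1_at_enorm n (v : 'rV[R]_n) : v != 0 ->
  C1_at (fun y : 'rV[R]_n => (enorm y)%:M : 'rV[R]_1) v.
Proof.
move=> v0.
have s0 : 0 < \sum_i (v ord0 i - (0 : 'rV[R]_n) ord0 i) ^+ 2.
  rewrite -sqrtr_gt0 (_ : Num.sqrt _ = enorm v) ?enorm_gt0//.
  by congr Num.sqrt; apply: eq_bigr => i _; rewrite mxE subr0.
have := @C1_at_real R n _ (@Num.sqrt R) (fun t => (2 * Num.sqrt t)^-1) v (C1_at_sqnorm 0 v).
have -> : (fun y : 'rV[R]_n => (enorm y)%:M : 'rV[R]_1) = (fun y : 'rV[R]_n =>
    (Num.sqrt (\sum_i (y ord0 i - (0 : 'rV[R]_n) ord0 i) ^+ 2))%:M : 'rV[R]_1).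
  apply/funext => y; congr (_%:M); congr Num.sqrt.
  by apply: eq_bigr => i _; rewrite mxE subr0.
apply; near=> t.
have t0 : 0 < t by near: t; exact: lt_nbhsr.
have st0 : Num.sqrt t != 0 by rewrite gt_eqF// sqrtr_gt0.
split; first exact: is_derive1_sqrt.
have cs : {for t, continuous (@Num.sqrt R)} by exact: sqrt_continuous.
apply: continuousV; first by rewrite mulf_neq0.
by apply: continuousM; [exact: cst_continuous | exact: cs].
Unshelve. all: by end_near. Qed.

End Enorm.

(** * Radial extensions and degrees *)

Section Radial.
Variables (R : realType) (n : nat).
Notation cube := [set x : 'rV[R]_n.+1 | `|x| <= 1].
Notation sph := (@sphere R n.+1).
Implicit Types (f g : 'rV[R]_n.+1 -> 'rV[R]_n.+1) (x y z p : 'rV[R]_n.+1).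

Lemma sphere_normalize x : x != 0 -> sph ((enorm x)^-1 *: x).
Proof.
move=> x0; rewrite /sphere /= enormZ ger0_norm ?invr_ge0 ?enorm_ge0//.
by rewrite mulVf// gt_eqF// enorm_gt0.
Qed.

Lemma sphere_neq0 x : sph x -> x != 0.
Proof. by rewrite /sphere /= => x1; rewrite -enorm_gt0 x1. Qed.

Lemma radial_sphere g x : sph x -> radial g x = g x.
Proof. by rewrite /sphere /= /radial => ->; rewrite invr1 !scale1r. Qed.

Lemma radial0 g : radial g 0 = 0.
Proof. by rewrite /radial enorm0 scale0r. Qed.

Lemma radialZ g (c : R) x : 0 < c -> radial g (c *: x) = c *: radial g x.
Proof.
move=> c0; rewrite /radial enormZ (gtr0_norm c0) invfM !scalerA.
by congr (_ *: g (_ *: _)); rewrite mulrAC mulVf ?mul1r// gt_eqF.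
Qed.

Lemma radial_enorm g x : (forall z, sph z -> sph (g z)) -> enorm (radial g x) = enorm x.
Proof.
move=> gs; have [->|x0] := eqVneq x 0; first by rewrite radial0.
have := gs _ (sphere_normalize x0); rewrite /sphere /= => g1.
by rewrite /radial enormZ g1 mulr1 ger0_norm// enorm_ge0.
Qed.

Lemma normalize_continuous x : x != 0 ->
  {for x, continuous (fun y : 'rV[R]_n.+1 => (enorm y)^-1 *: y)}.
Proof.
move=> x0; apply: continuousZ; last exact: cvg_id.
by apply: continuousV; [rewrite gt_eqF// enorm_gt0 | exact: enorm_continuous].
Qed.

(** At the origin continuity holds because the norm is preserved; elsewhere the extension is a
    composition with the normalization of vectors. *)
Lemma radial_homotopy_continuous (H : R * 'rV[R]_n.+1 -> 'rV[R]_n.+1) :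
  {within `[0, 1]%classic `*` sph, continuous H} ->
  (forall t z, `[0, 1]%classic t -> sph z -> sph (H (t, z))) ->
  {within `[0, 1]%classic `*` cube,
    continuous (fun q : R * 'rV[R]_n.+1 => radial (fun z => H (q.1, z)) q.2)}.
Proof.
move=> cH Hs; apply/within_continuousP => -[t0 x0] [/= It0 _] e e0.
have snd_cont : {for (t0, x0), continuous (@snd R 'rV[R]_n.+1)} by exact: cvg_snd.
have fst_cont : {for (t0, x0), continuous (@fst R 'rV[R]_n.+1)} by exact: cvg_fst.
have cen : {for (t0, x0), continuous (@enorm R n.+1 \o snd)}.
  by apply: continuous_comp; [exact: snd_cont | exact: enorm_continuous].
have [x00|x0N] := eqVneq x0 0.
  move/cvgrPdist_lt : cen => /(_ _ e0); apply: filterS => -[t x] /=.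
  rewrite x00 enorm0 sub0r normrN ger0_norm ?enorm_ge0// => xe [It _].
  rewrite radial0 sub0r normrN; apply: le_lt_trans (norm_le_enorm _) _.
  by rewrite radial_enorm// => z; exact: Hs.
pose psi (q : R * 'rV[R]_n.+1) := (q.1, (enorm q.2)^-1 *: q.2).
have cpsi : {for (t0, x0), continuous psi}.
  apply: continuous_pair; first exact: fst_cont.
  have := @continuous_comp _ _ _ snd (fun y : 'rV[R]_n.+1 => (enorm y)^-1 *: y) (t0, x0) snd_cont.
  by apply; exact: normalize_continuous.
pose D := (`[0, 1]%classic `*` cube : set (R * 'rV[R]_n.+1)).
have cHpsi : H (psi q) @[q --> within D (nbhs (t0, x0))] --> H (psi (t0, x0)).
  apply/cvgrPdist_lt => d d0; rewrite near_withinE.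
  move/within_continuousP : cH => /(_ (psi (t0, x0))).
  move=> /(_ (conj It0 (sphere_normalize x0N)) d d0) => Hn.
  have H1 : \forall q \near (t0, x0), (`[0, 1]%classic `*` sph) (psi q) ->
    `|H (psi (t0, x0)) - H (psi q)| < d by exact: (cpsi _ Hn).
  have H2 : \forall q \near (t0, x0), 0 < enorm q.2.
    have : \forall t \near enorm x0, 0 < t by apply: lt_nbhsr; rewrite enorm_gt0.
    by move=> /cen.
  apply: filterS2 H1 H2 => -[t x] /= H1 H2 [/= It _]; apply: H1; split => //=.
  by apply: sphere_normalize; rewrite -enorm_gt0.
have H1 : (enorm q.2) *: H (psi q) @[q --> within D (nbhs (t0, x0))] -->
    enorm x0 *: H (psi (t0, x0)).
  by apply: cvgZ; [exact: cvg_within_filter cen | exact: cHpsi].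
by move/cvgrPdist_lt : H1 => /(_ _ e0); rewrite near_withinE.
Qed.

Lemma label_count_sphere_homotopic f g : sphere_homotopic f g ->
  \forall N \near \oo, label_count N (radial f) = label_count N (radial g).
Proof.
case=> H [cH Hs H0 H1].
have := label_count_homotopy (radial_homotopy_continuous cH Hs).
have radE g' t : (forall z, sph z -> H (t, z) = g' z) ->
    (fun x => radial (fun z => H (t, z)) x) = radial g'.
  move=> Hg; apply/funext => x; have [->|x0] := eqVneq x 0; first by rewrite !radial0.
  by rewrite /radial Hg//; exact: sphere_normalize.
rewrite /= (radE f)// (radE g)//; apply => t x It x1.
have x0 : x != 0 by rewrite -normr_gt0 x1.
by rewrite -enorm_gt0 radial_enorm ?enorm_gt0// => z; exact: Hs.
Qed.

Lemma within_sphere_snd f : {within sph, continuous f} ->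
  {within `[0, 1]%classic `*` sph, continuous (fun q : R * 'rV[R]_n.+1 => f q.2)}.
Proof.
move=> /within_continuousP cf; apply/within_continuousP => -[t0 x0] [/= _ x0s] e e0.
have cs : {for (t0, x0), continuous (@snd R 'rV[R]_n.+1)} by exact: cvg_snd.
have H : \forall q \near (t0, x0), sph q.2 -> `|f x0 - f q.2| < e.
  exact: cs _ (cf _ x0s _ e0).
by apply: filterS H => -[t x] /= H [_ /=]; exact: H.
Qed.

Lemma radial_continuous f : {within sph, continuous f} ->
  (forall z, sph z -> sph (f z)) -> {within cube, continuous (radial f)}.
Proof.
move=> cf fs.
have := radial_homotopy_continuous (within_sphere_snd cf) (fun t z _ => fs z).
move=> /within_continuousP H; apply/within_continuousP => x0 Qx0 e e0.
have I0 : `[0, 1]%classic (0 : R) by rewrite /= in_itv /= lexx ler01.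
have {}H := H (0, x0) (conj I0 Qx0) e e0.
have cp : (fun x : 'rV[R]_n.+1 => (0 : R, x)) @ x0 --> (0 : R, x0).
  by apply: continuous_pair; [exact: cst_continuous | exact: cvg_id].
have {}H : \forall x \near x0, (`[0, 1]%classic `*` cube) (0 : R, x) ->
    `|radial f x0 - radial f x| < e by exact: cp _ H.
by apply: filterS H => x H Qx; apply: H.
Qed.

Lemma sphere_homotopic_refl f : {within sph, continuous f} ->
  (forall z, sph z -> sph (f z)) -> sphere_homotopic f f.
Proof.
move=> cf fs; exists (fun q => f q.2); split=> //; first exact: within_sphere_snd.
by move=> t z _; exact: fs.
Qed.

Lemma C1_sphere_map_continuous f : C1_sphere_map f -> {within sph, continuous f}.
Proof.
move=> fC; apply/within_continuousP => x0 x0s e e0.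
have /cvgrPdist_lt/(_ _ e0) := C1_at_continuous (fC _ x0s).
by apply: filterS => x; rewrite (radial_sphere f x0s) => H xs; rewrite -(radial_sphere f xs).
Qed.

Lemma has_jacobian_radial g (c : R) p A : 0 < c ->
  has_jacobian (radial g) p A -> has_jacobian (radial g) (c *: p) A.
Proof.
move=> c0 gp.
have H1 : has_jacobian (fun y => y *m (c^-1)%:M) (c *: p) (c^-1)%:M.
  exact: has_jacobian_mulmxr.
have pE : c *: p *m (c^-1)%:M = p.
  by rewrite mul_mx_scalar scalerA mulVf ?scale1r// gt_eqF.
have := has_jacobian_comp H1; rewrite pE => /(_ _ _ _ gp) => /(has_jacobianZ c).
rewrite mul_scalar_mx scalerA divff ?scale1r ?gt_eqF//.
apply: has_jacobian_near; apply: filterE => y /=.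
by rewrite mul_mx_scalar radialZ ?invr_gt0// scalerA divff ?scale1r// gt_eqF.
Qed.

Lemma C1_at_radial g x : C1_sphere_map g -> x != 0 -> C1_at (radial g) x.
Proof.
move=> gC x0; have e0 : 0 < enorm x by rewrite enorm_gt0.
have := gC _ (sphere_normalize x0).
have E : (enorm x)^-1 *: x = x *m ((enorm x)^-1)%:M by rewrite mul_mx_scalar.
rewrite E => H.
have := C1_atZ (enorm x) (C1_at_comp (C1_at_mulmxr ((enorm x)^-1)%:M x) H).
apply: C1_at_near; apply: filterE => y /=.
by rewrite mul_mx_scalar radialZ ?invr_gt0// scalerA divff ?scale1r// gt_eqF.
Qed.

Lemma has_jacobian_isolated m (f : 'rV[R]_m.+1 -> 'rV[R]_m.+1) (x : 'rV[R]_m.+1) A :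
  has_jacobian f x A -> A \in unitmx -> \forall y \near x, f y = f x -> y = x.
Proof.
move=> fA uA; pose c := m.+1%:R * `|invmx A|.
have c0 : 0 <= c by rewrite mulr_ge0.
have e0 : 0 < (c + 1)^-1 / 2 :> R by rewrite divr_gt0// invr_gt0 ltr_wpDl.
apply: filterS (fA _ e0) => y H fyx; apply/eqP; rewrite -subr_eq0 -normr_le0.
move: H; rewrite fyx subrr sub0r normrN => H.
have := mulmx_norm_le ((y - x) *m A) (invmx A); rewrite mulmxK// => H'.
have : `|y - x| <= `|y - x| / 2.
  apply: le_trans H' _; rewrite [`|_ *m A| * _]mulrC mulrA -/c.
  apply: le_trans (ler_wpM2l c0 H) _; rewrite mulrA [leRHS]mulrC ler_wpM2r//.
  by rewrite mulrA -[leRHS]mul1r ler_pM2r// ler_pdivrMr ?mul1r ?ltr_wpDl// lerDl.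
by have := normr_ge0 (y - x); lra.
Qed.

Lemma compact_enorm (a b : R) : compact [set x : 'rV[R]_n.+1 | a <= enorm x <= b].
Proof.
apply: bounded_closed_compact.
  exists b; split; first exact: num_real.
  move=> M bM x /= /andP[_ xb]; apply: le_trans (norm_le_enorm _) _.
  by apply: le_trans xb _; exact: ltW.
have -> : [set x : 'rV[R]_n.+1 | a <= enorm x <= b] =
    (@enorm R n.+1) @^-1` [set t | a <= t] `&` (@enorm R n.+1) @^-1` [set t | t <= b].
  by apply/seteqP; split => x /=; [move=> /andP|move=> [-> ->]].
apply: closedI; apply: closed_comp.
- by move=> x _; exact: enorm_continuous.
- exact: closed_ge.
- by move=> x _; exact: enorm_continuous.
exact: closed_le.
Qed.

Lemma sphere_compact : compact sph.
Proof.
have -> : sph = [set x : 'rV[R]_n.+1 | 1 <= enorm x <= 1].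
  apply/seteqP; split => x; rewrite /sphere /=; first by move=> ->; rewrite lexx.
  by rewrite -eq_le => /eqP.
exact: compact_enorm.
Qed.

(** The origin, where [radial g] vanishes, is not a usable zero, so the map is translated by
    [- y / 2]. The zeros become the halves of the preimages of [y], and the translation creates none
    on the boundary of the cube, where [radial g] has Euclidean norm at least 1. *)
Lemma label_count_is_degree f m : is_degree f m ->
  \forall N \near \oo, label_count N (radial f) = m.
Proof.
move=> [g [y [fg gC ys greg ->]]].
have gs z : sph z -> sph (g z).
  case: fg => H [_ Hs _ H1] zs; rewrite -H1//; apply: Hs => //.
  by rewrite /= in_itv /= lexx ler01.
have cg := C1_sphere_map_continuous gC.
have crg := radial_continuous cg gs.
pose S := [set p | sph p /\ g p = y].
have finS : finite_set S.
  apply: (sub_finite_set (B := sph `&` [set p | radial g p = y])).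
    by move=> p [ps gp]; split=> //=; rewrite radial_sphere.
  apply: finite_isolated; first exact: sphere_compact.
  move=> p ps; have [gp|gp] := eqVneq (radial g p) y.
    have u : 'J (radial g) p \in unitmx.
      by rewrite unitmxE unitfE; apply: greg => //; rewrite -(radial_sphere g ps).
    have := has_jacobian_isolated (C1_at_jacobian (gC _ ps)) u.
    by apply: filterS => q H gq; apply: H; rewrite gp gq.
  have : \forall q \near p, radial g q != y.
    have c := C1_at_continuous (gC _ ps).
    have e0 : 0 < `|radial g p - y| by rewrite normr_gt0 subr_eq0.
    move/cvgrPdist_lt : c => /(_ _ e0); apply: filterS => q.
    by apply: contraTneq => ->; rewrite ltxx.
  by apply: filterS => q /eqP.
have [s us sS] := finite_set_seq finS.
pose Z := [seq 2^-1 *: p | p <- s].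
have S_in p : p \in s <-> S p by rewrite sS.
have h2 : 0 < 2^-1 :> R by rewrite invr_gt0.
have uZ : uniq Z.
  by rewrite map_inj_uniq// => p q /scalerI; apply; rewrite gt_eqF.
pose w x := radial g x - 2^-1 *: y.
have y1 : enorm y = 1 by [].
have H1 : \forall N \near \oo, label_count N w =
    \sum_(z <- Z) sgz (\det ('J (radial g) (2 *: z))).
  apply: (label_count_zeros (A := fun z => 'J (radial g) (2 *: z))) => //.
  - apply/within_continuousP => x0 Qx0 e e0.
    move/within_continuousP : crg => /(_ x0 Qx0 e e0).
    by apply: filterS => x; rewrite /w opprB addrA subrK.
  - move=> x _ /eqP; rewrite /w subr_eq0 => /eqP rx.
    have ex : enorm x = 2^-1.
      by rewrite -(radial_enorm x gs) rx enormZ y1 mulr1 gtr0_norm.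
    apply/mapP; exists (2 *: x); last by rewrite scalerA mulVf ?scale1r.
    apply/S_in; split.
      by rewrite /sphere /= enormZ ex ger0_norm// divff.
    rewrite -(@radial_sphere g) /sphere /= ?enormZ ?ex ?ger0_norm ?divff//.
    by rewrite radialZ// rx scalerA divff ?scale1r.
  move=> z /mapP[p /S_in[ps gp] ->].
  have p1 : enorm p = 1 by [].
  have E : 2 *: (2^-1 *: p) = p by rewrite scalerA divff ?scale1r.
  have pj := C1_at_jacobian (gC _ ps).
  split.
  - apply: le_lt_trans (norm_le_enorm _) _; rewrite enormZ p1 mulr1 gtr0_norm//.
    by rewrite invf_lt1// ltr1n.
  - by rewrite /w radialZ// radial_sphere// gp subrr.
  - rewrite E; have := has_jacobian_radial h2 pj.
    move=> H e e0; apply: filterS (H e e0) => q.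
    by rewrite /w radialZ// (radial_sphere g ps) gp.
  - by rewrite E unitmxE unitfE; exact: greg.
have H2 : \forall N \near \oo, label_count N (radial g) = label_count N w.
  pose W (q : R * 'rV[R]_n.+1) := radial g q.2 - (q.1 / 2) *: y.
  have W0 : (fun x => W (0, x)) = radial g.
    by apply/funext => x; rewrite /W /= mul0r scale0r subr0.
  have W1 : (fun x => W (1, x)) = w by apply/funext => x; rewrite /W /= mul1r.
  have := @label_count_homotopy R n W; rewrite W0 W1; apply.
    have /within_continuousP Hr := radial_homotopy_continuous (within_sphere_snd cg) (fun t z _ => gs z).
    apply/subspace_continuousP => -[t0 x0] [It0 Qx0].
    apply: cvgB.
      apply/cvgrPdist_lt => e e0; rewrite near_withinE.
      by have := Hr (t0, x0) (conj It0 Qx0) e e0.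
    apply: cvgZr_tmp; apply: cvg_within_filter; apply: cvgMr_tmp; exact: cvg_fst.
  move=> t x /=; rewrite in_itv /= => /andP[t0 t1] x1.
  rewrite /W /= subr_eq0; apply/eqP => /(congr1 (@enorm R _)).
  rewrite radial_enorm// enormZ y1 mulr1 ger0_norm ?divr_ge0// => ex.
  by have := norm_le_enorm x; rewrite x1 ex; lra.
have H3 := label_count_sphere_homotopic fg.
have SE (E : 'rV[R]_n.+1 -> int) :
    \sum_(p \in [set p | sph p /\ g p = y]) E p = \sum_(p <- s) E p.
  by rewrite (fsbig_seq _ _ us) -sS.
apply: filterS (filterI (filterI H3 H2) H1) => N [[-> ->] ->].
rewrite SE big_map; apply: eq_bigr => p _.
by rewrite scalerA divff ?scale1r.
Qed.

(** Sard's theorem is applied to the radial extension on a shell around the sphere; a regular value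
    there can be normalized because the Jacobian of a radial extension is constant along rays. *)
Lemma is_degree_exists f : C1_sphere_map f -> (forall z, sph z -> sph (f z)) ->
  exists m, is_degree f m.
Proof.
move=> fC fs.
pose K := [set x : 'rV[R]_n.+1 | 2^-1 <= enorm x <= 2].
have K0 x : K x -> x != 0.
  by move=> /andP[x2 _]; rewrite -enorm_gt0 (lt_le_trans _ x2)// invr_gt0.
pose c : 'rV[R]_n.+1 := delta_mx ord0 ord0.
have c1 : enorm c = 1.
  rewrite /enorm (bigD1 ord0)//= big1 ?addr0 => [|j j0]; last first.
    by rewrite mxE (negbTE j0) andbF expr0n.
  by rewrite mxE !eqxx expr1n sqrtr1.
have [r r0 Hr] : exists2 r : R, 0 < r & forall y, `|y - c| < r -> K y.
  have : \forall t \near enorm c, 2^-1 < t < 2.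
    rewrite c1; near=> t; apply/andP; split; near: t.
      by apply: lt_nbhsr; rewrite invf_lt1// ltr1n.
    by apply: lt_nbhsl; rewrite ltr1n.
  move=> /(@enorm_continuous R n.+1 c) H.
  have {}H : \forall y \near c, 2^-1 < enorm y < 2 by exact: H.
  have /nbhs_normP[r /= r0 Hr] := H.
  exists r => // y yc; have /andP[a b] : 2^-1 < enorm y < 2 by apply: Hr; rewrite /= distrC.
  by rewrite /K /= !ltW.
have [y' [yc reg]] := @sard R n (radial f) K (@compact_enorm 2^-1 2)
  (fun x Kx => C1_at_radial fC (K0 x Kx)) c r r0.
have Ky := Hr _ yc; have y0 := K0 _ Ky.
pose y := (enorm y')^-1 *: y'.
have e0 : 0 < enorm y' by rewrite enorm_gt0.
exists (\sum_(p \in [set p | sph p /\ f p = y]) sgz (\det ('J (radial f) p))).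
exists f, y; split=> //.
- by apply: sphere_homotopic_refl => //; exact: C1_sphere_map_continuous.
- exact: sphere_normalize.
move=> p ps fp.
have pj := has_jacobian_radial e0 (C1_at_jacobian (fC _ ps)).
rewrite -(has_jacobian_unique pj); apply: reg.
  have p1 : enorm p = 1 by [].
  by rewrite /K /= enormZ p1 mulr1 ger0_norm// enorm_ge0.
by rewrite radialZ// radial_sphere// fp /y scalerA divff ?scale1r// gt_eqF.
Unshelve. all: by end_near. Qed.

(** Whichever value [xget] selects is the label count on fine grids, so no separate uniqueness
    argument is made; existence rules out the default value. *)
Theorem degree_label_count f : C1_sphere_map f -> (forall z, sph z -> sph (f z)) ->
  \forall N \near \oo, label_count N (radial f) = degree f.
Proof.
move=> fC fs; rewrite /degree /=; apply: label_count_is_degree.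
have [m fm] := is_degree_exists fC fs.
by case: xgetP => [m' -> //|/(_ m)].
Qed.

(** Label counts live on the cube, which contains the ball where [v] is given, so [v] is extended
    homogeneously by [vt]. Outside the ball, [vt] and the radial extension of the normalized [v] are
    positive multiples of the same vector: the segment between them avoids 0, and [vt] has no new
    zero. *)
Theorem degree_ball f (v : 'rV[R]_n.+1 -> 'rV[R]_n.+1) (Z : seq 'rV[R]_n.+1)
    (A : 'rV[R]_n.+1 -> 'M[R]_n.+1) :
  C1_sphere_map f -> (forall z, sph z -> sph (f z)) ->
  {within [set x | enorm x <= 1], continuous v} ->
  (forall z, sph z -> v z != 0) ->
  sphere_homotopic f (fun z => (enorm (v z))^-1 *: v z) ->
  uniq Z -> (forall x, enorm x <= 1 -> v x = 0 -> x \in Z) ->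
  (forall z, z \in Z -> [/\ enorm z < 1, v z = 0, linear_part v z (A z) &
                            A z \in unitmx]) ->
  degree f = \sum_(z <- Z) sgz (\det (A z)).
Proof.
move=> fC fs cv v0 fv uZ vZ Zv.
pose vh z := (enorm (v z))^-1 *: v z.
have vhs z : sph z -> sph (vh z) by move=> zs; apply: sphere_normalize; exact: v0.
pose mx (x : 'rV[R]_n.+1) := Num.max 1 (enorm x).
pose rt (x : 'rV[R]_n.+1) := (mx x)^-1 *: x.
have mx1 x : 1 <= mx x by rewrite le_max lexx.
have mx0 x : 0 < mx x by exact: lt_le_trans (mx1 x).
have rtB x : enorm (rt x) <= 1.
  rewrite enormZ ger0_norm ?invr_ge0 ?(ltW (mx0 x))// mulrC ler_pdivrMr// mul1r.
  by rewrite le_max lexx orbT.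
have cmx : continuous mx.
  by move=> x; apply: continuous_max; [exact: cst_continuous | exact: enorm_continuous].
have crt : continuous rt.
  move=> x; have cI : {for x, continuous (@idfun 'rV[R]_n.+1)} by exact: cvg_id.
  have ci : {for x, continuous (fun y => (mx y)^-1)}.
    by apply: continuousV; [rewrite gt_eqF | exact: cmx].
  exact: (continuousZ ci cI).
pose vt x := mx x *: v (rt x).
have cvrt : continuous (v \o rt).
  move=> x; apply: continuous_dist_lt => e e0.
  move/within_continuousP : cv => /(_ (rt x) (rtB x) e e0) H.
  have {}H : \forall y \near x, [set x | enorm x <= 1] (rt y) ->
    `|v (rt x) - v (rt y)| < e by exact: crt _ _ H.
  by apply: filterS H => y; apply; exact: rtB.
have cvt : continuous vt by move=> x; exact: (continuousZ (cmx x) (cvrt x)).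
have mxin x : enorm x <= 1 -> mx x = 1 by move=> x1; apply/max_idPl.
have mxout x : 1 <= enorm x -> mx x = enorm x by move=> x1; apply/max_idPr.
have vtin x : enorm x <= 1 -> vt x = v x.
  by move=> x1; rewrite /vt /rt mxin// invr1 !scale1r.
have cvh : {within sph, continuous vh}.
  apply/subspace_continuousP => x xs.
  have x1 : enorm x = 1 by [].
  have cvx : v y @[y --> within sph (nbhs x)] --> v x.
    apply/cvgrPdist_lt => e e0; rewrite near_withinE.
    move/within_continuousP : cv => /(_ x _ e e0); rewrite /= x1 lexx => /(_ isT).
    by apply: filterS => y H ys; apply: H; rewrite (ys : enorm y = 1).
  apply: cvgZ; last exact: cvx.
  apply: cvgV; first by rewrite gt_eqF// enorm_gt0 v0.
  by apply: continuous_cvg; [exact: enorm_continuous | exact: cvx].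
have H1 := label_count_sphere_homotopic fv.
have H2 : \forall N \near \oo, label_count N (radial vh) = label_count N vt.
  pose W (q : R * 'rV[R]_n.+1) := (1 - q.1) *: radial vh q.2 + q.1 *: vt q.2.
  have W0 : (fun x => W (0, x)) = radial vh.
    by apply/funext => x; rewrite /W /= subr0 scale1r scale0r addr0.
  have W1 : (fun x => W (1, x)) = vt.
    by apply/funext => x; rewrite /W /= subrr scale1r scale0r add0r.
  have := @label_count_homotopy R n W; rewrite W0 W1; apply.
    have /within_continuousP Hr := radial_homotopy_continuous (within_sphere_snd cvh) (fun t z _ => vhs z).
    apply/subspace_continuousP => -[t0 x0] [It0 Qx0].
    apply: cvgD; apply: cvgZ.
    - apply: cvgB; first exact: cvg_cst.
      by apply: cvg_within_filter; exact: cvg_fst.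
    - apply/cvgrPdist_lt => e e0; rewrite near_withinE.
      by have := Hr (t0, x0) (conj It0 Qx0) e e0.
    - by apply: cvg_within_filter; exact: cvg_fst.
    - apply: cvg_within_filter.
      by apply: continuous_cvg; [exact: cvt | exact: cvg_snd].
  move=> t x /=; rewrite in_itv /= => /andP[t0 t1] x1.
  have ex1 : 1 <= enorm x by rewrite -x1 norm_le_enorm.
  have x0 : x != 0 by rewrite -normr_gt0 x1.
  have ex0 : 0 < enorm x by rewrite enorm_gt0.
  rewrite /W /= /radial /vt /rt mxout// /vh.
  set u := v _; have u0 : u != 0 by apply: v0; exact: sphere_normalize.
  have eu0 : 0 < enorm u by rewrite enorm_gt0.
  rewrite !scalerA -scalerDl scaler_eq0 negb_or u0 andbT gt_eqF//.
  have iu : 0 < (enorm u)^-1 by rewrite invr_gt0.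
  have [->|tn] := eqVneq t 0; first by rewrite subr0 mul1r mul0r addr0 mulr_gt0.
  rewrite ltr_wpDl//; first by rewrite !mulr_ge0 ?subr_ge0// ltW.
  by rewrite mulr_gt0// lt_neqAle eq_sym tn.
have H3 : \forall N \near \oo, label_count N vt = \sum_(z <- Z) sgz (\det (A z)).
  apply: label_count_zeros.
  - exact: continuous_subspaceT.
  - exact: uZ.
  - move=> x _ /eqP; rewrite /vt scaler_eq0 gt_eqF//= => /eqP vr.
    have rZ := vZ _ (rtB x) vr; have [r1 _ _ _] := Zv _ rZ.
    have x1 : enorm x <= 1.
      rewrite leNgt; apply/negP => x1; move: r1.
      rewrite enormZ mxout ?(ltW x1)// ger0_norm ?invr_ge0 ?enorm_ge0// mulVf ?ltxx//.
      by rewrite gt_eqF// (lt_trans _ x1).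
    by move: rZ; rewrite /rt mxin// invr1 scale1r.
  move=> z zZ; have [z1 vz Az uz] := Zv z zZ; split=> //.
  - exact: le_lt_trans (norm_le_enorm z) z1.
  - by rewrite vtin// ltW.
  move=> e e0.
  have zn : \forall y \near z, enorm y < 1.
    have : \forall t \near enorm z, t < 1 by exact: lt_nbhsl.
    by move=> /(@enorm_continuous R _ z).
  by apply: filterS2 zn (Az e e0) => y y1; rewrite vtin// ltW.
have H4 := degree_label_count fC fs.
have [N [[[E4 E1] E2] E3]] := filter_ex (filterI (filterI (filterI H4 H1) H2) H3).
by rewrite -E4 E1 E2 E3.
Qed.

End Radial.

(** * Iterates and periods *)

Section Periods.
Variables (T : Type) (g : T -> T).
Implicit Types (z : T) (d j k : nat).

Lemma iter_mul_fixed d q z : iter d g z = z -> iter (q * d) g z = z.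
Proof. by move=> zE; elim: q => // q IH; rewrite mulSn iterD IH. Qed.

Lemma iter_dvd_fixed d k z : (d %| k)%N -> iter d g z = z -> iter k g z = z.
Proof. by move=> /dvdnP[q ->]; exact: iter_mul_fixed. Qed.

Lemma iter_gcd_fixed d j z : (0 < d)%N -> iter d g z = z -> iter j g z = z ->
  iter (gcdn d j) g z = z.
Proof.
move=> d0 zd zj; have [a _ /dvdnP[q qE]] := Bezoutl j d0.
by rewrite -{2}(iter_mul_fixed q zd) -qE iterD (iter_mul_fixed a zj).
Qed.

Definition exact_period d z :=
  iter d g z = z /\ forall j, (0 < j < d)%N -> iter j g z <> z.

Lemma exact_period_dvd d k z : (0 < d)%N -> exact_period d z -> iter k g z = z ->
  (d %| k)%N.
Proof.
move=> d0 [zd zj] zk; have := iter_gcd_fixed d0 zd zk.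
have := dvdn_leq d0 (dvdn_gcdl d k); rewrite leq_eqVlt => /predU1P[<- _|H1 H2].
  exact: dvdn_gcdr.
by have := zj (gcdn d k); rewrite gcdn_gt0 d0 H1 => /(_ isT).
Qed.

Lemma exact_period_or d z : (0 < d)%N -> iter d g z = z ->
  exact_period d z \/ exists j, [/\ (0 < j < d)%N, (j %| d)%N & iter j g z = z].
Proof.
move=> d0 zd.
have [[j [jd zj]]|H] := pselect (exists j, (0 < j < d)%N /\ iter j g z = z).
  right; exists (gcdn d j); rewrite dvdn_gcdl gcdn_gt0 d0; split=> //.
    move: jd => /andP[j0 jd]; apply: leq_ltn_trans jd.
    exact: dvdn_leq j0 (dvdn_gcdr _ _).
  exact: iter_gcd_fixed.
by left; split=> // j jd zj; apply: H; exists j.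
Qed.

Lemma exact_period_image d z : exact_period d z -> exact_period d (g z).
Proof.
case: d => [|d] [zd zj]; first by split=> // j /andP[_]; rewrite ltn0.
split=> [|j jd gz]; first by rewrite -iterSr iterS zd.
apply: (zj j jd); have := congr1 (iter d g) gz.
by rewrite -iterD -!iterSr -[(d + j).+1]addSn addnC iterD zd.
Qed.

Lemma exact_period_iter d i z : exact_period d z -> exact_period d (iter i g z).
Proof. by move=> zd; elim: i => //= i; exact: exact_period_image. Qed.

End Periods.

Section LocalIterates.
Variables (R : realType) (n : nat).
Notation E := 'rV[R]_n.+1.
Implicit Types (g : E -> E) (x y z : E) (k d : nat).

Lemma jacobian_id x : 'J (@id E) x = 1%:M.
Proof. exact: has_jacobian_unique (has_jacobian_id x). Qed.

Lemma C1_at_iter g k x : (forall i, (i < k)%N -> C1_at g (iter i g x)) -> C1_at (iter k g) x.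
Proof.
elim: k => [|k IH] gk; first exact: C1_at_id.
have -> : iter k.+1 g = g \o iter k g by apply/funext.
apply: C1_at_comp; last by apply: gk.
by apply: IH => i ik; apply: gk; apply: leqW.
Qed.

Lemma jacobian_iter_comp g a b x :
  (forall i, (i < a + b)%N -> C1_at g (iter i g x)) ->
  'J (iter (a + b) g) x = 'J (iter b g) x *m 'J (iter a g) (iter b g x).
Proof.
move=> gx; have -> : iter (a + b) g = iter a g \o iter b g.
  by apply/funext => y /=; rewrite iterD.
apply: has_jacobian_unique; apply: has_jacobian_comp; apply: C1_at_jacobian.
  by apply: C1_at_iter => i ib; apply: gx; rewrite (leq_trans ib)// leq_addl.
by apply: C1_at_iter => i ia; rewrite -iterD; apply: gx; rewrite ltn_add2r.
Qed.

Lemma jacobian_iter_period g d q x : (forall i, C1_at g (iter i g x)) ->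
  iter d g x = x -> 'J (iter (q * d) g) x = 'J (iter d g) x ^+ q.
Proof.
move=> gx xd; elim: q => [|q IH]; first by rewrite mul0n expr0 jacobian_id.
rewrite exprSr mulSn (jacobian_iter_comp (fun i _ => gx i)) (iter_mul_fixed q xd) IH.
exact: erefl.
Qed.

End LocalIterates.

Lemma det_1BX_neq0 (F : fieldType) n (A : 'M[F]_n.+1) q :
  \det (1%:M - A ^+ q) != 0 -> \det (1%:M - A) != 0.
Proof.
apply: contraNneq => d0.
have -> : 1%:M - A ^+ q = (1%:M - A) *m (\sum_(i < q) A ^+ i).
  by have := subrX1 A q => /(congr1 -%R); rewrite opprB -mulNr opprB.
by rewrite det_mulmx d0 mul0r.
Qed.

(** * Generic perturbations *)

Lemma dist_lt_halves (R : realType) (V : normedModType R) (a b c : V) (e : R) :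
  `|a - b| < e / 2 -> `|b - c| < e / 2 -> `|a - c| < e.
Proof.
by move=> ab bc; rewrite (splitr e); apply: le_lt_trans (ler_distD b _ _) _; exact: ltrD.
Qed.

Lemma cvg_near_eq (I : Type) (F : set_system I) {FF : Filter F} (V : topologicalType)
    (f h : I -> V) (l : V) :
  F (fun i => h i = f i) -> f i @[i --> F] --> l -> h i @[i --> F] --> l.
Proof.
by move=> hf fl A /fl; rewrite !nbhs_simpl /=; apply: filterS2 hf => i /= ->.
Qed.

Lemma nbhs_dist_lt (R : realType) (V : normedModType R) (x : V) (r : R) :
  0 < r -> nbhs x [set y | `|x - y| < r].
Proof. by move=> r0; apply/nbhs_normP; exists r. Qed.

Lemma continuous_norm_comp (R : realType) (T : topologicalType) (V : normedModType R)
    (f : T -> V) x : {for x, continuous f} -> {for x, continuous (fun y => `|f y|)}.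
Proof. by move=> cf; apply: (continuous_comp cf); exact: norm_continuous. Qed.

Lemma continuous_dist (R : realType) (V : normedModType R) (x z : V) :
  {for x, continuous (fun y => `|y - z|)}.
Proof.
apply: continuous_norm_comp; apply: continuousB; first exact: cvg_id.
exact: cst_continuous.
Qed.

Section Perturbation.
Variables (R : realType) (n : nat).
Notation E := 'rV[R]_n.+1.
Implicit Types (g h : E -> E) (x y z : E) (k d : nat).

Definition smooth g := forall x, C1_at g x.

Definition C1_dist_lt (e : R) g h :=
  forall x, `|g x - h x| < e /\ `|'J g x - 'J h x| < e.

(** Uniform $C^1$ neighbourhoods among the maps that are $C^1$ everywhere. As a filter they let each
    perturbation keep, by intersection, all the open conditions obtained before it. *)
Definition C1nbhs g : set_system (E -> E) :=
  filter_from [set e : R | 0 < e] (fun e => [set h : E -> E | smooth h /\ C1_dist_lt e g h]).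

Global Instance C1nbhs_filter g : Filter (C1nbhs g).
Proof.
apply: filter_from_filter; first by exists 1; rewrite /= ltr01.
move=> e1 e2 /= e10 e20; exists (Num.min e1 e2); first by rewrite /= lt_min e10.
move=> h [hS H]; split; split=> // x; have [] := H x.
  by rewrite !lt_min => /andP[-> _] /andP[-> _].
by rewrite !lt_min => /andP[_ ->] /andP[_ ->].
Qed.

Lemma C1_dist_lt_refl g (e : R) : 0 < e -> C1_dist_lt e g g.
Proof. by move=> e0 x; rewrite !subrr !normr0. Qed.

Lemma C1nbhs_self g A : smooth g -> C1nbhs g A -> A g.
Proof. by move=> gS [e e0]; apply; split=> //; exact: C1_dist_lt_refl. Qed.

Lemma C1nbhs_smooth g : C1nbhs g smooth.
Proof. by exists 1; [rewrite /= ltr01 | move=> h []]. Qed.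

Lemma C1nbhs_nbhs g A : C1nbhs g A -> C1nbhs g [set h : E -> E | C1nbhs h A].
Proof.
move=> [e /= e0 eA]; have e2 : 0 < e / 2 by rewrite divr_gt0.
exists (e / 2) => // h [hS gh]; exists (e / 2) => // h' [h'S hh']; apply: eA.
split=> // x; have [a1 a2] := gh x; have [b1 b2] := hh' x; split.
  exact: dist_lt_halves a1 b1.
exact: dist_lt_halves a2 b2.
Qed.

Lemma smooth_iter g k : smooth g -> smooth (iter k g).
Proof. move=> gS x; exact: C1_at_iter (fun i _ => gS _). Qed.

Lemma jacobian_iterS g k x : smooth g ->
  'J (iter k.+1 g) x = 'J (iter k g) x *m 'J g (iter k g x).
Proof. move=> gS; exact: (@jacobian_iter_comp _ _ g 1 k x (fun i _ => gS _)). Qed.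

Section Limits.
Context (I : Type) (F : set_system I) {FF : Filter F}.
Variables (G : I -> E -> E) (g : E -> E).
Hypothesis gS : smooth g.
Hypothesis GF : forall A, C1nbhs g A -> F (fun i => A (G i)).

Lemma C1nbhs_eval (X : I -> E) x0 :
  X i @[i --> F] --> x0 -> G i (X i) @[i --> F] --> g x0.
Proof.
move=> Xx0; apply/cvgrPdist_lt => e e0; have e2 : 0 < e / 2 by rewrite divr_gt0.
have gX : g (X i) @[i --> F] --> g x0.
  by apply: continuous_cvg Xx0; exact: C1_at_continuous.
have H1 : F (fun i => C1_dist_lt (e / 2) g (G i)).
  by apply: (GF (A := C1_dist_lt (e / 2) g)); exists (e / 2) => // h [].
move/cvgrPdist_lt : gX => /(_ _ e2); apply: filterS2 H1 => i H1 H2.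
by have [H3 _] := H1 (X i); exact: dist_lt_halves H2 H3.
Qed.

Lemma C1nbhs_jac (X : I -> E) x0 :
  X i @[i --> F] --> x0 -> 'J (G i) (X i) @[i --> F] --> 'J g x0.
Proof.
move=> Xx0; apply/cvgrPdist_lt => e e0; have e2 : 0 < e / 2 by rewrite divr_gt0.
have gX : 'J g (X i) @[i --> F] --> 'J g x0.
  exact: (@continuous_cvg _ _ _ F FF X (jacobian g) x0 (C1_at_cjacobian (gS x0)) Xx0).
have H1 : F (fun i => C1_dist_lt (e / 2) g (G i)).
  by apply: (GF (A := C1_dist_lt (e / 2) g)); exists (e / 2) => // h [].
move/cvgrPdist_lt : gX => /(_ _ e2); apply: filterS2 H1 => i H1 H2.
by have [_ H3] := H1 (X i); exact: dist_lt_halves H2 H3.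
Qed.

Lemma C1nbhs_iter k (X : I -> E) x0 :
  X i @[i --> F] --> x0 -> iter k (G i) (X i) @[i --> F] --> iter k g x0.
Proof. by move=> Xx0; elim: k => [//|k IH]; exact: C1nbhs_eval IH. Qed.

Lemma C1nbhs_iter_jac k (X : I -> E) x0 :
  X i @[i --> F] --> x0 -> 'J (iter k (G i)) (X i) @[i --> F] --> 'J (iter k g) x0.
Proof.
move=> Xx0; elim: k => [|k IH].
  have -> : (fun i => 'J (iter 0 (G i)) (X i)) = (fun=> 'J (iter 0 g) x0).
    by apply/funext => i /=; rewrite !jacobian_id.
  exact: cvg_cst.
rewrite (jacobian_iterS k x0 gS).
have H := cvg_mulmx IH (C1nbhs_jac (C1nbhs_iter (k := k) Xx0)).
have HE : F (fun i => 'J (iter k.+1 (G i)) (X i) =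
    'J (iter k (G i)) (X i) *m 'J (G i) (iter k (G i) (X i))).
  by apply: filterS (GF (@C1nbhs_smooth g)) => i; exact: jacobian_iterS.
exact: (cvg_near_eq HE (H FF)).
Qed.

End Limits.

Definition nondeg k g y := \det (1%:M - 'J (iter k g) y) != 0.

(** Conditions on [iter k h x] and its Jacobian are open in the pair of [x] and [h]; compactness
    then makes them uniform in [x]. *)
Definition eval_nbhs x0 g := filter_prod (nbhs x0) (C1nbhs g).

Global Instance eval_nbhs_filter x0 g : Filter (eval_nbhs x0 g).
Proof. exact: filter_prod_filter. Qed.

Lemma eval_nbhsE x0 g (P : E -> (E -> E) -> Prop) :
  eval_nbhs x0 g (fun q : E * (E -> E) => P q.1 q.2) ->
  exists2 r, 0 < r & C1nbhs g [set h : E -> E | forall x, `|x - x0| < r -> P x h].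
Proof.
move=> [[A B] [/= /nbhs_normP[r /= r0 rA] gB] AB]; exists r => //.
apply: filterS gB => h Bh x xr; apply: (AB (x, h)); split=> //=.
by apply: rA; rewrite /= distrC.
Qed.

Lemma near_iter k x0 g (A : set E) : smooth g -> nbhs (iter k g x0) A ->
  eval_nbhs x0 g (fun q : E * (E -> E) => A (iter k q.2 q.1)).
Proof.
move=> gS xA.
have H : (fun q : E * (E -> E) => iter k q.2 q.1) @ eval_nbhs x0 g --> iter k g x0.
  apply: (@C1nbhs_iter _ (eval_nbhs x0 g) _ snd g gS) => [B gB|]; last exact: cvg_fst.
  by exists (setT, B) => [|[? ?] []//]; split=> //; exact: filterT.
exact: H _ xA.
Qed.

Lemma near_iter_jac k x0 g (A : set 'M[R]_n.+1) : smooth g -> nbhs ('J (iter k g) x0) A ->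
  eval_nbhs x0 g (fun q : E * (E -> E) => A ('J (iter k q.2) q.1)).
Proof.
move=> gS xA.
have H : (fun q : E * (E -> E) => 'J (iter k q.2) q.1) @ eval_nbhs x0 g --> 'J (iter k g) x0.
  apply: (@C1nbhs_iter_jac _ (eval_nbhs x0 g) _ snd g gS) => [B gB|]; last exact: cvg_fst.
  by exists (setT, B) => [|[? ?] []//]; split=> //; exact: filterT.
exact: H _ xA.
Qed.

Lemma near_iter_neq k x0 g : smooth g -> iter k g x0 <> x0 ->
  eval_nbhs x0 g (fun q : E * (E -> E) => iter k q.2 q.1 <> q.1).
Proof.
move=> gS x0N; pose r := `|iter k g x0 - x0| / 2.
have r0 : 0 < r by rewrite divr_gt0// normr_gt0 subr_eq0; exact/eqP.
have n1 : nbhs (iter k g x0) [set y | `|iter k g x0 - y| < r]. by exact: nbhs_dist_lt.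
have H1 := near_iter gS n1.
have n2 : nbhs x0 [set y | `|x0 - y| < r] by exact: nbhs_dist_lt.
have H2 := @near_iter 0 x0 g _ gS n2.
apply: filterS2 H1 H2 => -[x h] /= H1 H2 xE; rewrite xE in H1.
have := ler_distD x (iter k g x0) x0; rewrite [`|x - x0|]distrC.
have : `|iter k g x0 - x0| = r + r by rewrite -splitr.
by move=> -> H; have := ltrD H1 H2; rewrite ltNge H.
Qed.

Lemma near_nondeg k x0 g : smooth g -> nondeg k g x0 ->
  eval_nbhs x0 g (fun q : E * (E -> E) => nondeg k q.2 q.1).
Proof.
move=> gS nd.
pose A := [set M : 'M[R]_n.+1 | \det (1%:M - M) != 0].
suff nA : nbhs ('J (iter k g) x0) A by exact: near_iter_jac nA.
have c1 : {for 'J (iter k g) x0, continuous (fun M : 'M[R]_n.+1 => 1%:M - M)}.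
  by apply: continuousB; [exact: cst_continuous | exact: cvg_id].
have c2 : {for 'J (iter k g) x0, continuous ((fun M : 'M[R]_n.+1 => \det M) \o (fun M => 1%:M - M))}.
  by apply: continuous_comp; [exact: c1 | exact: continuous_det].
have o : nbhs (\det (1%:M - 'J (iter k g) x0)) [set t : R | t != 0].
  have : open [set t : R | t != 0] by exact: open_neq.
  by rewrite openE; apply.
exact: c2 _ o.
Qed.

Lemma near_compact (K : set E) g (P : E -> (E -> E) -> Prop) : compact K ->
  (forall x, K x -> eval_nbhs x g (fun q : E * (E -> E) => P q.1 q.2)) ->
  C1nbhs g [set h : E -> E | forall x, K x -> P x h].
Proof.
move=> /compact_near_coveringP cK KP.
have := cK (E -> E) (C1nbhs g) (fun h x => P x h) _.
by apply => x Kx; exact: KP.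
Qed.

Lemma near_compact_nondeg (K : set E) k j g : smooth g -> compact K ->
  (forall x, K x -> iter j g x = x -> nondeg k g x) ->
  C1nbhs g [set h : E -> E | forall x, K x -> iter j h x = x -> nondeg k h x].
Proof.
move=> gS cK H; apply: (near_compact (P := fun (x : E) (h : E -> E) => iter j h x = x -> nondeg k h x)) => // x Kx.
have [xE|xN] := pselect (iter j g x = x).
  by apply: filterS (near_nondeg gS (H x Kx xE)) => q nq _.
by apply: filterS (near_iter_neq gS xN) => q.
Qed.

(** One radius serves all [h] near [g]: on the ball the differential of [id - iter k h] stays close
    to an invertible matrix, so the mean value inequality makes this map injective. The two factors
    n+1 in [c] come from that inequality and from the product with the inverse. *)
Lemma near_unique_fixed k g x0 : smooth g -> nondeg k g x0 ->
  exists2 r, 0 < r & C1nbhs g [set h : E -> E | forall x y, `|x - x0| < r -> `|y - x0| < r ->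
    iter k h x = x -> iter k h y = y -> x = y].
Proof.
move=> gS nd; pose L := 'J (iter k g) x0.
have uL : 1%:M - L \in unitmx by rewrite unitmxE unitfE.
pose c := n.+1%:R * `|invmx (1%:M - L)| * n.+1%:R.
have c0 : 0 <= c by rewrite mulr_ge0// mulr_ge0.
pose e := (c + 1)^-1 / 2.
have e0 : 0 < e by rewrite divr_gt0// invr_gt0 ltr_wpDl.
have n1 : nbhs L [set M | `|L - M| < e] by exact: nbhs_dist_lt.
have [r r0 Hr] := eval_nbhsE (P := fun (x : E) (h : E -> E) => `|L - 'J (iter k h) x| < e) (near_iter_jac gS n1).
exists r => //; apply: filterS2 (@C1nbhs_smooth g) Hr => h hS Hr x y xr yr hx hy.
have := @mean_value_le R _ _ (iter k h) x y L e (jacobian (iter k h)).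
rewrite hx hy => /(_ _)/wrap[].
  move=> t /andP[t0 t1]; split; first by apply: C1_at_jacobian; exact: smooth_iter.
  rewrite distrC; apply: ltW; apply: Hr.
  have -> : x + t *: (y - x) - x0 = (1 - t) *: (x - x0) + t *: (y - x0).
    rewrite scalerBl scale1r !scalerBr; apply/matrixP => i j; rewrite !mxE; ring.
  apply: le_lt_trans (ler_normD _ _) _; rewrite !normrZ (ger0_norm t0) ger0_norm ?subr_ge0//.
  have [->|tn] := eqVneq t 0; first by rewrite subr0 mul1r mul0r addr0.
  have tp : 0 < t by rewrite lt_neqAle eq_sym tn.
  have -> : r = (1 - t) * r + t * r by ring.
  by apply: ler_ltD; [rewrite ler_wpM2l ?subr_ge0// ltW | rewrite ltr_pM2l].
have -> : y - x - (y - x) *m L = (y - x) *m (1%:M - L) by rewrite mulmxBr mulmx1.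
move=> H; have := mulmx_norm_le ((y - x) *m (1%:M - L)) (invmx (1%:M - L)).
rewrite mulmxK// => H'; apply/esym/eqP; rewrite -subr_eq0 -normr_le0.
have : `|y - x| <= `|y - x| / 2.
  have ce : c * e <= 2^-1.
    by rewrite /e mulrA -[leRHS]mul1r ler_pM2r// ler_pdivrMr ?mul1r ?ltr_wpDl// lerDl.
  apply: le_trans H' _; apply: (@le_trans _ _ (`|y - x| * (c * e))); last exact: ler_wpM2l.
  have -> : `|y - x| * (c * e) =
      n.+1%:R * ((n.+1%:R * (`|y - x| * e)) * `|invmx (1%:M - L)|).
    by rewrite /c; clear; ring.
  by rewrite ler_wpM2l// ler_wpM2r.
by have := normr_ge0 (y - x); lra.
Qed.

Lemma compact_cball z (r : R) : compact [set x : E | `|x - z| <= r].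
Proof.
apply: bounded_closed_compact.
  exists (r + `|z|); split; first exact: num_real.
  move=> M rM x /= xz; apply: ltW; apply: le_lt_trans rM.
  by rewrite -[x](subrK z); apply: le_trans (ler_normD _ _) _; rewrite lerD2r.
have -> : [set x : E | `|x - z| <= r] = (fun x : E => `|x - z|) @^-1` [set t | t <= r] by [].
apply: closed_comp; last exact: closed_le.
by move=> x _; exact: continuous_dist.
Qed.

Lemma C1_bounded_support m (h : E -> 'rV[R]_m) z (r : R) :
  (forall x, C1_at h x) -> (forall x, r <= `|x - z| -> h x = 0) ->
  exists2 C : R, 0 <= C & forall x, `|h x| <= C /\ `|'J h x| <= C.
Proof.
move=> hS h0; have cK := @compact_cball z r.
have [C1 HC1] : exists C : nat, forall x, `|x - z| <= r -> `|h x| <= C%:R.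
  apply: (compact_bound_nat cK) => x _.
  by apply: continuous_norm_comp; exact: C1_at_continuous.
have [C2 HC2] : exists C : nat, forall x, `|x - z| <= r -> `|'J h x| <= C%:R.
  apply: (compact_bound_nat cK) => x _.
  by apply: continuous_norm_comp; exact: C1_at_cjacobian.
exists (C1%:R + C2%:R) => [|x]; first by rewrite addr_ge0.
have [xr|xr] := leP `|x - z| r.
  split; first by apply: le_trans (HC1 x xr) _; rewrite lerDl.
  by apply: le_trans (HC2 x xr) _; rewrite lerDr.
have hx : h x = 0 by exact: h0 (ltW xr).
split; first by rewrite hx normr0 addr_ge0.
have -> : 'J h x = 0.
  apply: has_jacobian_unique; have := has_jacobian_cst (0 : 'rV[R]_m) x.
  apply: has_jacobian_near.
  have c := @continuous_dist R E x z.
  have o : nbhs `|x - z| [set t | r < t] by exact: lt_nbhsr.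
  have H : \forall y \near x, r < `|y - z| by exact: c _ o.
  by apply: filterS H => y yr; rewrite h0 ?ltW.
by rewrite normr0 addr_ge0.
Qed.

(** A $C^1$ plateau: the inner [sqpos] is at least 1/4 where the squared Euclidean distance is at
    most half of [s ^+ 2], which makes the value 1 there, and it vanishes beyond [s]. An exact
    plateau makes a cut-off translation a true translation near [z]. *)
Definition cutoff z (s : R) x : R :=
  1 - sqpos (1 - 4 * sqpos (1 - (\sum_i (x ord0 i - z ord0 i) ^+ 2) / s ^+ 2)).

Lemma C1_at_sqpos m (s : 'rV[R]_m -> R) (p : 'rV[R]_m) :
  C1_at (fun y : 'rV[R]_m => (s y)%:M : 'rV[R]_1) p ->
  C1_at (fun y : 'rV[R]_m => (sqpos (s y))%:M : 'rV[R]_1) p.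
Proof.
move=> sp; apply: (C1_at_real (h' := fun t => 2 * Num.max 0 t)) => //.
apply: filterE => t; split; first exact: is_derive_sqpos.
apply: continuousM; first exact: cst_continuous.
by apply: continuous_max; [exact: cst_continuous | exact: cvg_id].
Qed.

Lemma C1_at_affine m (a b : R) (s : 'rV[R]_m -> R) (p : 'rV[R]_m) :
  C1_at (fun y : 'rV[R]_m => (s y)%:M : 'rV[R]_1) p ->
  C1_at (fun y : 'rV[R]_m => (a - b * s y)%:M : 'rV[R]_1) p.
Proof.
move=> sp; have H := C1_atB (C1_at_cst a%:M p) (C1_atZ b sp).
apply: C1_at_near H; apply: filterE => y.
by rewrite raddfB /= scale_scalar_mx.
Qed.

Lemma C1_at_cutoff z (s : R) p : C1_at (fun x => (cutoff z s x)%:M : 'rV[R]_1) p.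
Proof.
have H0 := C1_at_affine 1 (s ^+ 2)^-1 (C1_at_sqnorm z p).
have H1 := C1_at_affine 1 4 (C1_at_sqpos H0).
have H2 := C1_at_affine 1 1 (C1_at_sqpos H1).
apply: C1_at_near H2; apply: filterE => y; rewrite /cutoff mul1r.
by rewrite [(s ^+ 2)^-1 * _]mulrC.
Qed.

Lemma cutoff_near1 z (s : R) : 0 < s ->
  exists2 r, 0 < r & forall x, `|x - z| < r -> cutoff z s x = 1.
Proof.
move=> s0; pose q (x : E) := \sum_i (x ord0 i - z ord0 i) ^+ 2.
have cq : {for z, continuous q} by exact: continuous_scalar_mx (C1_at_continuous (C1_at_sqnorm z z)).
have qz : q z = 0 by rewrite /q big1// => i _; rewrite subrr expr0n.
have o : nbhs (q z) [set t | t < s ^+ 2 / 2].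
  by apply: lt_nbhsl; rewrite qz divr_gt0// exprn_gt0.
have H : \forall x \near z, q x < s ^+ 2 / 2 by exact: cq _ o.
have /nbhs_normP[r /= r0 Hr] := H.
exists r => // x xr.
have : q x < s ^+ 2 / 2 by apply: Hr; rewrite /= distrC.
rewrite /cutoff -/(q x) => qx.
have u2 : q x / s ^+ 2 < 2^-1 by rewrite ltr_pdivrMr ?exprn_gt0// mulrC.
move: (q x / s ^+ 2) u2 => u u2.
have u0 : 2^-1 < 1 - u by lra.
rewrite /sqpos [Num.max 0 (1 - u)]max_r; last by lra.
rewrite max_l; first by rewrite expr0n subr0.
have : (2^-1 : R) ^+ 2 <= (1 - u) ^+ 2.
  by rewrite lerXn2r ?nnegrE ?ltW// (lt_trans _ u0)// invr_gt0.
rewrite expr2; lra.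
Qed.

Lemma cutoff_out z (s : R) x : 0 < s -> s <= `|x - z| -> cutoff z s x = 0.
Proof.
move=> s0 sx; pose q := \sum_i (x ord0 i - z ord0 i) ^+ 2.
have sq : s ^+ 2 <= q.
  have [i xi] := rV_norm_attained (x - z).
  rewrite /q (bigD1 i)//=; apply: (@le_trans _ _ ((x ord0 i - z ord0 i) ^+ 2)).
    rewrite -[leRHS]real_normK ?num_real// lerXn2r ?nnegrE ?(ltW s0)//.
    by move: xi; rewrite !mxE => <-.
  by rewrite lerDl sumr_ge0// => j _; exact: sqr_ge0.
rewrite /cutoff -/q; have : 1 <= q / s ^+ 2 by rewrite ler_pdivlMr ?exprn_gt0// mul1r.
move: (q / s ^+ 2) => u u1; rewrite /sqpos [Num.max 0 (1 - u)]max_l; last by lra.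
by rewrite expr0n mulr0 subr0 max_r// expr1n subrr.
Qed.

Lemma cutoff_ge0_le1 z (s : R) x : 0 <= cutoff z s x <= 1.
Proof.
have sq0 (t : R) : 0 <= sqpos t by exact: sqr_ge0.
have sq1 (t : R) : t <= 1 -> sqpos t <= 1.
  by move=> t1; rewrite /sqpos expr_le1// ?le_max ?lexx// ge_max ler01.
by rewrite /cutoff subr_ge0 gerBl sq0 sq1// gerBl mulr_ge0.
Qed.

End Perturbation.

Section Generic.
Variables (R : realType) (n : nat).
Notation E := 'rV[R]_n.+1.
Implicit Types (g h : E -> E) (x y z : E) (k d : nat).

Lemma C1nbhs_add g A : smooth g -> C1nbhs g A ->
  exists2 c : R, 0 < c & forall h, smooth h ->
    (forall x, `|h x| < c /\ `|'J h x| < c) -> A (fun x => g x + h x).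
Proof.
move=> gS [e /= e0 eA]; exists e => // h hS hc; apply: eA; split.
  by move=> x; exact: C1_atD (gS x) (hS x).
move=> x; have [hx jx] := hc x.
have -> : 'J (fun y => g y + h y) x = 'J g x + 'J h x.
  apply: has_jacobian_unique.
  exact: has_jacobianD (C1_at_jacobian (gS x)) (C1_at_jacobian (hS x)).
by split; rewrite opprD addNKr normrN.
Qed.

Lemma nondeg_dvd g d k x : smooth g -> iter d g x = x -> (d %| k)%N ->
  nondeg k g x -> nondeg d g x.
Proof.
move=> gS xd /dvdnP[q ->]; rewrite /nondeg (jacobian_iter_period q (fun i => gS _) xd).
exact: det_1BX_neq0.
Qed.

(* A constant b added near the last point of the orbit of z translates
   iter d g by b near z; Sard's theorem provides the choice of b. *)
Lemma generic_local d g z : smooth g -> (0 < d)%N -> exact_period g d z ->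
  exists2 r, 0 < r & C1nbhs g [set h : E -> E | smooth h -> forall A, C1nbhs h A ->
    exists h', [/\ A h', smooth h' &
      forall y, `|y - z| <= r -> iter d h' y = y -> nondeg d h' y]].
Proof.
case: d => // m gS _ [zm zj]; pose w := iter m g z.
have zw i : (i < m)%N -> iter i g z <> w.
  move=> im iw; apply: (zj i.+1); first by rewrite ltn0Sn.
  by rewrite -[RHS]zm !iterS iw.
have [s s0 Hs] : exists2 s : R, 0 < s & forall i, (i < m)%N -> s < `|iter i g z - w|.
  have H : \forall s \near (0 : R)^'+, forall i, i \in iota 0 m -> s < `|iter i g z - w|.
    apply: near_all_seq => i; rewrite mem_iota add0n => /andP[_ im].
    by apply: nbhs_right_lt; rewrite normr_gt0 subr_eq0; apply/eqP; exact: zw.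
  have [s [s0 Hs]] := filter_ex (filterI (nbhs_right_gt (0 : R)) H).
  by exists s => // i im; apply: Hs; rewrite mem_iota.
have [r1 r10 Hr1] := cutoff_near1 w s0.
pose P (x : E) (h : E -> E) := (forall i, i \in iota 0 m -> s < `|iter i h x - w|) /\
  `|iter m h x - w| < r1.
have [r2 r20 Hr2] : exists2 r, 0 < r &
    C1nbhs g [set h : E -> E | forall x, `|x - z| < r -> P x h].
  have H1 : eval_nbhs z g (fun q : E * (E -> E) =>
      forall i, i \in iota 0 m -> s < `|iter i q.2 q.1 - w|).
    apply: (near_all_seq (P := fun (q : E * (E -> E)) i => s < `|iter i q.2 q.1 - w|)
      (eval_nbhs_filter z g)) => i.
    rewrite mem_iota add0n => /andP[_ im].
    apply: (near_iter (A := [set y : E | s < `|y - w|]) gS).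
    have o : nbhs `|iter i g z - w| [set t | s < t] by apply: lt_nbhsr; exact: Hs.
    exact: (@continuous_dist R E (iter i g z) w) _ o.
  have H2 : eval_nbhs z g (fun q : E * (E -> E) => `|iter m q.2 q.1 - w| < r1).
    apply: (near_iter (A := [set y : E | `|y - w| < r1]) gS).
    have o : nbhs `|w - w| [set t | t < r1] by apply: lt_nbhsl; rewrite subrr normr0.
    exact: (@continuous_dist R E w w) _ o.
  apply: eval_nbhsE; apply: filterS2 H1 H2 => q a b; split.
    exact: a.
  exact: b.
have r0 : 0 < r2 / 2 by rewrite divr_gt0.
exists (r2 / 2) => //; apply: filterS Hr2 => h Ph hS A hA.
have cut0 x : s <= `|x - w| -> (cutoff w s x)%:M = 0 :> 'rV[R]_1.
  by move=> sx; rewrite cutoff_out// raddf0.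
have [C C0 HC] := C1_bounded_support (C1_at_cutoff w s) cut0.
have [c c0 Hc] := C1nbhs_add hS hA.
pose f (y : E) := y - iter m.+1 h y.
have fC y : C1_at f y by apply: C1_atB; [exact: C1_at_id | exact: smooth_iter].
have b0 : 0 < c / (C + 1) by rewrite divr_gt0// ltr_wpDl.
(* Near [z] the fixed points of the perturbed iterate are the solutions of [f y = b], and ['J f] is
   the matrix whose determinant must not vanish. *)
have [b [bc breg]] := @sard R n f _ (@compact_cball R n z (r2 / 2)) (fun y _ => fC y) 0 _ b0.
rewrite subr0 in bc.
pose p x : E := cutoff w s x *: b.
have pS : smooth p by move=> x; exact: C1_at_scale (C1_at_cutoff w s x) (C1_at_cst b x).
pose h' x := h x + p x.
have Ah' : A h'.
  apply: Hc => // x; have /andP[be0 be1] := cutoff_ge0_le1 w s x; split.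
    rewrite normrZ ger0_norm//; apply: (@le_lt_trans _ _ (1 * `|b|)).
      by rewrite ler_wpM2r.
    rewrite mul1r; apply: lt_le_trans bc _.
    by rewrite ler_pdivrMr ?ltr_wpDl// ler_peMr ?(ltW c0)// lerDr.
  have -> : 'J p x = 'J (fun x => (cutoff w s x)%:M : 'rV[R]_1) x *m b.
    apply: has_jacobian_unique.
    have := has_jacobian_scale (C1_at_jacobian (C1_at_cutoff w s x)) (has_jacobian_cst b x).
    by rewrite scaler0 addr0.
  apply: le_lt_trans (mulmx_norm_le _ _) _; rewrite mul1r.
  apply: (@le_lt_trans _ _ (C * `|b|)).
    by rewrite ler_wpM2r//; have [] := HC x.
  apply: (@le_lt_trans _ _ (C * (c / (C + 1)))); first by rewrite ler_wpM2l// ltW.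
  by rewrite mulrA ltr_pdivrMr ?ltr_wpDl// mulrC ltr_pM2l// ltrDl.
have h'S : smooth h' by move=> x; exact: C1_atD (hS x) (pS x).
have itE y : `|y - z| < r2 -> iter m.+1 h' y = iter m.+1 h y + b.
  move=> yr; have [Py1 Py2] := Ph y yr.
  have itE i : (i <= m)%N -> iter i h' y = iter i h y.
    elim: i => // i IH im; rewrite !iterS IH 1?ltnW// /h' /p cutoff_out ?scale0r ?addr0//.
    by apply: ltW; apply: Py1; rewrite mem_iota.
  by rewrite !iterS itE// /h' /p Hr1// scale1r.
exists h'; split=> // y yr yfix.
have yr2 : `|y - z| < r2.
  by apply: le_lt_trans yr _; rewrite ltr_pdivrMr// mulr_natr mulr2n ltrDl.
have JE : 'J (iter m.+1 h') y = 'J (iter m.+1 h) y.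
  apply: has_jacobian_unique.
  have := has_jacobianD (C1_at_jacobian (smooth_iter m.+1 hS y)) (has_jacobian_cst b y).
  rewrite addr0; apply: has_jacobian_near.
  have o : nbhs `|y - z| [set t | t < r2] by exact: lt_nbhsl.
  have {}o : \forall v \near y, `|v - z| < r2 by exact: (@continuous_dist R E y z) _ o.
  by apply: filterS o => v vr; rewrite itE.
rewrite /nondeg JE.
have <- : 'J f y = 1%:M - 'J (iter m.+1 h) y.
  apply: has_jacobian_unique.
  exact: has_jacobianB (has_jacobian_id y) (C1_at_jacobian (smooth_iter m.+1 hS y)).
apply: breg; first exact: yr.
by have := itE y yr2; rewrite yfix /f => {1}->; rewrite addrAC subrr add0r.
Qed.

(** Points that are not fixed by [iter d g], or are of smaller period, need no change. Finitely many
    balls cover [K], each with a radius valid for all maps near [g], so they can be treated in turn: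
    nondegeneracy on the closed balls already treated is open and survives. *)
Lemma generic_period g (K : set E) k d (A : set (E -> E)) :
  compact K -> smooth g -> (0 < d)%N -> (d %| k)%N ->
  C1nbhs g [set h : E -> E | forall x, iter d h x = x -> K x] ->
  (forall j, (0 < j < d)%N -> (j %| d)%N -> forall x, iter j g x = x -> nondeg k g x) ->
  C1nbhs g A ->
  exists h, [/\ smooth h, C1nbhs h A & forall x, iter d h x = x -> nondeg d h x].
Proof.
move=> cK gS d0 dk HK low gA.
pose Q (x : E) (r : R) (h : E -> E) :=
  forall y, `|y - x| <= r -> iter d h y = y -> nondeg d h y.
have LS x : exists r, 0 < r /\ C1nbhs g [set h : E -> E | smooth h -> forall B, C1nbhs h B ->
    exists h', [/\ B h', smooth h' & Q x r h']].
  have triv : eval_nbhs x g (fun q : E * (E -> E) => iter d q.2 q.1 = q.1 -> nondeg d q.2 q.1) ->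
      exists r, 0 < r /\ C1nbhs g [set h : E -> E | smooth h -> forall B, C1nbhs h B ->
      exists h', [/\ B h', smooth h' & Q x r h']].
    move=> /(eval_nbhsE (P := fun (x : E) (h : E -> E) => iter d h x = x -> nondeg d h x)).
    move=> [r r0 Hr]; exists (r / 2); split; first by rewrite divr_gt0.
    apply: filterS Hr => h Hh hS B hB; exists h; split=> //.
      exact: C1nbhs_self hB.
    move=> y yr; apply: Hh; apply: le_lt_trans yr _.
    by rewrite ltr_pdivrMr// mulr_natr mulr2n ltrDl.
  have [xd|xd] := pselect (iter d g x = x); last first.
    by apply: triv; apply: filterS (near_iter_neq gS xd) => q.
  have [xe|[j [jd jdd xj]]] := exact_period_or d0 xd.
    by have [r r0 H] := generic_local gS d0 xe; exists r.
  apply: triv; have := nondeg_dvd gS xd dk (low j jd jdd x xj).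
  by move=> /(near_nondeg gS); apply: filterS => q.
have /choice[r Hr] := LS.
have [s Ks] := @compact_finite_cover _ K (fun x => [set y : E | `|x - y| < r x]) cK
  (fun x _ => nbhs_dist_lt x (proj1 (Hr x))).
pose S := [set h : E -> E | forall x, x \in s -> smooth h -> forall B, C1nbhs h B ->
    exists h', [/\ B h', smooth h' & Q x (r x) h']].
have gSs : C1nbhs g S.
  apply: (near_all_seq (P := fun (h : E -> E) x => smooth h -> forall B, C1nbhs h B ->
    exists h', [/\ B h', smooth h' & Q x (r x) h']) (C1nbhs_filter g)) => x _.
  exact: (proj2 (Hr x)).
pose A0 := A `&` (S `&` [set h : E -> E | forall x, iter d h x = x -> K x]).
have gA0 : C1nbhs g A0 by apply: filterI => //; exact: filterI.
have [h [hS hA hQ]] : exists h, [/\ smooth h, C1nbhs h A0 & forall x, x \in s -> Q x (r x) h].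
  have : {subset s <= s} by [].
  elim: {1 3}s => [_|x s' IH ss']; first by exists g; split.
  have [|h [hS hA hQ]] := IH; first by move=> y ys; apply: ss'; rewrite in_cons ys orbT.
  have [_ [hSs _]] := C1nbhs_self hS hA.
  have hB : C1nbhs h [set h' | C1nbhs h' A0 /\ forall y, y \in s' -> Q y (r y) h'].
    apply: filterI; first exact: C1nbhs_nbhs.
    apply: (near_all_seq (P := fun (h : E -> E) y => Q y (r y) h) (C1nbhs_filter h)) => y ys.
    exact: (near_compact_nondeg hS (@compact_cball R n y (r y)) (hQ y ys)).
  have [h' [[h'A h'Q] h'S h'x]] := hSs x (ss' _ (mem_head _ _)) hS _ hB.
  by exists h'; split=> // y; rewrite in_cons => /predU1P[->//|]; exact: h'Q.
have [_ [_ hK]] := C1nbhs_self hS hA.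
exists h; split; [exact: hS | by apply: filterS hA => h' [] |].
move=> x xd; have [z zs xz] := Ks x (hK x xd).
apply: (hQ z zs) xd; by rewrite distrC ltW.
Qed.

End Generic.

(** * Signs of determinants *)

Section SignDet.
Import complex.
Variable R : realType.

(** Over the complex numbers the matrix is [(M + ib) (M - ib)], so its determinant is the squared
    modulus of that of [M + ib]. *)
Lemma det_sqrD_ge0 n (M : 'M[R]_n) (b : R) : 0 <= \det (M *m M + (b ^+ 2)%:M).
Proof.
pose f := real_complex R; pose ib : R[i] := Complex 0 b.
pose P : 'M[R[i]]_n := map_mx f M + ib%:M.
have ib2 : ib * ib = - f (b ^+ 2).
  by apply/eqP; rewrite eq_complex /=; apply/andP; split; apply/eqP; ring.
have PE : map_mx f (M *m M + (b ^+ 2)%:M) = P *m map_mx conjc P.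
  have -> : map_mx conjc P = map_mx f M - ib%:M.
    apply/matrixP => i j; rewrite !mxE; case: (i == j); rewrite ?mulr1n ?mulr0n ?oppr0 ?addr0.
      by apply/eqP; rewrite eq_complex /=; apply/andP; split; apply/eqP; ring.
    by apply/eqP; rewrite eq_complex /=; apply/andP; split; apply/eqP; ring.
  rewrite map_mxD map_mxM map_scalar_mx /= /P mulmxDl !mulmxBr.
  rewrite mul_mx_scalar mul_scalar_mx -scalar_mxM ib2.
  by rewrite addrACA addrA addrAC; apply/matrixP => i j; rewrite !mxE mulNrn; ring.
have := congr1 (fun X => \det X) PE; rewrite det_mulmx !det_map_mx /=.
case: (\det P) => x y /eqP; rewrite eq_complex /= => /andP[/eqP -> _].
by rewrite mulrN opprK -!expr2 addr_ge0 ?sqr_ge0.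
Qed.

(* Over the complex numbers q is a product of conjugate pairs of factors. *)
Lemma det_horner_ge0 n (A : 'M[R]_n.+1) (q : {poly R}) :
  0 < lead_coef q -> (forall x, ~~ root q x) -> 0 <= \det (horner_mx A q).
Proof.
have [m] := ubnP (size q); elim: m q => // m IH q qm lq nq.
have q0 : q != 0 by apply: contraTneq lq => ->; rewrite lead_coef0 ltxx.
have [s1|s1] := eqVneq (size q) 1%N.
  have /eqP/size_poly1P[c c0 qc] := s1.
  rewrite qc horner_mx_C det_scalar exprn_ge0// ltW//.
  by rewrite qc lead_coefC in lq.
pose f := real_complex R.
have [[a b] /= ab] : exists x : R[i], root (map_poly f q) x.
  by apply/closed_rootP; rewrite size_map_poly.
have b0 : b != 0.
  apply: contraNneq (nq a) => b0; move: ab; rewrite b0 -[Complex a 0]/(f a).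
  by rewrite fmorph_root.
pose d : {poly R} := ('X - a%:P) ^+ 2 + (b ^+ 2)%:P.
have sd : size d = 3.
  rewrite size_polyDl; first by rewrite size_exp_XsubC.
  by rewrite size_exp_XsubC (leq_ltn_trans (size_polyC_leq1 _)).
have dmon : d \is monic.
  rewrite monicE lead_coefDl; last first.
    by rewrite size_exp_XsubC (leq_ltn_trans (size_polyC_leq1 _)).
  by rewrite lead_coef_exp lead_coefXsubC expr1n.
have dl : root (map_poly f d) (Complex a b).
  rewrite /root rmorphD rmorphXn rmorphB /= map_polyX !map_polyC /= !hornerE /=.
  rewrite eq_complex /= expr2 /=; apply/andP; split; apply/eqP; ring.
(* The remainder is real, of degree at most 1, and has the nonreal root a + ib. *)
have r0 : modp q d = 0.
  have : root (map_poly f (modp q d)) (Complex a b).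
    move: ab; rewrite {1}(divp_eq q d) rmorphD rmorphM /= /root hornerD hornerM.
    by move/eqP : dl => ->; rewrite mulr0 add0r.
  have : (size (modp q d) < size d)%N by rewrite ltn_modp -size_poly_eq0 sd.
  rewrite sd ltnS.
  move: (modp q d) => r sr rr.
  have rE : r = (r`_1)%:P * 'X + (r`_0)%:P.
    apply/polyP => i; rewrite coefD coefCM coefX coefC.
    case: i => [|[|i]] /=; rewrite ?mulr0 ?mulr1 ?add0r ?addr0//.
    by rewrite nth_default//; apply: leq_trans sr _.
  move: rr; rewrite rE rmorphD rmorphM /= !map_polyC map_polyX /root !hornerE /=.
  rewrite eq_complex /= !mul0r subr0 !addr0 => /andP[/eqP e1 /eqP e2].
  have r1 : r`_1 = 0.
    by apply/eqP; move/eqP : e2; rewrite mulf_eq0 (negbTE b0) orbF.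
  move: e1; rewrite r1 mul0r add0r => ->; by rewrite !polyC0 mul0r addr0.
have qE : q = divp q d * d by rewrite {1}(divp_eq q d) r0 addr0.
have qd0 : divp q d != 0 by apply: contraNneq q0 => h; rewrite qE h mul0r.
rewrite qE rmorphM /= det_mulmx mulr_ge0//.
  apply: IH.
  - rewrite size_divp; last by rewrite -size_poly_eq0 sd.
    have : (0 < size q)%N by rewrite size_poly_gt0.
    rewrite sd /=; move: qm; move: (size q) => k; clear; lia.
  - by move: lq; rewrite {1}qE lead_coef_Mmonic.
  - by move=> x; apply: contra (nq x); rewrite {2}qE rootM => ->.
rewrite rmorphD rmorphXn rmorphB /= horner_mx_X !horner_mx_C expr2.
exact: det_sqrD_ge0.
Qed.

Lemma poly_roots_seq (p : {poly R}) : p != 0 ->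
  exists rs : seq R, uniq rs /\ forall x, (x \in rs) = root p x.
Proof.
have [m] := ubnP (size p); elim: m p => // m IH p pm p0.
have [[a pa]|H] := pselect (exists a, root p a); last first.
  exists [::]; split=> // x; rewrite in_nil; apply/esym/negbTE/negP => px.
  by apply: H; exists x.
have [k [q + pE]] := multiplicity_XsubC p a; rewrite p0 /= => qa.
have k0 : (0 < k)%N.
  by case: k pE => // pE; move: pa; rewrite pE expr0 mulr1 (negbTE qa).
have q0 : q != 0 by apply: contraNneq p0 => q0; rewrite pE q0 mul0r.
have sq : (size q < m)%N.
  move: pm; rewrite pE size_Mmonic// ?monic_exp ?monicXsubC// size_exp_XsubC.
  rewrite addnS /= ltnS; apply: leq_trans; by rewrite -addn1 leq_add2l.
have [rs [urs rsP]] := IH q sq q0.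
exists (a :: rs); split; first by rewrite /= rsP qa.
by move=> x; rewrite in_cons rsP pE rootM -(prednK k0) root_exp_XsubC orbC.
Qed.

(** This is the sign at minus infinity, obtained from the sign at plus infinity of [p] composed with
    [- 'X], and carried to [x] by the intermediate value theorem. *)
Lemma sgz_no_root_lt (p : {poly R}) (x : R) : 0 < lead_coef p ->
  (forall y, y <= x -> ~~ root p y) -> sgz p.[x] = (-1) ^+ (size p).-1.
Proof.
move=> lp np; have p0 : p != 0 by apply: contraTneq lp => ->; rewrite lead_coef0 ltxx.
pose s : R := (-1) ^+ (size p).-1.
pose q := s *: (p \Po (- 'X)).
have sX : size (- 'X : {poly R}) = 2 by rewrite size_polyN size_polyX.
have lq : lead_coef q = lead_coef p.
  rewrite /q lead_coefZ lead_coef_comp ?sX// lead_coefN lead_coefX.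
  by rewrite mulrCA -expr2 sqrr_sign mulr1.
have qE y : q.[y] = s * p.[- y] by rewrite /q hornerZ horner_comp !hornerE.
have [N HN] : exists N, forall y, N <= y -> lead_coef q <= q.[y].
  by apply: polyrcf.poly_pinfty_gt_lc; rewrite lq.
have qx : 0 < q.[- x].
  rewrite ltNge; apply/negP => qx0.
  pose y := Num.max N (- x).
  have qy : 0 <= q.[y].
    have Ny : N <= y by rewrite /y le_max lexx.
    by apply: le_trans (HN y Ny); rewrite lq ltW.
  have xy : - x <= y by rewrite /y le_max lexx orbT.
  have [z zI qz] := polyrcf.poly_ivt xy (mulr_le0_ge0 qx0 qy).
  move: zI; rewrite in_itv /= => /andP[zx _]; have := np (- z); rewrite lerNl zx => /(_ isT)/negP; apply.
  move: qz; rewrite /root qE mulf_eq0 => /orP[|//].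
  by rewrite /s signr_eq0.
rewrite -signr_odd; move: qx; rewrite qE opprK /s -signr_odd.
case: (odd _) => /=; rewrite ?expr1 ?expr0 ?mulN1r ?mul1r => h.
  by rewrite ltr0_sgz// -oppr_gt0.
by rewrite gtr0_sgz.
Qed.

(** A root [a] below [x] of multiplicity k gives a factor that is positive at [x]; removing it
    lowers both the degree and the sum of multiplicities by k, so the parity is unchanged. *)
Lemma sgz_horner_mup (rs : seq R) (p : {poly R}) (x : R) :
  0 < lead_coef p -> p.[x] != 0 -> uniq rs -> (forall y, y \in rs -> y < x) ->
  (forall y, root p y -> y < x -> y \in rs) ->
  sgz p.[x] = (-1) ^+ ((size p).-1 + \sum_(y <- rs) mup y p).
Proof.
elim: rs p => [|a rs IH] p lp px urs rsx rsp.
  rewrite big_nil addn0; apply: sgz_no_root_lt => // y; rewrite le_eqVlt.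
  case/predU1P => [->|yx]; first by rewrite /root.
  by apply/negP => /rsp/(_ yx); rewrite in_nil.
have p0 : p != 0 by apply: contraTneq lp => ->; rewrite lead_coef0 ltxx.
have [k [q + pE]] := multiplicity_XsubC p a; rewrite p0 /= => qa.
have q0 : q != 0 by apply: contraNneq p0 => q0; rewrite pE q0 mul0r.
have monk : ('X - a%:P) ^+ k \is monic by rewrite monic_exp ?monicXsubC.
have xa : 0 < x - a by rewrite subr_gt0 rsx// mem_head.
move: urs => /= /andP[ars urs].
have nroot y : y \in rs -> ~~ root (('X - a%:P) ^+ k) y.
  move=> yrs; case: k {pE monk} => [|k]; first by rewrite expr0 root1.
  by rewrite root_exp_XsubC /=; apply: contraNneq ars => <-.
have mupq y : y \in rs -> mup y p = mup y q by move=> /nroot yk; rewrite pE mupMl.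
have mupa : mup a p = k by rewrite pE mupMr// mup_XsubCX eqxx.
have sp : (size p).-1 = ((size q).-1 + k)%N.
  rewrite pE size_Mmonic// size_exp_XsubC addnS /=.
  by move: q0; rewrite -size_poly_eq0; case: (size q) => // s _; rewrite addSn.
rewrite big_cons mupa sp (eq_big_seq _ mupq).
have -> : sgz p.[x] = sgz q.[x].
  by rewrite pE hornerM horner_exp hornerXsubC sgzM (gtr0_sgz (exprn_gt0 _ xa)) mulr1.
rewrite (IH q)//.
- have eN (a' b' c' : nat) : (a' + c' + (c' + b') = 2 * c' + (a' + b'))%N by lia.
  by rewrite eN [RHS]exprD exprM sqrrN !expr1n mul1r.
- by move: lp; rewrite pE lead_coef_Mmonic.
- by apply: contraNneq px => qx; rewrite pE hornerM qx mul0r.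
- by move=> y yrs; apply: rsx; rewrite in_cons yrs orbT.
move=> y qy yx; have : y \in a :: rs by apply: rsp => //; rewrite pE rootM qy.
by rewrite in_cons => /predU1P[ya|//]; rewrite ya (negbTE qa) in qy.
Qed.

Lemma mup_eq0 (p : {poly R}) (x : R) : ~~ root p x -> mup x p = 0%N.
Proof.
move=> px; have p0 : p != 0 by apply: contraNneq px => ->; rewrite root0.
apply/eqP; rewrite -leqn0 leqNgt mup_geq// expr1 dvdp_XsubCl//.
Qed.

Lemma horner_char_poly n (A : 'M[R]_n) (a : R) :
  (char_poly A).[a] = \det (a%:M - A).
Proof.
rewrite /char_poly -[LHS]/(horner_eval a _) -det_map_mx; congr (\det _).
apply/matrixP => i j; rewrite !mxE -[LHS]/(('X *+ (i == j) - (A i j)%:P).[a]) hornerD hornerN hornerC hornerMn hornerX.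
by [].
Qed.

(** The characteristic polynomial takes the value (-1)^n det(1 + A) at -1, and its sign there counts
    the degree n and the roots below -1. *)
Lemma sgz_det1D n (A : 'M[R]_n) : \det (1%:M + A) != 0 ->
  sgz (\det (1%:M + A)) = (-1) ^+ num_eigenvalues_lt_m1 A.
Proof.
move=> dA; pose p := char_poly A.
have pm : p \is monic := char_poly_monic A.
have p0 : p != 0 by exact: monic_neq0.
have [rs [urs rsP]] := poly_roots_seq p0.
have pE : p.[-1] = (-1) ^+ n * \det (1%:M + A).
  rewrite /p horner_char_poly -detZ; congr (\det _).
  by rewrite scaleN1r opprD -raddfN.
have bE : num_eigenvalues_lt_m1 A = (\sum_(y <- [seq y <- rs | (y < -1)%R]) mup y p)%N.
  rewrite /num_eigenvalues_lt_m1 (fsbigE [seq y <- rs | (y < -1)%R]).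
  - by rewrite [RHS]big_filter [LHS]big_filter_cond; apply: eq_bigl => y; apply/andP/idP => [[]//|y1]; split=> //; exact/mem_set.
  - exact: filter_uniq.
  - by move=> y /=; rewrite mem_filter => /andP[].
  - move=> y /= y1; rewrite mem_filter y1 /= rsP; exact: mup_eq0.
have := @sgz_horner_mup [seq y <- rs | y < -1] p (-1).
rewrite (monicP pm) ltr01 pE mulf_neq0 ?signr_eq0// filter_uniq// -bE => H.
have {}H : sgz (\det (1%:M + A)) * sgz ((-1) ^+ n : R) = (-1) ^+ n * (-1) ^+ num_eigenvalues_lt_m1 A.
  rewrite mulrC -sgzM -exprD; have := H isT isT isT; rewrite size_char_poly /= => -> //.
    by move=> y; rewrite mem_filter => /andP[].
  by move=> y py y1; rewrite mem_filter y1 rsP.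
have E : sgz ((-1) ^+ n : R) = (-1) ^+ n.
  by rewrite -signr_odd -[RHS]signr_odd; case: (odd n); rewrite ?expr1 ?expr0 ?sgzN1 ?sgz1.
move: H; rewrite E mulrC.
have sn : (-1 : int) ^+ n * (-1) ^+ n = 1 by rewrite -expr2 sqrr_sign.
move=> H; by rewrite -[LHS]mul1r -sn -mulrA H mulrA sn mul1r.
Qed.

(** For m odd, 1 - X^m is 1 - X times a polynomial without real roots; for m even, it is (1 - X)(1 +
    X) times a polynomial in X^2 that is positive on the reals. The rootless factors do not affect
    the sign, and 1 + A gives the eigenvalues below -1. *)
Lemma sgz_det_1BX n (A : 'M[R]_n.+1) (m : nat) : (0 < m)%N ->
  \det (1 - A ^+ m) != 0 ->
  sgz (\det (1 - A ^+ m)) = sgz (\det (1 - A)) *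
    (if odd m then 1 else (-1) ^+ num_eigenvalues_lt_m1 A).
Proof.
move=> m0 dm.
have hX : horner_mx A 'X = A by rewrite horner_mx_X.
have pos (q : {poly R}) B : 0 < lead_coef q -> (forall x, ~~ root q x) ->
    \det (B * horner_mx A q) != 0 -> sgz (\det (B * horner_mx A q)) = sgz (\det B).
  move=> lq nq; rewrite det_mulmx mulf_eq0 negb_or => /andP[_ q0].
  rewrite sgzM [X in _ * X]gtr0_sgz ?mulr1// lt_neqAle eq_sym q0.
  exact: det_horner_ge0.
have geom (k : nat) (x : R) : (\poly_(i < k) (1 : R)).[x] = \sum_(i < k) x ^+ i.
  by rewrite horner_poly; apply: eq_bigr => i _; rewrite mul1r.
have geomA (k : nat) (B : 'M[R]_n.+1) :
    horner_mx B (\poly_(i < k) (1 : R)) = \sum_(i < k) B ^+ i.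
  rewrite poly_def rmorph_sum /=; apply: eq_bigr => i _.
  by rewrite scale1r rmorphXn /= horner_mx_X.
have subr (B : 'M[R]_n.+1) k : 1 - B ^+ k = (1 - B) * \sum_(i < k) B ^+ i.
  by rewrite -opprB subrX1 -mulNr opprB.
case: ifP => om.
  move: dm; rewrite subr -geomA => dm; rewrite pos ?mulr1//.
    by rewrite lead_coef_poly ?ltr01 ?oner_eq0.
  move=> x; apply/negP; rewrite /root geom => /eqP x0.
  have /eqP : x ^+ m - 1 = 0 by rewrite subrX1 x0 mulr0.
  rewrite subr_eq0; have [x_ge0|x_lt0] := leP 0 x.
    rewrite pexpr_eq1// => /eqP x1; move: x0; rewrite x1.
    under eq_bigr do rewrite expr1n.
    by rewrite sumr_const card_ord => /eqP; rewrite pnatr_eq0 -leqn0 leqNgt m0.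
  move=> /eqP xm; have : x ^+ m < 0 by rewrite exprn_odd_lt0.
  by rewrite xm ltr10.
have mE : m = (2 * m./2)%N by rewrite mul2n -[LHS]odd_double_half om.
have k0 : (0 < m./2)%N by move: m0; rewrite {1}mE; case: (m./2).
pose q := (\poly_(i < m./2) (1 : R)) \Po 'X^2.
have qA : horner_mx A q = \sum_(i < m./2) (A ^+ 2) ^+ i.
  rewrite /q poly_def raddf_sum /= rmorph_sum /=; apply: eq_bigr => i _.
  by rewrite scale1r comp_Xn_poly !rmorphXn /= horner_mx_X.
have E : 1 - A ^+ m = (1 - A ^+ 2) * horner_mx A q.
  by rewrite {1}mE exprM subr qA.
have E2 : 1 - A ^+ 2 = (1 - A) * (1 + A).
  by rewrite mulrDr mulr1 mulrBl mul1r expr2 addrA subrK.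
have dmE : \det (1 - A ^+ m) = \det (1 - A) * \det (1 + A) * \det (horner_mx A q).
  by rewrite E E2 !det_mulmx.
have d1 : \det (1 + A) != 0.
  by move: dm; rewrite dmE !mulf_eq0 !negb_or => /andP[/andP[]].
move: dm; rewrite E => dm; rewrite pos//.
- by rewrite E2 det_mulmx sgzM; congr (_ * _); exact: sgz_det1D.
- by rewrite lead_coef_comp ?size_polyXn// lead_coef_poly ?oner_eq0// lead_coefXn expr1n mulr1 ltr01.
move=> x; rewrite /root horner_comp geom hornerXn gt_eqF//.
case: (m./2) k0 => // k _; rewrite big_ord_recl expr0 ltr_wpDr// sumr_ge0// => i _.
by rewrite exprn_ge0// sqr_ge0.
Qed.

End SignDet.

(** * Nondegeneracy for the full period *)

Section GenericNondegenerate.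
Variables (R : realType) (n : nat).
Notation E := 'rV[R]_n.+1.
Implicit Types (g h : E -> E) (x y z : E) (k d : nat).

Lemma nondeg_isolated g d x : smooth g -> iter d g x = x -> nondeg d g x ->
  \forall y \near x, iter d g y = y -> y = x.
Proof.
move=> gS xd nd.
have u : 1%:M - 'J (iter d g) x \in unitmx by rewrite unitmxE unitfE.
have := has_jacobian_isolated
  (has_jacobianB (has_jacobian_id x) (C1_at_jacobian (smooth_iter d gS x))) u.
by apply: filterS => y H yd; apply: H; rewrite /= yd xd !subrr.
Qed.

(** The determinant vanishes only if the inverse of [(1 + t) ^+ k] is one of the finitely many real
    eigenvalues of [M]: those at least 1 are pushed above 1, the others stay below it. *)
Lemma det_scale_near0 k (M : 'M[R]_n.+1) : (0 < k)%N ->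
  \forall t \near (0 : R)^'+, \det (1%:M - (1 + t) ^+ k *: M) != 0.
Proof.
move=> k0; have [rs [_ rsP]] := poly_roots_seq (monic_neq0 (char_poly_monic M)).
have H : \forall t \near (0 : R)^'+, forall a, a \in rs -> a * (1 + t) ^+ k != 1.
  apply: near_all_seq => a _.
  have [a1|a1] := ltP a 1; last first.
    near=> t; have t0 : 0 < t by near: t; exact: nbhs_right_gt.
    rewrite gt_eqF//; apply: (@lt_le_trans _ _ ((1 + t) ^+ k)).
      by rewrite exprn_egt1 ?ltrDl// -lt0n.
    by rewrite ler_peMl// exprn_ge0// addr_ge0// ltW.
  have c : {for (0 : R), continuous (fun t : R => a * (1 + t) ^+ k)}.
    apply: continuousM; first exact: cst_continuous.
    apply: (@continuous_comp _ _ _ (fun t : R => 1 + t) (fun t => t ^+ k)).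
      by apply: continuousD; [exact: cst_continuous | exact: cvg_id].
    exact: exprn_continuous.
  have o : nbhs (a * (1 + 0) ^+ k) [set t : R | t < 1].
    by apply: lt_nbhsl; rewrite addr0 expr1n mulr1.
  have {}o : \forall t \near (0 : R), a * (1 + t) ^+ k < 1 by exact: c _ o.
  by apply: cvg_within; apply: filterS o => t /lt_eqF ->.
near=> t; have t0 : 0 < t by near: t; exact: nbhs_right_gt.
have Ht : forall a, a \in rs -> a * (1 + t) ^+ k != 1 by near: t; exact: H.
have ck : (1 + t) ^+ k != 0 by rewrite expf_neq0// gt_eqF// addr_gt0.
move: ((1 + t) ^+ k) ck Ht => c c0 Ht.
have -> : 1%:M - c *: M = c *: ((c^-1)%:M - M).
  by rewrite scalerBr scale_scalar_mx divff.
rewrite detZ mulf_neq0 ?expf_neq0// -horner_char_poly.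
apply/negP => r; have := Ht c^-1; rewrite rsP => /(_ r).
by rewrite mulVf// eqxx.
Unshelve. all: by end_near. Qed.

Lemma C1_sum_bounded (s : seq E) (h : E -> E -> E) :
  (forall z, smooth (h z)) ->
  (forall z, exists2 C : R, 0 <= C & forall x, `|h z x| <= C /\ `|'J (h z) x| <= C) ->
  smooth (fun x => \sum_(z <- s) h z x) /\
  exists2 C : R, 0 <= C & forall x, `|\sum_(z <- s) h z x| <= C /\
    `|'J (fun x => \sum_(z <- s) h z x) x| <= C.
Proof.
move=> hS hB; elim: s => [|z s [IH1 [C1 C10 IH2]]].
  have -> : (fun x => \sum_(z <- [::]) h z x) = fun=> 0.
    by apply/funext => x; rewrite big_nil.
  split; first by move=> x; exact: C1_at_cst.
  exists 0 => // x; rewrite (has_jacobian_unique (has_jacobian_cst _ x)).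
  by rewrite big_nil !normr0.
have E1 : (fun x => \sum_(z <- z :: s) h z x) = fun x => h z x + \sum_(z <- s) h z x.
  by apply/funext => x; rewrite big_cons.
have [C2 C20 H2] := hB z.
rewrite E1; split; first by move=> x; exact: C1_atD (hS z x) (IH1 x).
exists (C2 + C1) => [|x]; first exact: addr_ge0.
rewrite big_cons.
rewrite (has_jacobian_unique (has_jacobianD (C1_at_jacobian (hS z x)) (C1_at_jacobian (IH1 x)))).
have [a1 a2] := H2 x; have [b1 b2] := IH2 x.
split; apply: le_trans (ler_normD _ _) _; exact: lerD.
Qed.

Lemma separated_radius (s : seq E) :
  exists2 r : R, 0 < r & forall z z', z \in s -> z' \in s -> z != z' -> r < `|z - z'|.
Proof.
have H : \forall r \near (0 : R)^'+, forall z, z \in s -> forall z', z' \in s ->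
    z != z' -> r < `|z - z'|.
  apply: near_all_seq => z _; apply: near_all_seq => z' _.
  have [->|zz'] := eqVneq z z'; first exact: filterE.
  apply: filterS (nbhs_right_lt (_ : 0 < `|z - z'|)) => //.
  by rewrite normr_gt0 subr_eq0.
have [r [r0 Hr]] := filter_ex (filterI (nbhs_right_gt (0 : R)) H).
by exists r => // z z' zs z's; exact: Hr.
Qed.

(* Adding t (g - g z) to g near each point z of exact period d preserves these
   orbits and multiplies the Jacobian of iter k g along them by (1 + t)^k. *)
Lemma generic_nondeg g (K : set E) k d (A : set (E -> E)) :
  compact K -> smooth g -> (0 < d)%N -> (0 < k)%N -> (d %| k)%N ->
  C1nbhs g [set h : E -> E | forall x, iter d h x = x -> K x] ->
  (forall j, (0 < j < d)%N -> (j %| d)%N -> forall x, iter j g x = x -> nondeg k g x) ->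
  (forall x, iter d g x = x -> nondeg d g x) ->
  C1nbhs g A ->
  exists h, [/\ smooth h, C1nbhs h A & forall x, iter d h x = x -> nondeg k h x].
Proof.
move=> cK gS d0 k0 dk HK low nd gA.
have gK := C1nbhs_self gS HK.
pose Z := [set z | exact_period g d z].
have finZ : finite_set Z.
  apply: (sub_finite_set (B := K `&` [set x | iter d g x = x])).
    by move=> z [zd _]; split=> //; exact: gK.
  apply: finite_isolated => // x Kx.
  have [xd|xd] := pselect (iter d g x = x); first exact: nondeg_isolated (nd x xd).
  have [r r0 Hr] := eval_nbhsE (P := fun (x : E) (h : E -> E) => iter d h x <> x)
    (near_iter_neq gS xd).
  have {}Hr := C1nbhs_self gS Hr; apply: filterS (nbhs_dist_lt x r0) => y xy.
  by move=> yd; case: (Hr y); rewrite // distrC.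
have [zs uzs ZE] := finite_set_seq finZ.
have zsP z : z \in zs <-> exact_period g d z by rewrite -[exact_period g d z]/(Z z) ZE.
have [s0 s00 Hs0] := separated_radius zs.
(* Half the separation: within [s] of one centre all the other cutoffs vanish. *)
pose s := s0 / 2; have s_gt0 : 0 < s by rewrite divr_gt0.
pose H z x := cutoff z s x *: (g x - g z).
have HS z : smooth (H z).
  move=> x; apply: C1_at_scale; first exact: C1_at_cutoff.
  exact: C1_atB (gS x) (C1_at_cst (g z) x).
have H0 z x : s <= `|x - z| -> H z x = 0.
  by move=> sx; rewrite /H cutoff_out// scale0r.
have HB z := C1_bounded_support (HS z) (H0 z).
have [SS [C C0 HC]] := C1_sum_bounded zs HS HB.
pose S x := \sum_(z <- zs) H z x.
have nearS z : z \in zs -> \forall x \near z, S x = g x - g z.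
  move=> zz; have [r1 r10 Hr1] := cutoff_near1 z s_gt0.
  have n1 := nbhs_dist_lt z r10; have n2 := nbhs_dist_lt z s_gt0.
  have {}n1 : \forall x \near z, `|z - x| < r1 by [].
  have {}n2 : \forall x \near z, `|z - x| < s by [].
  apply: filterS2 n1 n2 => x x1 x2; rewrite /S (bigD1_seq z)//= {1}/H Hr1 1?distrC//.
  rewrite scale1r big_seq_cond big1 ?addr0// => z' /andP[z's z'z].
  apply: H0; have := Hs0 _ _ z's zz z'z; have := ler_distD x z' z.
  rewrite [`|z' - x|]distrC [`|x - z|]distrC /s; move: x2; rewrite /s.
  by move: (`|x - z'|) (`|z - x|) (`|z' - z|) => a b c; lra.
pose gt (t : R) x := g x + t *: S x.
have gtS t : smooth (gt t) by move=> x; exact: C1_atD (gS x) (C1_atZ t (SS x)).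
have gt_z t z : z \in zs -> gt t z = g z.
  by move=> zz; rewrite /gt (nbhs_singleton (nearS z zz)) subrr scaler0 addr0.
have gt_jac t z : z \in zs -> 'J (gt t) z = (1 + t) *: 'J g z.
  move=> zz; apply: has_jacobian_unique.
  have gz := C1_at_jacobian (gS z).
  have := has_jacobianD gz (has_jacobianZ t (has_jacobianB gz (has_jacobian_cst (g z) z))).
  rewrite subr0 -{1}['J g z]scale1r -scalerDl.
  by apply: has_jacobian_near; apply: filterS (nearS z zz) => x Sx; rewrite /gt Sx.
have zs_iter i z : z \in zs -> iter i g z \in zs.
  by move=> /zsP zd; apply/zsP; exact: exact_period_iter.
have gt_iter t i z : z \in zs -> iter i (gt t) z = iter i g z.
  by move=> zz; elim: i => // i IH; rewrite !iterS IH gt_z//; exact: zs_iter.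
have gt_iter_jac t i z : z \in zs ->
    'J (iter i (gt t)) z = (1 + t) ^+ i *: 'J (iter i g) z.
  move=> zz; elim: i => [|i IH]; first by rewrite expr0 scale1r !jacobian_id.
  rewrite (jacobian_iterS i z (gtS t)) (jacobian_iterS i z gS) IH.
  rewrite (gt_iter t i z zz) (gt_jac t _ (zs_iter i z zz)).
  by rewrite -scalemxAl -scalemxAr scalerA exprSr.
(* For [h] near [g], the only fixed point of [iter d h] near a point of [zs] is that point itself,
   if it stays fixed. So it is enough to check [nondeg k] on the finite list [zs], points of smaller
   period being covered by openness. *)
pose W := [set h : E -> E | (forall z, z \in zs -> iter d h z = z /\ nondeg k h z) ->
  forall x, K x -> iter d h x = x -> nondeg k h x].
have gW : C1nbhs g W.
  suff : C1nbhs g [set h : E -> E | forall x, K x ->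
      (forall z, z \in zs -> iter d h z = z /\ nondeg k h z) ->
      iter d h x = x -> nondeg k h x].
    by apply: filterS => h hW Hz x Kx; exact: hW.
  apply: (near_compact (P := fun (x : E) (h : E -> E) =>
     (forall z, z \in zs -> iter d h z = z /\ nondeg k h z) ->
      iter d h x = x -> nondeg k h x)) => // x Kx.
  have [xd|xd] := pselect (iter d g x = x); last first.
    by apply: filterS (near_iter_neq gS xd) => q.
  have [xe|[j [jd jdd xj]]] := exact_period_or d0 xd; last first.
    by apply: filterS (near_nondeg gS (low j jd jdd x xj)) => q nq _ _.
  have [r r0 Hr] := near_unique_fixed gS (nd x xd).
  exists ([set y | `|x - y| < r], [set h : E -> E | forall y z, `|y - x| < r -> `|z - x| < r ->
    iter d h y = y -> iter d h z = z -> y = z]) => /=; first by split=> //; exact: nbhs_dist_lt.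
  move=> [y h] [/= xy Hh] Hz yd; have [hx nx] := Hz x (proj2 (zsP x) xe).
  by rewrite (Hh y x)// ?subrr ?normr0// distrC.
have gB : C1nbhs g ([set h | C1nbhs h A] `&` (W `&` [set h : E -> E | forall x, iter d h x = x -> K x])).
  by apply: filterI; [exact: C1nbhs_nbhs | exact: filterI].
have [c c0 Hc] := C1nbhs_add gS gB.
have T1 : \forall t \near (0 : R)^'+, forall z, z \in zs ->
    \det (1%:M - (1 + t) ^+ k *: 'J (iter k g) z) != 0.
  by apply: near_all_seq => z _; exact: det_scale_near0.
have cC : 0 < c / (C + 1) by rewrite divr_gt0// ltr_wpDl.
have [t [[t0 tc] Ht]] :=
  filter_ex (filterI (filterI (nbhs_right_gt (0 : R)) (nbhs_right_lt cC)) T1).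
have tC u : u <= C -> t * u < c.
  move=> uC; apply: (@le_lt_trans _ _ (t * C)); first by rewrite ler_wpM2l// ltW.
  rewrite ltr_pdivlMr ?ltr_wpDl// mulrDr mulr1 in tc.
  by apply: le_lt_trans tc; rewrite lerDl ltW.
have [gtA [gtW gtK]] : ([set h | C1nbhs h A] `&`
    (W `&` [set h : E -> E | forall x, iter d h x = x -> K x])) (gt t).
  apply: (Hc (fun x => t *: S x)); first by move=> x; exact: C1_atZ (SS x).
  move=> x; have [a b] := HC x.
  rewrite (has_jacobian_unique (has_jacobianZ t (C1_at_jacobian (SS x)))).
  by rewrite !normrZ (gtr0_norm t0); split; exact: tC.
exists (gt t); split; [exact: gtS | exact: gtA |] => x xd.
apply: (gtW _ x (gtK x xd) xd).
move=> z zz; split; first by rewrite gt_iter//; have /zsP[] := zz.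
by rewrite /nondeg gt_iter_jac//; exact: Ht.
Qed.

(** [K] confines the periodic points of all nearby maps. Without such a compact set, nondegeneracy
    at all points of the periods already treated would not be an open condition, and the induction
    could lose it. *)
Theorem generic_perturbation g (K : set E) k (A : set (E -> E)) :
  compact K -> smooth g -> (0 < k)%N ->
  C1nbhs g [set h : E -> E | forall x, iter k h x = x -> K x] ->
  C1nbhs g A ->
  exists h, [/\ smooth h, A h & forall x, iter k h x = x -> nondeg k h x].
Proof.
move=> cK gS k0 HK gA.
pose B := A `&` [set h : E -> E | forall x, iter k h x = x -> K x].
pose N d := [set h : E -> E | forall j, j \in iota 0 d.+1 -> (0 < j)%N -> (j %| k)%N ->
  forall x, iter j h x = x -> nondeg k h x].
have Kdvd d h : (d %| k)%N -> (forall x, iter k h x = x -> K x) ->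
    forall x, iter d h x = x -> K x.
  by move=> dk hK x xd; apply: hK; exact: iter_dvd_fixed dk xd.
have nearN d h : smooth h -> C1nbhs h B -> N d h -> C1nbhs h (N d).
  move=> hS hB hN; have hK : C1nbhs h [set h : E -> E | forall x, iter k h x = x -> K x].
    by apply: filterS hB => h' [].
  apply: (near_all_seq (P := fun (h : E -> E) j => (0 < j)%N -> (j %| k)%N ->
    forall x, iter j h x = x -> nondeg k h x) (C1nbhs_filter h)) => j jd.
  have [/andP[j0 jk]|jN] := boolP ((0 < j) && (j %| k))%N; last first.
    by apply: filterE => h' j0 jk; rewrite j0 jk in jN.
  have H1 := near_compact_nondeg hS cK (fun x _ => hN j jd j0 jk x).
  apply: filterS2 H1 hK => h' H1 h'K _ _ x xj; apply: H1 (xj).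
  exact: Kdvd jk h'K x xj.
suff H d : exists h, [/\ smooth h, C1nbhs h B & N d h].
  have [h [hS hB hN]] := H k; have [hA _] := C1nbhs_self hS hB.
  exists h; split; [exact: hS | exact: hA |].
  by apply: hN => //; rewrite mem_iota ltnS leqnn.
elim: d => [|d [g1 [g1S g1B g1N]]].
  exists g; split; [exact: gS | exact: filterI|].
  by move=> j; rewrite mem_iota => /andP[_]; case: j.
have Nstep h : N d h -> ((d.+1 %| k)%N -> forall x, iter d.+1 h x = x -> nondeg k h x) ->
    N d.+1 h.
  move=> hN hd j; rewrite mem_iota add0n leq0n /= ltnS leq_eqVlt => /predU1P[-> _|jd].
    exact: hd.
  by apply: hN; rewrite mem_iota.
have [dk|dk] := boolP (d.+1 %| k)%N; last first.
  by exists g1; split; [exact: g1S | exact: g1B | apply: Nstep => // dk'; rewrite dk' in dk].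
have low h : N d h -> forall j, (0 < j < d.+1)%N -> (j %| d.+1)%N ->
    forall x, iter j h x = x -> nondeg k h x.
  move=> hN j /andP[j0 jd] jdd; apply: hN => //; first by rewrite mem_iota.
  exact: dvdn_trans dk.
have Kd h : C1nbhs h B -> C1nbhs h [set h : E -> E | forall x, iter d.+1 h x = x -> K x].
  by apply: filterS => h' [_]; exact: Kdvd.
have nb h : smooth h -> C1nbhs h B -> N d h -> C1nbhs h ([set h | C1nbhs h B] `&` N d).
  by move=> hS hB hN; apply: filterI; [exact: C1nbhs_nbhs | exact: nearN].
have [g2 [g2S g2A g2d]] := generic_period cK g1S (ltn0Sn d) dk (Kd _ g1B) (low _ g1N)
  (nb _ g1S g1B g1N).
have [g2B g2N] := C1nbhs_self g2S g2A.
have [g3 [g3S g3A g3d]] := generic_nondeg cK g2S (ltn0Sn d) k0 dk (Kd _ g2B) (low _ g2N) g2d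
  (nb _ g2S g2B g2N).
have [g3B g3N] := C1nbhs_self g3S g3A.
by exists g3; split; [exact: g3S | exact: g3B | exact: Nstep].
Qed.

End GenericNondegenerate.

(** * Totient sums over orbits *)

(* Two factorizations of the block matrix [[1, A], [B, 1]]. *)
Lemma det_1BM_comm (R : comPzRingType) n (A B : 'M[R]_n) :
  \det (1%:M - A *m B) = \det (1%:M - B *m A).
Proof.
have E1 : block_mx 1%:M A B 1%:M =
    block_mx 1%:M 0 B 1%:M *m block_mx 1%:M A 0 (1%:M - B *m A).
  rewrite mulmx_block !mul1mx !mulmx1 !mul0mx ?mulmx0 !addr0.
  by rewrite addrC subrK.
have E2 : block_mx 1%:M A B 1%:M =
    block_mx (1%:M - A *m B) A 0 1%:M *m block_mx 1%:M 0 B 1%:M.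
  by rewrite mulmx_block !mul1mx !mulmx1 !mul0mx ?mulmx0 !add0r subrK.
have := congr1 determinant E1.
by rewrite {1}E2 !det_mulmx !det_ublock !det_lblock !det1 !mul1r !mulr1.
Qed.

Section Totient.
Implicit Types (m t d : nat).

Lemma big_divisors_dvd (V : nmodType) t m (F : nat -> V) : (0 < t)%N -> (0 < m)%N ->
  \sum_(d <- divisors (t * m) | (t %| d)%N) F d = \sum_(d <- divisors m) F (t * d)%N.
Proof.
move=> t0 m0; rewrite -[RHS](big_map (muln t) xpredT F) -[LHS]big_filter.
apply: perm_big; apply: uniq_perm.
- by rewrite filter_uniq// divisors_uniq.
- by rewrite map_inj_uniq ?divisors_uniq// => a b /eqP; rewrite eqn_pmul2l// => /eqP.
move=> d; rewrite mem_filter -dvdn_divisors ?muln_gt0 ?t0//.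
apply/andP/mapP => [[/dvdnP[q ->]]|[q]].
  by rewrite mulnC dvdn_pmul2l// => qm; exists q => //; rewrite -dvdn_divisors.
by rewrite -dvdn_divisors// => qm ->; rewrite dvdn_mulr// dvdn_pmul2l.
Qed.

Lemma sum_totient_div m : (0 < m)%N -> (\sum_(d <- divisors m) totient (m %/ d) = m)%N.
Proof.
move=> m0; rewrite -[RHS]sum_totient_dvd.
rewrite -(big_mkord (fun d => (d %| m)%N) totient) -[RHS]big_filter.
rewrite -(big_map (divn m) xpredT totient); apply: perm_big; apply: uniq_perm.
- rewrite map_inj_in_uniq ?divisors_uniq// => a b; rewrite -!dvdn_divisors// => am bm ab.
  have q0 : (0 < m %/ a)%N.
    by rewrite (divn_gt0 _ (dvdn_gt0 m0 am)); exact: dvdn_leq m0 am.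
  have E1 : (m %/ a * a = m %/ b * b)%N by rewrite (divnK am) (divnK bm).
  by apply/eqP; rewrite -(eqn_pmul2l q0) E1 ab.
- by rewrite filter_uniq// iota_uniq.
move=> d; rewrite mem_filter mem_index_iota ltnS /=.
apply/mapP/andP => [[q]|[dm _]].
  rewrite -dvdn_divisors// => qm ->; rewrite leq_div; split=> //.
  by apply/dvdnP; exists q; rewrite mulnC divnK.
exists (m %/ d)%N; first by rewrite -dvdn_divisors// dvdn_div.
by rewrite divnA// mulKn.
Qed.

(** In the bad case the odd divisors count with the sign [s] and the even ones with [- s]. The even
    divisors of [m] are the doubles of those of m/2, so their totients add up to m/2, half of the
    total, and everything cancels. *)
Lemma totient_sum_sign (R : realType) n (A : 'M[R]_n.+1) m : (0 < m)%N ->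
  \det (1 - A ^+ m) != 0 ->
  \sum_(d <- divisors m) (totient (m %/ d))%:R * sgz (\det (1 - A ^+ d)) =
  if odd (num_eigenvalues_lt_m1 A) && ~~ odd m then 0
  else m%:R * sgz (\det (1 - A ^+ m)) :> int.
Proof.
move=> m0 dm.
have dd d : (d %| m)%N -> \det (1 - A ^+ d) != 0.
  by move=> /dvdnP[q mE]; move: dm; rewrite mE mulnC exprM; exact: det_1BX_neq0.
set b := num_eigenvalues_lt_m1 A; set s := sgz (\det (1 - A)).
have sE d : (d %| m)%N -> sgz (\det (1 - A ^+ d)) = s * (if odd d then 1 else (-1) ^+ b).
  by move=> dm'; rewrite sgz_det_1BX ?dd// (dvdn_gt0 m0).
rewrite sE//.
have -> : \sum_(d <- divisors m) (totient (m %/ d))%:R * sgz (\det (1 - A ^+ d)) =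
    \sum_(d <- divisors m) ((totient (m %/ d))%:R * (if odd d then 1 else (-1) ^+ b)) * s :> int.
  apply: eq_big_seq => d; rewrite -dvdn_divisors// => dm'.
  by rewrite sE// mulrA mulrAC.
rewrite -mulr_suml.
have S1 : \sum_(d <- divisors m) (totient (m %/ d))%:R = m%:R :> int.
  by rewrite -natr_sum sum_totient_div.
have [bo|be] := boolP (odd b); last first.
  have -> : (-1) ^+ b = 1 :> int by rewrite -signr_odd (negbTE be).
  have -> : (if odd m then 1 else 1) = 1 :> int by case: ifP.
  rewrite /= mulr1 -S1; congr (_ * _); apply: eq_bigr => d _.
  by case: ifP; rewrite mulr1.
have [mo|me] := boolP (odd m) => /=.
  rewrite mulr1 -S1; congr (_ * _); apply: eq_big_seq => d.
  rewrite -dvdn_divisors// => /dvdnP[q mE].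
  by move: mo; rewrite {1}mE oddM => /andP[_ ->]; rewrite mulr1.
have -> : (-1) ^+ b = -1 :> int by rewrite -signr_odd bo.
have mE : m = (2 * m./2)%N by rewrite mul2n -[LHS]odd_double_half (negbTE me).
have h0 : (0 < m./2)%N by move: m0; rewrite {1}mE; case: (m./2).
rewrite (eq_bigr (fun d => (totient (m %/ d))%:R - 2 * (if (2 %| d)%N then (totient (m %/ d))%:R else 0)));
  last by move=> d _; rewrite dvdn2; case: (odd d) => /=; ring.
have S2 : \sum_(d <- divisors m | (2 %| d)%N) (totient (m %/ d))%:R = (m./2)%:R :> int.
  move: h0 mE; move: (m./2) => h h0 ->; rewrite big_divisors_dvd//.
  have E d : (2 * h %/ (2 * d) = h %/ d)%N by rewrite divnMl.
  by rewrite -[in RHS](sum_totient_div h0) natr_sum; apply: eq_bigr => d _; rewrite E.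
by rewrite sumrB -mulr_sumr -big_mkcond S1 S2 -natrM -mE subrr mul0r.
Qed.

Lemma totient_sum_period (R : realType) n (A : 'M[R]_n.+1) t m : (0 < t)%N -> (0 < m)%N ->
  \det (1 - A ^+ m) != 0 ->
  \sum_(d <- divisors (t * m) | (t %| d)%N)
     (totient (t * m %/ d))%:R * sgz (\det (1 - A ^+ (d %/ t))) =
  if odd (num_eigenvalues_lt_m1 A) && ~~ odd m then 0
  else m%:R * sgz (\det (1 - A ^+ m)) :> int.
Proof.
move=> t0 m0 dm; rewrite big_divisors_dvd// -totient_sum_sign//.
by apply: eq_bigr => d _; rewrite divnMl// mulKn.
Qed.

End Totient.

Section OrbitSum.
Variables (T : choiceType) (G : T -> T) (k : nat).
Hypothesis k0 : (0 < k)%N.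
Implicit Types (u v : T).

Definition orbit_set u := [set iter i G u | i in `I_k].

Lemma iter_modn t j u : iter t G u = u -> iter j G u = iter (j %% t) G u.
Proof.
move=> tu; rewrite {1}(divn_eq j t) addnC iterD iter_mul_fixed//.
Qed.

Lemma orbit_set_iter j u : iter k G u = u -> orbit_set u (iter j G u).
Proof.
move=> ku; exists (j %% k)%N; first by rewrite /= ltn_pmod.
by rewrite -iter_modn.
Qed.

Lemma orbit_set_sub u v : iter k G u = u -> orbit_set u v -> orbit_set v `<=` orbit_set u.
Proof. by move=> ku [i _ <-] _ [j _ <-]; rewrite -iterD; exact: orbit_set_iter. Qed.

Lemma orbit_set_fixed t u v : iter t G u = u -> orbit_set u v -> iter t G v = v.
Proof. by move=> tu [i _ <-]; rewrite -iterD addnC iterD tu. Qed.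

Lemma orbit_set_eq u v : iter k G u = u -> orbit_set u v -> orbit_set v = orbit_set u.
Proof.
move=> ku uv; have kv := orbit_set_fixed ku uv.
apply/seteqP; split; first exact: orbit_set_sub.
apply: orbit_set_sub => //; move: uv => [i /= ik <-].
have E : iter (k - i) G (iter i G u) = u by rewrite -iterD subnK// ltnW.
by rewrite -[X in orbit_set _ X]E; apply: orbit_set_iter; rewrite -iterD addnC iterD ku.
Qed.

Lemma exact_period_ex u : iter k G u = u ->
  exists t, [/\ (0 < t)%N, exact_period G t u & (t %| k)%N].
Proof.
move=> ku.
have ex : exists t, (0 < t)%N && (iter t G u == u) by exists k; rewrite k0 ku eqxx.
case: (ex_minnP ex) => t /andP[t0 /eqP tu] tmin; exists t.
have tp : exact_period G t u.
  split=> // j /andP[j0 jt] ju; have := tmin j; rewrite j0 ju eqxx => /(_ isT).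
  by rewrite leqNgt jt.
by split=> //; exact: exact_period_dvd tp ku.
Qed.

Lemma exact_period_uniq t u : exact_period G t u -> uniq [seq iter i G u | i <- iota 0 t].
Proof.
move=> [tu tmin].
have H i j : (i < j)%N -> (j < t)%N -> iter i G u <> iter j G u.
  move=> ij jt ijE; apply: (tmin (j - i)%N).
    by rewrite subn_gt0 ij (leq_ltn_trans (leq_subr _ _)).
  have := congr1 (iter (t - i) G) ijE.
  rewrite -!iterD subnK; last by apply: ltnW; exact: ltn_trans jt.
  have -> : (t - i + j = j - i + t)%N by lia.
  by rewrite iterD tu => <-.
rewrite map_inj_in_uniq ?iota_uniq// => i j; rewrite !mem_iota !add0n => /andP[_ it] /andP[_ jt] ij.
by case: (ltngtP i j) => // h; [have := H i j h jt | have := H j i h it; rewrite ij].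
Qed.

(** Here [c u] stands for the contribution of the point [u] to the right-hand side. It is constant
    on orbits, and an orbit of t good points contributes t (k/t) times its index. *)
Lemma orbit_sum (P : set T) (x0 : T) (c I : T -> int) (bad : T -> Prop) :
  finite_set P -> (forall u, P u -> iter k G u = u) ->
  (forall u, P u -> P (G u)) -> (forall u, P u -> c (G u) = c u) ->
  (forall u t, P u -> (0 < t)%N -> exact_period G t u -> ~ bad u ->
     c u = (k %/ t)%:R * I u) ->
  (forall u, P u -> bad u -> c u = 0) -> (forall u, P u -> I u != 0) ->
  k%:R * \sum_(O \in [set orbit_set u | u in [set u | P u /\ ~ bad u]]) I (xget x0 O) =
  \sum_(u \in P) c u.
Proof.
move=> finP Pk PG cG cgood cbad I0.
have Pi i u : P u -> P (iter i G u) by move=> Pu; elim: i => //= i; exact: PG.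
have ci i u : P u -> c (iter i G u) = c u.
  by move=> Pu; elim: i => //= i <-; apply: cG; exact: Pi.
have [s us PE] := finite_set_seq finP.
have sP u : u \in s <-> P u by rewrite PE.
pose Os := undup [seq orbit_set u | u <- s & `[< ~ bad u >]].
have OsE : [set orbit_set u | u in [set u | P u /\ ~ bad u]] = [set` Os].
  apply/seteqP; split=> O /=; rewrite mem_undup.
    move=> [u [Pu ub] <-]; apply/mapP; exists u => //; rewrite mem_filter.
    by apply/andP; split; [exact/asboolP | exact/sP].
  by move=> /mapP[u]; rewrite mem_filter => /andP[/asboolP ub /sP Pu] ->; exists u.
rewrite OsE -fsbig_seq ?undup_uniq// PE -fsbig_seq//.
have -> : \sum_(u <- s) c u = \sum_(u <- s) \sum_(O <- Os | O == orbit_set u) c u.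
  apply: eq_big_seq => u /sP Pu.
  have [uO|uO] := boolP (orbit_set u \in Os).
    rewrite big_mkcond (bigD1_seq (orbit_set u)) ?undup_uniq//= eqxx big1 ?addr0//.
    by move=> O /negbTE ->.
  have -> : c u = 0.
    apply: cbad => //; apply: contrapT => ub; move/negP : uO; apply.
    rewrite mem_undup; apply/mapP; exists u => //; rewrite mem_filter.
    by apply/andP; split; [exact/asboolP | exact/sP].
  by rewrite big1.
rewrite (exchange_big_dep xpredT)//= mulr_sumr; apply: eq_big_seq => O OOs.
have [u0 [Pu0 u0b] OE] : [set orbit_set u | u in [set u | P u /\ ~ bad u]] O by rewrite OsE.
have Ov : O (xget x0 O).
  apply: xgetPex; exists u0; rewrite -OE; exact: (@orbit_set_iter 0 u0 (Pk _ Pu0)).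
move: (xget x0 O) Ov => v Ov.
have u0v : orbit_set u0 v by rewrite OE.
have Pv : P v by have [i _ <-] := u0v; exact: Pi.
have cv : c v = c u0 by have [i _ <-] := u0v; exact: ci.
have vO : orbit_set v = O by rewrite -OE; exact: orbit_set_eq (Pk _ Pu0) u0v.
(* [xget] may choose another point of the orbit than the good one [u0]; goodness passes to it
   through [c], which is nonzero at [u0] because the index is. *)
have vb : ~ bad v.
  move=> /(cbad _ Pv); rewrite cv.
  have [t [t0 tp tk]] := exact_period_ex (Pk _ Pu0).
  rewrite (cgood _ _ Pu0 t0 tp u0b) => /eqP; rewrite mulf_eq0 (negbTE (I0 _ Pu0)) orbF.
  by rewrite pnatr_eq0 -leqn0 leqNgt divn_gt0// dvdn_leq.
have [t [t0 tp tk]] := exact_period_ex (Pk _ Pv).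
rewrite -big_filter (perm_big [seq iter i G v | i <- iota 0 t]) /=; last first.
  apply: uniq_perm; [exact: filter_uniq | exact: exact_period_uniq |].
  move=> u; rewrite mem_filter; apply/andP/mapP => [[/eqP uO /sP Pu]|[i]].
    have : orbit_set v u by rewrite vO uO; exact: (@orbit_set_iter 0 u (Pk _ Pu)).
    move=> [j _ <-]; exists (j %% t)%N; first by rewrite mem_iota add0n ltn_pmod.
    by apply: iter_modn; have [] := tp.
  move=> _ ->; split; last by apply/sP; exact: Pi.
  rewrite eq_sym; apply/eqP; rewrite -vO; apply: orbit_set_eq; first exact: Pk.
  by apply: orbit_set_iter; exact: Pk.
rewrite big_map (eq_bigr (fun=> c v)) => [|i _]; last exact: ci.
rewrite big_const_seq count_predT size_iota iter_addr_0 (cgood _ _ Pv t0 tp vb).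
by rewrite -[RHS]mulr_natl mulrA -natrM mulnC divnK.
Qed.

End OrbitSum.

(** * The index of a fixed point *)

(** At consecutive points of an orbit the two Jacobians are products of the same two matrices in
    opposite orders. *)
Lemma det_jacobian_iter_shift (R : realType) n (g : 'rV[R]_n.+1 -> 'rV[R]_n.+1) d x : (0 < d)%N -> (forall i, C1_at g (iter i g x)) ->
  iter d g x = x ->
  \det (1%:M - 'J (iter d g) (g x)) = \det (1%:M - 'J (iter d g) x).
Proof.
move=> d0; have {d0}[m ->] : exists m, d = m.+1 by exists d.-1; rewrite prednK.
move: m => {}d gx xd.
have gx' i : C1_at g (iter i g (g x)) by rewrite -iterSr.
have -> : 'J (iter d.+1 g) x = 'J (iter 1 g) x *m 'J (iter d g) (g x).
  by rewrite -[d.+1]addn1 (jacobian_iter_comp (fun i _ => gx i)).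
have -> : 'J (iter d.+1 g) (g x) = 'J (iter d g) (g x) *m 'J (iter 1 g) x.
  rewrite -[d.+1]add1n (jacobian_iter_comp (fun i _ => gx' i)); congr (_ *m 'J _ _).
  by rewrite -iterSr.
exact: det_1BM_comm.
Qed.

Section Index.
Variables (R : realType) (n : nat).
Notation E := 'rV[R]_n.+1.
Notation sph := (@sphere R n.+1).
Implicit Types (g h : E -> E) (p x y z : E).

Lemma degree_homotopy (f0 f1 : E -> E) :
  C1_sphere_map f0 -> (forall z, sph z -> sph (f0 z)) ->
  C1_sphere_map f1 -> (forall z, sph z -> sph (f1 z)) ->
  sphere_homotopic f0 f1 -> degree f0 = degree f1.
Proof.
move=> C0 s0 C1 s1 /label_count_sphere_homotopic H.
have [N [[<- <-] ->]] := filter_ex (filterI (filterI (degree_label_count C0 s0)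
  (degree_label_count C1 s1)) H).
by [].
Qed.

Lemma sphere_homotopic_normalize (V : R * E -> E) :
  {within `[0, 1]%classic `*` sph, continuous V} ->
  (forall t z, `[0, 1]%classic t -> sph z -> V (t, z) != 0) ->
  sphere_homotopic (fun z => (enorm (V (0, z)))^-1 *: V (0, z))
    (fun z => (enorm (V (1, z)))^-1 *: V (1, z)).
Proof.
move=> /subspace_continuousP cV V0.
exists (fun q => (enorm (V q))^-1 *: V q); split=> //.
  apply/subspace_continuousP => -[t z] [tI zs].
  have cVq := cV (t, z) (conj tI zs).
  apply: cvgZ; last exact: cVq.
  apply: cvgV; first by rewrite gt_eqF// enorm_gt0 V0.
  by apply: continuous_cvg; [exact: enorm_continuous | exact: cVq].
by move=> t z tI zs; apply: sphere_normalize; exact: V0.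
Qed.

Lemma C1_at_normalize (V : E -> E) y : C1_at V y -> V y != 0 ->
  C1_at (fun x => (enorm (V x))^-1 *: V x) y.
Proof.
move=> VC V0; apply: C1_at_scale; last exact: VC.
exact: (C1_at_comp VC (C1_at_inv_enorm V0)).
Qed.

Lemma C1_at_displacement g p (r : R) z : C1_at g (p + r *: z) ->
  C1_at (fun x => (p + r *: x) - g (p + r *: x)) z.
Proof.
move=> gC; have aC : C1_at (fun x : E => p + r *: x) z.
  by apply: C1_atD; [exact: C1_at_cst | apply: C1_atZ; exact: C1_at_id].
by apply: C1_atB; [exact: aC | exact: (C1_at_comp aC gC)].
Qed.

Lemma displacement_sphere g p (r : R) : (forall z, sph z -> g (p + r *: z) <> p + r *: z) ->
  forall z, sph z -> sph (displacement_direction g p r z).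
Proof.
move=> gN z zs; apply: sphere_normalize; rewrite subr_eq0 eq_sym.
by apply/eqP; exact: gN.
Qed.

Lemma displacement_C1 g p (r : R) : (forall z, sph z -> C1_at g (p + r *: z)) ->
  (forall z, sph z -> g (p + r *: z) <> p + r *: z) ->
  C1_sphere_map (displacement_direction g p r).
Proof.
move=> gC gN z zs; have z0 := sphere_neq0 zs.
pose D x := displacement_direction g p r x.
have DC : C1_at D z.
  apply: C1_at_normalize; first by apply: C1_at_displacement; exact: gC.
  by rewrite subr_eq0 eq_sym; apply/eqP; exact: gN.
have NC := C1_at_normalize (C1_at_id z) z0.
have Nz : (enorm z)^-1 *: z = z by rewrite (zs : enorm z = 1) invr1 scale1r.
have DN : C1_at (fun x => D ((enorm x)^-1 *: x)) z.
  by apply: (C1_at_comp NC); rewrite /= Nz.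
exact: C1_at_scale (C1_at_enorm z0) DN.
Qed.

Lemma displacement_degree_radius g p (r1 r2 : R) : 0 < r1 <= r2 ->
  (forall x, r1 <= enorm (x - p) <= r2 -> C1_at g x /\ g x <> x) ->
  degree (displacement_direction g p r1) = degree (displacement_direction g p r2).
Proof.
move=> /andP[r10 r12] gC.
have en (r : R) z : 0 < r -> sph z -> enorm (p + r *: z - p) = r.
  by move=> r0 zs; rewrite addrC addKr enormZ (zs : enorm z = 1) mulr1 gtr0_norm.
have H (r : R) z : r1 <= r <= r2 -> sph z -> C1_at g (p + r *: z) /\ g (p + r *: z) <> p + r *: z.
  move=> rr zs; apply: gC; rewrite en//; by case/andP : rr => /(lt_le_trans r10).
have rr1 : r1 <= r1 <= r2 by rewrite lexx.
have rr2 : r1 <= r2 <= r2 by rewrite r12 lexx.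
pose rho (t : R) := r1 + t * (r2 - r1).
have rhoI t : `[0, 1]%classic t -> r1 <= rho t <= r2.
  rewrite /= in_itv /= => /andP[t0 t1]; rewrite /rho; apply/andP; split; nra.
pose V (q : R * E) := (p + rho q.1 *: q.2) - g (p + rho q.1 *: q.2).
have VE t z : displacement_direction g p (rho t) z = (enorm (V (t, z)))^-1 *: V (t, z).
  by [].
have r1E : r1 = rho 0 by rewrite /rho mul0r addr0.
have r2E : r2 = rho 1 by rewrite /rho mul1r addrC subrK.
apply: degree_homotopy.
- by apply: displacement_C1 => z /(H _ _ rr1)[].
- by apply: displacement_sphere => z /(H _ _ rr1)[].
- by apply: displacement_C1 => z /(H _ _ rr2)[].
- by apply: displacement_sphere => z /(H _ _ rr2)[].
rewrite [X in displacement_direction g p X]r1E r2E.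
apply: (sphere_homotopic_normalize (V := V)).
  apply: continuous_in_subspaceT => -[t z]; rewrite inE => -[tI zs].
  have cf : {for (t, z), continuous (@fst R E)} by exact: cvg_fst.
  have cs : {for (t, z), continuous (@snd R E)} by exact: cvg_snd.
  have crho : {for (t, z), continuous (fun q : R * E => rho q.1)}.
    apply: continuousD; first exact: cst_continuous.
    by apply: continuousM; [exact: cf | exact: cst_continuous].
  have ca : {for (t, z), continuous (fun q : R * E => p + rho q.1 *: q.2)}.
    by apply: continuousD; [exact: cst_continuous | exact: (continuousZ crho cs)].
  have cg : {for (t, z), continuous (g \o (fun q : R * E => p + rho q.1 *: q.2))}.
    by apply: (continuous_comp ca); have [gx _] := H _ _ (rhoI t tI) zs; exact: C1_at_continuous.
  exact: (continuousB ca cg).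
move=> t z tI zs; rewrite /V /= subr_eq0 eq_sym; apply/eqP.
by have [] := H _ _ (rhoI t tI) zs.
Qed.

(** The index is the eventual value of the degree for small radii, and the degree does not change as
    long as the shell between two radii contains no fixed point. *)
Lemma euclidean_index_degree g p (r : R) : 0 < r ->
  (forall x, enorm (x - p) <= r -> C1_at g x /\ (g x = x -> x = p)) ->
  euclidean_index g p = degree (displacement_direction g p r).
Proof.
move=> r0 gC.
have H : \forall s \near (0 : R)^'+,
    degree (displacement_direction g p s) = degree (displacement_direction g p r).
  near=> s; have s0 : 0 < s by near: s; exact: nbhs_right_gt.
  have sr : s <= r by near: s; exact: nbhs_right_le.
  apply: displacement_degree_radius; first by rewrite s0.
  move=> x /andP[sx xr]; have [Cx xp] := gC x xr; split=> // /xp xE.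
  by move: sx; rewrite xE subrr enorm0 leNgt s0.
rewrite /euclidean_index; apply: xget_unique; first exact: H.
move=> m Hm.
have {}Hm : \forall s \near (0 : R)^'+, degree (displacement_direction g p s) = m by exact: Hm.
have HH : \forall s \near (0 : R)^'+, m = degree (displacement_direction g p r).
  by apply: filterS2 Hm H => s <- <-.
by have [] := filter_ex HH.
Unshelve. all: by end_near. Qed.

(** A condition of Rouché type: on the sphere [h] differs from [g] by less than the displacement of
    [g], so the segment between the two displacements avoids 0, and the degree is counted on the
    zeros of [id - h] in the ball. *)
Lemma displacement_degree_sum g h p (r : R) (Y : seq E) : 0 < r ->
  (forall z, sph z -> C1_at g (p + r *: z)) ->
  (forall x, enorm (x - p) <= r -> C1_at h x) ->
  (forall z, sph z -> enorm (g (p + r *: z) - h (p + r *: z)) <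
                      enorm (p + r *: z - g (p + r *: z))) ->
  uniq Y -> (forall y, y \in Y <-> enorm (y - p) <= r /\ h y = y) ->
  (forall y, y \in Y -> \det (1%:M - 'J h y) != 0) ->
  degree (displacement_direction g p r) = \sum_(y <- Y) sgz (\det (1%:M - 'J h y)).
Proof.
move=> r0 gC hC gh uY YP Ynd.
have rn : r != 0 by rewrite gt_eqF.
have en z : enorm (p + r *: z - p) = r * enorm z.
  by rewrite addrC addKr enormZ gtr0_norm.
have gN z : sph z -> g (p + r *: z) <> p + r *: z.
  by move=> zs gz; have := gh z zs; rewrite gz subrr enorm0 ltNge enorm_ge0.
pose a (z : E) := p + r *: z; pose b (y : E) := r^-1 *: (y - p).
have ab y : a (b y) = y by rewrite /a /b scalerA divff// scale1r addrC subrK.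
have ba z : b (a z) = z by rewrite /a /b addrC addKr scalerA mulVf// scale1r.
pose vg z := a z - g (a z); pose v z := a z - h (a z).
have v0 z : sph z -> v z != 0.
  move=> zs; rewrite subr_eq0; apply/eqP => hz.
  by have := gh z zs; rewrite -/(a z) -hz -opprB -scaleN1r enormZ normrN1 mul1r ltxx.
pose Z := [seq b y | y <- Y].
have aC z : C1_at a z.
  by apply: C1_atD; [exact: C1_at_cst | apply: C1_atZ; exact: C1_at_id].
have vC z : enorm z <= 1 -> C1_at v z.
  by move=> z1; apply: C1_at_displacement; apply: hC; rewrite en ler_piMr// ltW.
have vgC z : sph z -> C1_at vg z.
  by move=> zs; apply: C1_at_displacement; exact: gC.
rewrite (@degree_ball R n (displacement_direction g p r) v Z
  (fun z => r *: (1%:M - 'J h (a z)))).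
- rewrite big_map; apply: eq_big_seq => y yY.
  by rewrite ab detZ sgzM gtr0_sgz ?mul1r// exprn_gt0.
- by apply: displacement_C1.
- exact: displacement_sphere.
- apply: continuous_in_subspaceT => z; rewrite inE /= => z1.
  exact: C1_at_continuous (vC z z1).
- exact: v0.
- pose W (q : R * E) := (1 - q.1) *: vg q.2 + q.1 *: v q.2.
  have := @sphere_homotopic_normalize W.
  have -> : (fun z => (enorm (W (0, z)))^-1 *: W (0, z)) = displacement_direction g p r.
    by apply/funext => z; rewrite /W /= subr0 scale1r scale0r addr0.
  have -> : (fun z => (enorm (W (1, z)))^-1 *: W (1, z)) = fun z => (enorm (v z))^-1 *: v z.
    by apply/funext => z; rewrite /W /= subrr scale1r scale0r add0r.
  apply.
    apply: continuous_in_subspaceT => -[t z]; rewrite inE => -[tI zs].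
    have cf : {for (t, z), continuous (@fst R E)} by exact: cvg_fst.
    have cs : {for (t, z), continuous (@snd R E)} by exact: cvg_snd.
    have cf1 : {for (t, z), continuous (fun q : R * E => 1 - q.1)}.
      by apply: continuousB; [exact: cst_continuous | exact: cf].
    have z1 : enorm z <= 1 by rewrite (zs : enorm z = 1).
    have c1 : {for (t, z), continuous (vg \o snd)}.
      by apply: (continuous_comp cs); exact: C1_at_continuous (vgC z zs).
    have c2 : {for (t, z), continuous (v \o snd)}.
      by apply: (continuous_comp cs); exact: C1_at_continuous (vC z z1).
    exact: (continuousD (continuousZ cf1 c1) (continuousZ cf c2)).
  move=> t z; rewrite /= in_itv /= => /andP[t0 t1] zs.
  rewrite /W /=; have -> : (1 - t) *: vg z + t *: v z = vg z + t *: (g (a z) - h (a z)).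
    rewrite /vg /v; apply/matrixP => i j; rewrite !mxE; ring.
  rewrite addr_eq0; apply/eqP => /(congr1 (@enorm R _)); rewrite -scaleNr enormZ normrN ger0_norm//.
  move=> E1; have := gh z zs; rewrite -/(a z) -/(vg z) E1 ltNge => /negP; apply.
  by rewrite ler_piMl// enorm_ge0.
- by rewrite map_inj_uniq// => y y' /(congr1 a); rewrite !ab.
- move=> z z1 /eqP; rewrite subr_eq0 => /eqP hz; apply/mapP; exists (a z); last by rewrite ba.
  by apply/YP; split=> //; rewrite /a en ler_piMr// ltW.
move=> _ /mapP[y yY ->]; have [yr hy] := proj1 (YP y) yY.
have b1 : enorm (b y) <= 1.
  by rewrite -(ler_pM2l r0) mulr1 -en -/(a (b y)) ab.
split.
- rewrite lt_neqAle b1 andbT; apply/eqP => bs.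
  by have := v0 _ bs; rewrite /v ab hy subrr eqxx.
- by rewrite /v ab hy subrr.
- have aJ : has_jacobian a (b y) (r%:M).
    have := has_jacobianD (has_jacobian_cst p (b y)) (has_jacobianZ r (has_jacobian_id (b y))).
    by rewrite add0r scale_scalar_mx mulr1.
  have hJ : has_jacobian h (a (b y)) ('J h y) by rewrite ab; apply: C1_at_jacobian; exact: hC.
  have vJ := has_jacobianB aJ (has_jacobian_comp aJ hJ).
  have vb : v (b y) = 0 by rewrite /v ab hy subrr.
  move=> e e0; apply: filterS (vJ e e0) => z; rewrite /= -/(v z) -/(v (b y)) vb subr0 ab.
  by rewrite mul_scalar_mx scalerBr scale_scalar_mx mulr1.
by rewrite ab unitmxE unitfE detZ mulf_neq0 ?Ynd// expf_neq0.
Qed.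

Lemma euclidean_index_nondeg g p : C1_at g p -> g p = p -> \det (1%:M - 'J g p) != 0 ->
  euclidean_index g p = sgz (\det (1%:M - 'J g p)).
Proof.
move=> gC gp nd.
have u : 1%:M - 'J g p \in unitmx by rewrite unitmxE unitfE.
have H1 := has_jacobian_isolated (has_jacobianB (has_jacobian_id p) (C1_at_jacobian gC)) u.
have /nbhs_normP[r /= r0 Hr] : \forall y \near p, C1_at g y /\ (p - g p = y - g y -> y = p).
  by apply: filterS2 (C1_at_nbhs gC) H1 => y yC yH; split=> // E; exact: yH.
have r20 : 0 < r / 2 by rewrite divr_gt0.
have Hr2 x : enorm (x - p) <= r / 2 -> C1_at g x /\ (g x = x -> x = p).
  move=> xr; have [|xC xp] := Hr x.
    rewrite /= distrC; apply: le_lt_trans (norm_le_enorm _) _; apply: le_lt_trans xr _.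
    by rewrite ltr_pdivrMr// mulr_natr mulr2n ltrDl.
  by split=> // gx; apply: xp; rewrite gp gx !subrr.
rewrite (euclidean_index_degree r20 Hr2).
have en z : sph z -> enorm (p + (r / 2) *: z - p) <= r / 2.
  by move=> zs; rewrite addrC addKr enormZ (zs : enorm z = 1) mulr1 gtr0_norm.
have gN z : sph z -> g (p + (r / 2) *: z) <> p + (r / 2) *: z.
  move=> zs gz; have [_ /(_ gz)/eqP] := Hr2 _ (en z zs).
  rewrite -subr_eq0 addrC addKr scaler_eq0 (gt_eqF r20) /= => /eqP z0.
  by have := sphere_neq0 zs; rewrite z0 eqxx.
rewrite -[RHS](big_seq1 +%R p (fun y => sgz (\det (1%:M - 'J g y)))).
apply: displacement_degree_sum.
- exact: r20.
- by move=> z zs; have [] := Hr2 _ (en z zs).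
- by move=> x xr; have [] := Hr2 x xr.
- move=> z zs; rewrite subrr enorm0 enorm_gt0 subr_eq0 eq_sym; apply/eqP; exact: gN.
- by [].
- move=> y; rewrite inE; split=> [/eqP ->|[yr gy]].
    by split; [rewrite subrr enorm0 ltW | exact: gp].
  by have [_ yp] := Hr2 y yr; apply/eqP; exact: yp.
by move=> y; rewrite inE => /eqP ->; exact: nd.
Qed.

End Index.

(** * Charts *)

Section Charts.
Variables (R : realType) (n : nat) (M : topologicalType) (phi : chart R n M).
Implicit Types (G F : M -> M) (u x : M) (v : 'rV[R]_n) (k : nat).

Definition chart_img : set 'rV[R]_n := phi @` chart_dom phi.

Lemma chart_invK v : chart_img v -> phi (chart_inv phi v) = v.
Proof. by move=> [u du <-]; rewrite chart_mapK. Qed.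

Lemma chart_inv_dom v : chart_img v -> chart_dom phi (chart_inv phi v).
Proof. by move=> [u du <-]; rewrite chart_mapK. Qed.

Lemma chart_img_map u : chart_dom phi u -> chart_img (phi u).
Proof. by exists u. Qed.

Lemma near_chart_img x : chart_dom phi x -> \forall v \near phi x, chart_img v.
Proof.
move=> dx; apply: open_nbhs_nbhs; split; last exact: chart_img_map.
exact: chart_img_open.
Qed.

Lemma near_chart_inv x (A : set M) : chart_dom phi x -> nbhs x A ->
  \forall v \near phi x, A (chart_inv phi v).
Proof.
move=> dx xA.
have c : {for phi x, continuous (chart_inv phi)}.
  have := @chart_inv_continuous _ _ _ phi.
  rewrite continuous_open_subspace; last exact: chart_img_open.
  by apply; rewrite inE; exact: chart_img_map.
by apply: c; rewrite chart_mapK.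
Qed.

Lemma near_chart_map x (B : set 'rV[R]_n) : chart_dom phi x -> nbhs (phi x) B ->
  nbhs x [set u | chart_dom phi u /\ B (phi u)].
Proof.
move=> dx xB; have dn : nbhs x (chart_dom phi).
  by apply: open_nbhs_nbhs; split => //; exact: chart_dom_open.
have c : {for x, continuous phi}.
  have := @chart_map_continuous _ _ _ phi.
  rewrite continuous_open_subspace; last exact: chart_dom_open.
  by apply; rewrite inE.
by apply: filterS2 dn (c _ xB) => u du Bu; split.
Qed.

Lemma in_chart_map G u : chart_dom phi u -> in_chart phi G (phi u) = phi (G u).
Proof. by move=> du; rewrite /in_chart /= chart_mapK. Qed.

Lemma in_chart_iter G k v : chart_img v ->
  (forall i, (i < k)%N -> chart_dom phi (G (chart_inv phi (iter i (in_chart phi G) v)))) ->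
  [/\ chart_img (iter k (in_chart phi G) v),
      chart_inv phi (iter k (in_chart phi G) v) = iter k G (chart_inv phi v) &
      in_chart phi (iter k G) v = iter k (in_chart phi G) v].
Proof.
move=> vV vk.
have [H1 H2] : chart_img (iter k (in_chart phi G) v) /\
    chart_inv phi (iter k (in_chart phi G) v) = iter k G (chart_inv phi v).
  elim: k vk => // k IH vk; have [|_ E] := IH; first by move=> i ik; apply: vk; exact: leqW.
  have d := vk k (ltnSn k); split; first exact: chart_img_map.
  by rewrite iterS {1}/in_chart /= chart_mapK// E.
by split=> //; rewrite /in_chart /= -H2 chart_invK.
Qed.

Lemma in_chart_orbit G k u : (forall i, (i <= k)%N -> chart_dom phi (iter i G u)) ->
  iter k (in_chart phi G) (phi u) = phi (iter k G u).
Proof.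
elim: k => // k IH H; rewrite iterS IH; last by move=> i ik; apply: H; exact: leqW.
by rewrite in_chart_map//; exact: H.
Qed.

End Charts.

Lemma iter_agree (T : Type) (D : T -> Prop) (g h : T -> T) k v :
  (forall w, D w -> g w = h w) -> (forall i, (i < k)%N -> D (iter i g v)) ->
  iter k h v = iter k g v.
Proof.
move=> gh; elim: k => // k IH Dk; rewrite !iterS IH => [|i ik]; last exact: Dk (leqW ik).
by rewrite gh//; exact: Dk.
Qed.

Lemma jacobian_near (R : realType) m n (f g : 'rV[R]_m -> 'rV[R]_n) x :
  (\forall y \near x, f y = g y) -> C1_at f x -> 'J g x = 'J f x.
Proof.
by move=> fg fC; apply: has_jacobian_unique; exact: has_jacobian_near fg (C1_at_jacobian fC).
Qed.

Lemma eigenvalue1E (R : realType) n (A : 'M[R]_n) :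
  eigenvalue A 1 = (\det (1%:M - A) == 0).
Proof. by rewrite eigenvalue_root_char /root horner_char_poly. Qed.

Lemma near_dist_lt (R : realType) (V : normedModType R) (p v : V) (s : R) :
  `|v - p| < s -> \forall w \near v, `|w - p| < s.
Proof.
move=> vs; have o : nbhs `|v - p| [set t | t < s] by exact: lt_nbhsl.
exact: (@continuous_dist R V v p) _ o.
Qed.

Lemma near_radius (R : realType) (V : normedModType R) (p : V) (A : set V) :
  (\forall v \near p, A v) -> exists2 r : R, 0 < r & forall v, `|v - p| < r -> A v.
Proof.
move=> /nbhs_normP[r /= r0 rA]; exists r => // v vr.
by apply: rA; rewrite /= distrC.
Qed.

(** * Existence of nondegenerate perturbations *)

Section Existence.
Variables (R : realType) (n : nat) (M : topologicalType) (phi : chart R n.+1 M).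
Notation E := 'rV[R]_n.+1.

Lemma C1_cutoff_scale (f : E -> E) p (s : R) : 0 < s ->
  (forall v, `|v - p| < s -> C1_at f v) -> smooth (fun v => cutoff p (s / 2) v *: f v).
Proof.
move=> s0 fC v; have s20 : 0 < s / 2 by rewrite divr_gt0.
have ss : s / 2 < s by rewrite ltr_pdivrMr// mulr_natr mulr2n ltrDl.
have [vs|vs] := ltP `|v - p| s.
  by apply: C1_at_scale; [exact: C1_at_cutoff | exact: fC].
have o : nbhs `|v - p| [set t | s / 2 < t] by apply: lt_nbhsr; exact: lt_le_trans vs.
have {}o : \forall w \near v, s / 2 < `|w - p| by exact: (@continuous_dist R E v p) _ o.
have H := C1_at_cst (0 : E) v; apply: C1_at_near H.
by apply: filterS o => w ws; rewrite cutoff_out ?scale0r ?ltW.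
Qed.

(** The generic perturbation theorem concerns maps of the whole space, so [F] is cut off in the
    chart. The cutoff is 1 on the image of [U1], and only orbits that stay in [U] matter, so nothing
    is lost there. *)
Theorem admissible_exists (F : M -> M) x k : chart_dom phi x -> (0 < k)%N -> F x = x ->
  C1_at (in_chart phi F) (phi x) ->
  exists2 U1, nbhs x U1 & forall U, U `<=` U1 -> forall e : R, 0 < e ->
    exists G, admissible phi U k e F G.
Proof.
move=> dx k0 Fx fC; pose f := in_chart phi F; pose p := phi x.
have fp : f p = p by rewrite /f in_chart_map// Fx.
have [s s0 Hs] : exists2 s : R, 0 < s &
    forall v, `|v - p| < s -> chart_img phi v /\ C1_at f v.
  apply: near_radius.
  have n1 := near_chart_img dx; have n2 := C1_at_nbhs fC.
  by apply: filterS2 n1 n2 => v; split.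
have s20 : 0 < s / 2 by rewrite divr_gt0.
pose ft v := cutoff p (s / 2) v *: f v.
have ftS : smooth ft by apply: C1_cutoff_scale => // v /Hs[].
have [s1 s10 Hs1] := cutoff_near1 p s20.
have [s2 s20' Hs2] : exists2 r : R, 0 < r & forall v, `|v - p| < r ->
    [/\ `|v - p| < s1, `|f v - p| < s / 2 & `|v - p| < s].
  have n1 : \forall v \near p, `|v - p| < s1 by apply: near_dist_lt; rewrite subrr normr0.
  have n3 : \forall v \near p, `|v - p| < s by apply: near_dist_lt; rewrite subrr normr0.
  have o : nbhs (f p) [set w | `|p - w| < s / 2] by rewrite fp; exact: nbhs_dist_lt.
  have n2 : \forall v \near p, `|p - f v| < s / 2 by exact: (C1_at_continuous fC) _ o.
  apply: near_radius; apply: filterS3 n1 n2 n3 => v a b c; split=> //.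
  by rewrite distrC.
exists [set u | chart_dom phi u /\ `|phi u - p| < s2].
  have n1 : \forall v \near p, `|v - p| < s2 by apply: near_dist_lt; rewrite subrr normr0.
  exact: near_chart_map dx n1.
move=> U UU1 e e0.
have ft0 v : s / 2 <= `|v - p| -> ft v = 0 by move=> vs; rewrite /ft cutoff_out// scale0r.
have [C C0 HC] := C1_bounded_support ftS ft0.
(* Every value of a map at distance less than 1 from [ft] lies in this ball, and a fixed point of an
   iterate is such a value. *)
pose K := [set v : E | `|v - 0| <= C + 1].
have HK : C1nbhs ft [set h : E -> E | forall v, iter k h v = v -> K v].
  exists 1; rewrite /= ?ltr01// => h [_ hC] v vk.
  rewrite /K /= subr0 -vk -(prednK k0) iterS; set w := iter _ _ _.
  have [fw _] := hC w; have [Cw _] := HC w.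
  have -> : h w = ft w - (ft w - h w) by rewrite opprB addrC subrK.
  by apply: le_trans (ler_normB _ _) _; apply: lerD => //; exact: ltW.
(* The bound [s / 2] keeps [g v] within [s] of [p], hence in the image of the chart, as [f v] is
   within [s / 2] of [p]. *)
pose e' := Num.min e (s / 2).
have e'0 : 0 < e' by rewrite lt_min e0.
have gA : C1nbhs ft [set h | C1_dist_lt e' ft h] by exists e' => // h [].
have [g [gS gD gnd]] := generic_perturbation (@compact_cball R n 0 (C + 1)) ftS k0 HK gA.
pose G := chart_inv phi \o g \o phi.
pose D v := `|v - p| < s2.
have Dft v : D v -> \forall w \near v, ft w = f w.
  move=> vD; apply: filterS (near_dist_lt vD) => w /Hs2[w1 _ _].
  by rewrite /ft Hs1// scale1r.
have DV v : D v -> chart_img phi v by move=> /Hs2[_ _ /Hs[]].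
have DgV v : D v -> chart_img phi (g v).
  move=> vD; have [_ fv _] := Hs2 _ vD; have [gv _] := gD v.
  have [] // := Hs (g v); rewrite distrC; apply: (@dist_lt_halves _ _ _ (f v)).
    by rewrite distrC.
  rewrite -(nbhs_singleton (Dft v vD)); apply: lt_le_trans gv _.
  by rewrite ge_min lexx orbT.
have DG v : D v -> g v = in_chart phi G v.
  by move=> vD; rewrite /in_chart /G /= (chart_invK (DV v vD)) (chart_invK (DgV v vD)).
have nearDG v : D v -> \forall w \near v, g w = in_chart phi G w.
  by move=> vD; apply: filterS (near_dist_lt vD) => w; exact: DG.
have domG v : D v -> chart_dom phi (G (chart_inv phi v)).
  by move=> vD; rewrite /G /= (chart_invK (DV v vD)); exact: chart_inv_dom (DgV v vD).
exists G; split.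
  move=> u uU; have [du uD] := UU1 _ uU; have ud : D (phi u) by [].
  have [gf jf] := gD (phi u).
  rewrite -(DG _ ud) (jacobian_near (nearDG _ ud) (gS _)).
  have fE := nbhs_singleton (Dft _ ud).
  have JE : 'J f (phi u) = 'J ft (phi u) by exact: jacobian_near (Dft _ ud) (ftS _).
  split.
  - by have := domG _ ud; rewrite chart_mapK.
  - exact: C1_at_near (nearDG _ ud) (gS _).
  - rewrite -/f -fE distrC; apply: lt_le_trans gf _; by rewrite ge_min lexx.
  - rewrite -/f JE distrC; apply: lt_le_trans jf _; by rewrite ge_min lexx.
move=> u [uk uO]; pose v := phi u.
have uU i : (i < k)%N -> U (iter i G u) by move=> ik; apply: uO; exists i.
have uD i : (i <= k)%N -> chart_dom phi (iter i G u).
  rewrite leq_eqVlt => /predU1P[->|ik]; last by have [] := UU1 _ (uU i ik).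
  by rewrite uk; have [] := UU1 _ (uU 0 k0).
have vG i : (i <= k)%N -> iter i (in_chart phi G) v = phi (iter i G u).
  by move=> ik; apply: in_chart_orbit => j ji; apply: uD; exact: leq_trans ji ik.
have vGD i : (i < k)%N -> D (iter i (in_chart phi G) v).
  by move=> ik; rewrite vG ?(ltnW ik)//; have [] := UU1 _ (uU i ik).
have GgD w : D w -> in_chart phi G w = g w by move=> wD; rewrite DG.
have vg i : (i <= k)%N -> iter i g v = iter i (in_chart phi G) v.
  move=> ik; apply: (iter_agree (D := D)) => // j ji; apply: vGD.
  exact: leq_trans ji ik.
have vk : iter k g v = v by rewrite vg// vG// uk.
have nearD : \forall w \near v, forall i, i \in iota 0 k -> D (iter i g w).
  apply: (near_all_seq (P := fun (w : E) i => D (iter i g w)) (nbhs_filter v)) => i.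
  rewrite mem_iota add0n => /andP[_ ik].
  have Di : D (iter i g v) by rewrite vg ?(ltnW ik)//; exact: vGD.
  exact: (C1_at_continuous (smooth_iter i gS v)) _ (near_dist_lt Di).
have nearE : \forall w \near v, iter k g w = in_chart phi (iter k G) w.
  apply: filterS nearD => w wD.
  have {}wD i : (i < k)%N -> D (iter i g w) by move=> ik; apply: wD; rewrite mem_iota.
  have wG i : (i <= k)%N -> iter i (in_chart phi G) w = iter i g w.
    move=> ik; apply: (iter_agree (D := D)) => // j ji; apply: wD.
    exact: leq_trans ji ik.
  have wV : chart_img phi w by apply: DV; exact: (wD 0 k0).
  have [|_ _ ->] := @in_chart_iter _ _ _ phi G k w wV.
    by move=> i ik; rewrite wG ?(ltnW ik)//; apply: domG; exact: wD.
  by rewrite wG.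
rewrite /nondegenerate_fixed_point (jacobian_near nearE (smooth_iter k gS v)) eigenvalue1E.
exact: gnd.
Qed.

End Existence.

(** * Counting periodic orbits *)

Lemma eq_big_seq_cond (V : nmodType) (T : eqType) (s : seq T) (P Q : pred T) (F1 F2 : T -> V) :
  P =1 Q -> (forall d, d \in s -> Q d -> F1 d = F2 d) ->
  \sum_(d <- s | P d) F1 d = \sum_(d <- s | Q d) F2 d.
Proof.
move=> PQ F12; rewrite big_seq_cond [RHS]big_seq_cond.
by apply: eq_big => [d|d]; rewrite PQ// => /andP[]; exact: F12.
Qed.

Section PeriodicCount.
Variables (R : realType) (n : nat) (M : topologicalType) (phi : chart R n.+1 M).
Variables (G : M -> M) (U : set M) (k : nat) (p : 'rV[R]_n.+1) (r1 r2 : R).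
Notation E := 'rV[R]_n.+1.
Notation g := (in_chart phi G).
Hypothesis k0 : (0 < k)%N.
Hypothesis r21 : r2 < r1.
(** On this ball the chart expression can be iterated [k] times inside [U]. With [orbitU], the
    periodic points that lie in [U] become those in the smaller Euclidean ball of radius [r2], so
    the shape of [U] no longer enters. *)
Hypothesis ballG : forall v, `|v - p| < r1 -> forall i, (i <= k)%N ->
  [/\ chart_inv phi (iter i g v) = iter i G (chart_inv phi v), U (iter i G (chart_inv phi v)),
      in_chart phi (iter i G) v = iter i g v & C1_at g (iter i g v)].
Hypothesis ball_img : forall v, `|v - p| < r1 -> chart_img phi v.
Hypothesis orbitU : forall u, periodic_in U k G u ->
  chart_dom phi u /\ enorm (phi u - p) < r2.
Hypothesis periodic_nondeg : forall u, periodic_in U k G u ->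
  nondegenerate_fixed_point phi (iter k G) u.

Let P : set M := [set u | periodic_in U k G u].

Lemma periodic_shift u : P u -> P (G u).
Proof.
move=> [uk uO]; split; first by rewrite -iterSr iterS uk.
have H : orbit_set G k u (G u) by exact: (orbit_set_iter k0 1 uk).
have HE : orbit_set G k (G u) = orbit_set G k u.
  exact (orbit_set_eq k0 uk H).
by rewrite /periodic_orbit -/(orbit_set G k (G u)) HE.
Qed.

Lemma periodic_iter i u : P u -> P (iter i G u).
Proof. by move=> Pu; elim: i => //= i; exact: periodic_shift. Qed.

Lemma ball_norm v : enorm (v - p) <= r2 -> `|v - p| < r1.
Proof. by move=> vr; apply: le_lt_trans (norm_le_enorm _) _; exact: le_lt_trans r21. Qed.

Lemma periodic_ball u : P u -> `|phi u - p| < r1.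
Proof. by move=> /orbitU[_ /ltW]; exact: ball_norm. Qed.

Lemma periodic_chart i u : P u -> iter i g (phi u) = phi (iter i G u).
Proof.
by move=> Pu; apply: in_chart_orbit => j _; have [] := orbitU (periodic_iter j Pu).
Qed.

Lemma periodic_fixed d u : P u -> iter d G u = u -> iter d g (phi u) = phi u.
Proof. by move=> Pu ud; rewrite periodic_chart// ud. Qed.

Lemma ball_C1_iter i v : `|v - p| < r1 -> (i <= k)%N -> C1_at (iter i g) v.
Proof.
move=> vr ik; apply: C1_at_iter => j ji.
by have [] := ballG vr (leq_trans (ltnW ji) ik).
Qed.

Lemma near_in_chart_iter i v : `|v - p| < r1 -> (i <= k)%N ->
  \forall w \near v, iter i g w = in_chart phi (iter i G) w.
Proof.
move=> vr ik; apply: filterS (near_dist_lt vr) => w wr.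
by have [_ _ -> _] := ballG wr ik.
Qed.

Lemma jacobian_in_chart_iter i v : `|v - p| < r1 -> (i <= k)%N ->
  'J (in_chart phi (iter i G)) v = 'J (iter i g) v.
Proof. move=> vr ik; exact: jacobian_near (near_in_chart_iter vr ik) (ball_C1_iter vr ik). Qed.

Lemma ball_fixed_periodic v : `|v - p| < r1 -> iter k g v = v -> P (chart_inv phi v).
Proof.
move=> vr vk; split.
  by have [<- _ _ _] := ballG vr (leqnn k); rewrite vk.
by move=> _ [i /= ik <-]; have [_ ? _ _] := ballG vr (ltnW ik).
Qed.

Lemma ball_fixed_C1 v i : `|v - p| < r1 -> iter k g v = v -> C1_at g (iter i g v).
Proof.
move=> vr vk; rewrite (iter_modn i vk).
by have [] := ballG vr (ltnW (ltn_pmod i k0)).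
Qed.

Lemma ball_fixed_nondeg v : `|v - p| < r1 -> iter k g v = v ->
  \det (1%:M - 'J (iter k g) v) != 0.
Proof.
move=> vr vk; have := periodic_nondeg (ball_fixed_periodic vr vk).
rewrite /nondegenerate_fixed_point (chart_invK (ball_img vr)).
by rewrite (jacobian_in_chart_iter vr (leqnn k)) eigenvalue1E.
Qed.

Lemma ball_fixed_nondeg_dvd d v : `|v - p| < r1 -> (d %| k)%N -> iter d g v = v ->
  \det (1%:M - 'J (iter d g) v) != 0.
Proof.
move=> vr dk vd; have vk := iter_dvd_fixed dk vd.
have := ball_fixed_nondeg vr vk; move: (dk) => /dvdnP[q kE].
rewrite {1}kE (jacobian_iter_period q (fun i => ball_fixed_C1 i vr vk) vd).
exact: det_1BX_neq0.
Qed.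

Lemma fixed_seq d : (0 < d)%N -> (d %| k)%N -> exists2 Y : seq E, uniq Y &
  forall y, y \in Y <-> enorm (y - p) <= r2 /\ iter d g y = y.
Proof.
move=> d0 dk; have dlek := dvdn_leq k0 dk.
pose B := [set v : E | 0 <= enorm (v - p) <= r2].
have cB : compact B.
  have -> : B = [set v : E | `|v - p| <= r1] `&` [set v : E | enorm (v - p) <= r2].
    apply/seteqP; split=> v /=; rewrite /B /= enorm_ge0 //=.
      by move=> vr; split=> //; exact: ltW (ball_norm vr).
    by case.
  apply: compact_closedI; first exact: compact_cball.
  have c : continuous (fun v : E => enorm (v - p)).
    move=> v; have c1 : {for v, continuous (fun v : E => v - p)}.
      by apply: continuousB; [exact: cvg_id | exact: cst_continuous].
    by apply: (continuous_comp c1); exact: enorm_continuous.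
  have -> : [set v : E | enorm (v - p) <= r2] = (fun v : E => enorm (v - p)) @^-1` [set t | t <= r2] by [].
  by apply: closed_comp; [move=> v _; exact: c | exact: closed_le].
have fin : finite_set (B `&` [set v | iter d g v = v]).
  apply: finite_isolated => // v /andP[_ vB]; have vr := ball_norm vB.
  have C1v := ball_C1_iter vr dlek.
  have [vd|vd] := pselect (iter d g v = v).
    have u : 1%:M - 'J (iter d g) v \in unitmx.
      by rewrite unitmxE unitfE; exact: ball_fixed_nondeg_dvd.
    have := has_jacobian_isolated
      (has_jacobianB (has_jacobian_id v) (C1_at_jacobian C1v)) u.
    by apply: filterS => y H yd; apply: H; rewrite /= yd vd !subrr.
  have c : {for v, continuous (fun w => iter d g w - w)}.
    by apply: continuousB; [exact: C1_at_continuous | exact: cvg_id].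
  have o : nbhs (iter d g v - v) [set t | t != 0].
    have e0 : 0 < `|iter d g v - v| by rewrite normr_gt0 subr_eq0; apply/eqP.
    apply: filterS (nbhs_dist_lt (iter d g v - v) e0) => t.
    by apply: contraTneq => ->; rewrite subr0 ltxx.
  have o' : \forall w \near v, iter d g w - w != 0 by exact: c _ o.
  by apply: filterS o' => w; rewrite subr_eq0 => /eqP.
have [Y uY YE] := finite_set_seq fin; exists Y => // y.
have -> : (y \in Y) = ([set` Y] y) :> Prop by [].
rewrite -YE /B /= enorm_ge0; split; first by case.
by case.
Qed.

(** [idx d] stands for the index of the unperturbed iterate, known only through its count over the
    fixed points of the perturbation. Exchanging the sums over divisors and points gives the
    contributions [c u] to which [orbit_sum] applies. *)
Theorem periodic_count (idx : nat -> int) x :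
  (forall d (Y : seq E), (0 < d)%N -> (d %| k)%N -> uniq Y ->
     (forall y, y \in Y <-> enorm (y - p) <= r2 /\ iter d g y = y) ->
     (forall y, y \in Y -> \det (1%:M - 'J (iter d g) y) != 0) ->
     idx d = \sum_(y <- Y) sgz (\det (1%:M - 'J (iter d g) y))) ->
  k%:R * \sum_(O \in good_orbits phi U k G) orbit_index phi k G x O =
  \sum_(d <- divisors k) (totient (k %/ d))%:R * idx d.
Proof.
move=> idxE.
have dk_gt0 d : d \in divisors k -> (0 < d)%N /\ (d %| k)%N.
  by rewrite -dvdn_divisors// => dk; split=> //; exact: dvdn_gt0 dk.
have finP : finite_set P.
  have [Y _ YP] := fixed_seq k0 (dvdnn k).
  apply: (sub_finite_set (B := chart_inv phi @` [set` Y])); last exact: finite_image.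
  move=> u Pu; have [du ur] := orbitU Pu; exists (phi u); last by rewrite chart_mapK.
  by apply/YP; split; [exact: ltW | apply: periodic_fixed => //; have [] := Pu].
have [s us PE] := finite_set_seq finP.
have sP u : u \in s <-> P u by rewrite PE.
pose eps d u := sgz (\det (1%:M - 'J (iter d g) (phi u))).
pose c u := \sum_(d <- divisors k | iter d G u == u) (totient (k %/ d))%:R * eps d u.
pose I u := eps k u.
have idx_s d : d \in divisors k -> idx d = \sum_(u <- s | iter d G u == u) eps d u.
  move=> /dk_gt0[d0 dk]; have [Y uY YP] := fixed_seq d0 dk.
  rewrite (idxE d Y)//; last first.
    by move=> y /YP[yr yd]; apply: ball_fixed_nondeg_dvd => //; exact: ball_norm.
  have phiY y : y \in Y -> phi (chart_inv phi y) = y.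
    by move=> /YP[/ball_norm/ball_img yV _]; exact: chart_invK.
  rewrite -[RHS]big_filter (perm_big [seq chart_inv phi y | y <- Y]) /=.
    by rewrite big_map; apply: eq_big_seq => y yY; rewrite /eps phiY.
  apply: uniq_perm; first exact: filter_uniq.
    by rewrite map_inj_in_uniq// => y y' /phiY {2}<- /phiY {2}<- ->.
  move=> u; rewrite mem_filter; apply/andP/mapP => [[/eqP ud /sP Pu]|[y yY ->]].
    have [du ur] := orbitU Pu; exists (phi u); last by rewrite chart_mapK.
    by apply/YP; split; [exact: ltW | exact: periodic_fixed].
  have [yr yd] := proj1 (YP y) yY; have yr1 := ball_norm yr; split.
    by have [<- _ _ _] := ballG yr1 (dvdn_leq k0 dk); rewrite yd.
  by apply/sP; apply: ball_fixed_periodic => //; exact: iter_dvd_fixed dk yd.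
have sumc : \sum_(d <- divisors k) (totient (k %/ d))%:R * idx d = \sum_(u \in P) c u.
  rewrite PE -fsbig_seq// /c (exchange_big_dep xpredT)//=.
  by apply: eq_big_seq => d dk; rewrite idx_s// mulr_sumr.
have Pk u : P u -> iter k G u = u by case.
have gk u : P u -> iter k g (phi u) = phi u by move=> Pu; apply: periodic_fixed => //; exact: Pk.
have gC u : P u -> forall i, C1_at g (iter i g (phi u)).
  by move=> Pu i; apply: ball_fixed_C1; [exact: periodic_ball | exact: gk].
have Jk u : P u -> \det (1%:M - 'J (iter k g) (phi u)) != 0.
  by move=> Pu; apply: ball_fixed_nondeg; [exact: periodic_ball | exact: gk].
have I0 u : P u -> I u != 0 by move=> Pu; rewrite sgz_eq0; exact: Jk.
have cG u : P u -> c (G u) = c u.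
  move=> Pu; have [du _] := orbitU Pu.
  have fixE d : (iter d G (G u) == G u) = (iter d G u == u).
    apply/eqP/eqP => [ud|ud]; last by rewrite -iterSr iterS ud.
    have := congr1 (iter k.-1 G) ud.
    by rewrite -iterD -!iterSr -addSn (prednK k0) addnC iterD (Pk u Pu).
  have epsG d : d \in divisors k -> iter d G u == u -> eps d (G u) = eps d u.
    move=> /dk_gt0[d0 dk] /eqP ud.
    have JE : \det (1%:M - 'J (iter d g) (g (phi u))) = \det (1%:M - 'J (iter d g) (phi u)).
      exact (det_jacobian_iter_shift d0 (gC u Pu) (periodic_fixed Pu ud)).
    have EG : phi (G u) = g (phi u) := esym (in_chart_map G du).
    exact (etrans (congr1 (fun v => sgz (\det (1%:M - 'J (iter d g) v))) EG)
      (congr1 (fun t : R => sgz t) JE)).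
  rewrite /c.
  apply: (eq_big_seq_cond fixE) => d dk ud.
  by rewrite epsG.
have cE u t : P u -> (0 < t)%N -> exact_period G t u ->
    c u = if odd (num_eigenvalues_lt_m1 ('J (iter t g) (phi u))) && ~~ odd (k %/ t) then 0
          else (k %/ t)%:R * I u.
  move=> Pu t0 tp; have tk := exact_period_dvd t0 tp (Pk u Pu).
  have kE : k = (t * (k %/ t))%N by rewrite mulnC divnK.
  have m0 : (0 < k %/ t)%N by rewrite divn_gt0// dvdn_leq.
  have tg := periodic_fixed Pu (proj1 tp).
  have Jpow d : (t %| d)%N -> 'J (iter d g) (phi u) = 'J (iter t g) (phi u) ^+ (d %/ t).
    move=> td; rewrite -{1}(divnK td); exact: jacobian_iter_period (gC u Pu) tg.
  have dm : \det (1 - 'J (iter t g) (phi u) ^+ (k %/ t)) != 0.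
    by rewrite -Jpow//; exact: Jk.
  have IE : I u = sgz (\det (1 - 'J (iter t g) (phi u) ^+ (k %/ t))).
    by rewrite /I /eps Jpow.
  rewrite IE -(totient_sum_period t0 m0 dm) -kE.
  rewrite /c; apply: eq_big => d; last first.
    move=> /eqP ud; congr (_ * sgz (\det _)).
    by rewrite Jpow//; exact: exact_period_dvd t0 tp ud.
  apply/eqP/idP => [|td]; first exact: exact_period_dvd.
  by apply: iter_dvd_fixed td _; case: tp.
have badE u t : P u -> (0 < t)%N -> exact_period G t u ->
    bad_point phi k G u <-> odd (num_eigenvalues_lt_m1 ('J (iter t g) (phi u))) && ~~ odd (k %/ t).
  move=> Pu t0 tp; have tk := exact_period_dvd t0 tp (Pk u Pu).
  have JE : 'J (in_chart phi (iter t G)) (phi u) = 'J (iter t g) (phi u).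
    by apply: jacobian_in_chart_iter; [exact: periodic_ball | exact: dvdn_leq].
  split=> [[t' [[t'0 t'u t'min] ot ok]]|/andP[ot ok]]; last first.
    exists t; rewrite /odd_point JE.
    exact (And3 (And3 t0 (proj1 tp) (proj2 tp)) ot ok).
  have tp' : exact_period G t' u := conj t'u t'min.
  have tt' : t' = t.
    apply/eqP; rewrite eqn_dvd (exact_period_dvd t'0 tp' (proj1 tp)).
    exact: exact_period_dvd t0 tp t'u.
  by move: ot ok; rewrite /odd_point tt' JE => -> ->.
have Hgood u t : P u -> (0 < t)%N -> exact_period G t u -> ~ bad_point phi k G u ->
    c u = (k %/ t)%:R * I u.
  by move=> Pu t0 tp /(badE _ _ Pu t0 tp)/negP/negbTE nb; rewrite (cE _ _ Pu t0 tp) nb.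
have Hbad u : P u -> bad_point phi k G u -> c u = 0.
  move=> Pu; have [t [t0 tp _]] := exact_period_ex k0 (Pk u Pu).
  by move=> /(badE _ _ Pu t0 tp) b; rewrite (cE _ _ Pu t0 tp) b.
have H := @orbit_sum M G k k0 P x c I (bad_point phi k G) finP Pk periodic_shift cG Hgood Hbad I0.
rewrite sumc -H; congr (_ * _); apply: eq_fsbigr => O; rewrite inE => -[v [Pv vb] vO].
have Ow : O (xget x O).
  by apply: xgetPex; exists v; rewrite -vO; exact: (orbit_set_iter k0 0 (Pk v Pv)).
rewrite /orbit_index; move: (xget x O) Ow => w Ow.
have Pw : P w by move: Ow; rewrite -vO => -[i _ <-]; exact: periodic_iter.
have wr := periodic_ball Pw; have [dw _] := orbitU Pw.
have JE := jacobian_in_chart_iter wr (leqnn k).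
rewrite /fp_index /I /eps -JE; apply: euclidean_index_nondeg.
- exact: C1_at_near (near_in_chart_iter wr (leqnn k)) (ball_C1_iter wr (leqnn k)).
- rewrite (in_chart_map (iter k G) dw) (Pk w Pw); exact: erefl.
- rewrite JE; exact (Jk w Pw).
Qed.

End PeriodicCount.

Section Counting.
Variables (R : realType) (n : nat).
Notation E := 'rV[R]_n.+1.

(* The hypotheses are on prefixes of y, so that for an orbit of a map close to f
   one shows inductively that it stays in K. *)
Lemma shadowing (f : E -> E) (K : set E) k (d : R) : compact K ->
  (forall v, K v -> {for v, continuous f}) -> 0 < d ->
  exists2 e : R, 0 < e & forall y : nat -> E,
    (forall i, (i <= k)%N -> K (iter i f (y 0))) ->
    forall i, (i <= k)%N -> (forall j, (j < i)%N -> K (y j) /\ `|y j.+1 - f (y j)| < e) ->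
    `|y i - iter i f (y 0)| < d.
Proof.
move=> cK cf; elim: k d => [|k IH] d d0.
  exists 1; rewrite ?ltr01// => y _ i; rewrite leqn0 => /eqP -> _.
  by rewrite subrr normr0.
have d20 : 0 < d / 2 by rewrite divr_gt0.
have cfK : {within K, continuous f}.
  by apply: continuous_in_subspaceT => v; rewrite inE; exact: cf.
have [h [h0 Hh]] := filter_ex (filterI (nbhs_right_gt (0 : R)) (compact_unif_continuous cK cfK d20)).
have [e1 e10 He1] := IH _ h0; have [e2 e20 He2] := IH _ d0.
exists (Num.min (Num.min e1 e2) (d / 2)); first by rewrite !lt_min e10 e20.
move=> y yK i ik yi.
have yK' j : (j <= k)%N -> K (iter j f (y 0)) by move=> jk; apply: yK; exact: leqW.
move: ik; rewrite leq_eqVlt ltnS => /predU1P[iE|ik]; last first.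
  apply: He2 => // j ji; have [Kj yj] := yi j ji; split=> //.
  by move: yj; rewrite !lt_min => /andP[/andP[]].
have yk : `|y k - iter k f (y 0)| < h.
  apply: He1 => // j jk; have [|Kj yj] := yi j; first by rewrite iE leqW.
  by split=> //; move: yj; rewrite !lt_min => /andP[/andP[]].
have [|Kk yk1] := yi k; first by rewrite iE.
rewrite iE iterS; apply: (@dist_lt_halves _ _ _ (f (y k))).
  by move: yk1; rewrite !lt_min => /andP[].
by apply: Hh => //; exact: yK'.
Qed.

Variables (M : topologicalType) (phi : chart R n.+1 M).

(** [U] is arbitrary within [U0], so its periodic points have to be confined to a ball of radius
    [r2] whose orbits stay in [U]. In [U0] outside that ball the iterates of [f] move all points by
    a definite amount, and [G] shadows them; on the sphere of radius [r2] the same estimate lets [G]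
    compute the indices of the iterates of [F]. *)
Theorem admissible_count (F : M -> M) x k : chart_dom phi x -> (0 < k)%N -> F x = x ->
  nbhs x [set y | chart_dom phi (F y)] -> C1_at (in_chart phi F) (phi x) ->
  (forall j, (0 < j)%N -> \forall y \near x, iter j F y = y -> y = x) ->
  exists2 U0, nbhs x U0 & forall U, open U -> U x -> U `<=` U0 ->
    exists2 e : R, 0 < e & forall G, admissible phi U k e F G ->
      k%:R * \sum_(O \in good_orbits phi U k G) orbit_index phi k G x O =
      \sum_(d <- divisors k) (totient (k %/ d))%:R * fp_index phi (iter d F) x.
Proof.
move=> dx k0 Fx nF fC iso; pose f := in_chart phi F; pose p := phi x.
have fp : f p = p by rewrite /f in_chart_map// Fx.
have fpi i : iter i f p = p by elim: i => //= i ->.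
have [s s0 Hs] : exists2 s : R, 0 < s & forall v, `|v - p| < s ->
    [/\ chart_img phi v, C1_at f v & chart_dom phi (F (chart_inv phi v))].
  apply: near_radius; have n1 := near_chart_img dx; have n2 := C1_at_nbhs fC.
  have n3 := near_chart_inv dx nF.
  by apply: filterS3 n1 n2 n3 => v; split.
have s20 : 0 < s / 2 by rewrite divr_gt0.
have s2s : s / 2 < s by rewrite ltr_pdivrMr// mulr_natr mulr2n ltrDl.
have near_orb t : 0 < t -> \forall v \near p, forall i, i \in iota 0 k.+1 -> `|iter i f v - p| < t.
  move=> t0; apply: (near_all_seq (P := fun (v : E) i => `|iter i f v - p| < t) (nbhs_filter p)) => i _.
  have o : \forall w \near iter i f p, `|w - p| < t.
    by rewrite fpi; apply: near_dist_lt; rewrite subrr normr0.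
  have c : {for p, continuous (iter i f)}.
    by apply: C1_at_continuous; apply: C1_at_iter => j _; rewrite fpi.
  exact: c _ o.
have nIso : \forall v \near p, forall j, j \in iota 1 k ->
    iter j F (chart_inv phi v) = chart_inv phi v -> chart_inv phi v = x.
  apply: (near_all_seq (P := fun (v : E) j => iter j F (chart_inv phi v) = chart_inv phi v ->
    chart_inv phi v = x) (nbhs_filter p)) => j; rewrite mem_iota => /andP[j0 _].
  exact: near_chart_inv dx (iso j j0).
have [t t0 Ht] : exists2 t : R, 0 < t & forall v, `|v - p| < t ->
    (forall i, i \in iota 0 k.+1 -> `|iter i f v - p| < s / 2) /\
    (forall j, j \in iota 1 k ->
      iter j F (chart_inv phi v) = chart_inv phi v -> chart_inv phi v = x).
  by apply: near_radius; have n1 := near_orb _ s20; apply: filterS2 n1 nIso => v; split.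
pose rho := t / 2; have rho0 : 0 < rho by rewrite divr_gt0.
have rhot v : `|v - p| <= rho -> `|v - p| < t.
  by move=> vr; apply: le_lt_trans vr _; rewrite ltr_pdivrMr// mulr_natr mulr2n ltrDl.
have Hf v i : `|v - p| <= rho -> (i <= k)%N -> `|iter i f v - p| < s / 2.
  by move=> /rhot/Ht[H _] ik; apply: H; rewrite mem_iota.
have Hin v i : `|v - p| <= rho -> (i <= k)%N ->
    [/\ chart_img phi (iter i f v), chart_inv phi (iter i f v) = iter i F (chart_inv phi v) &
        in_chart phi (iter i F) v = iter i f v].
  move=> vr ik; have [V0 _ _] := Hs v (lt_trans (Hf v 0 vr (leq0n k)) s2s).
  apply: in_chart_iter V0 _ => j ji.
  by have [] := Hs _ (lt_trans (Hf v j vr (leq_trans (ltnW ji) ik)) s2s).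
have Himg v : `|v - p| <= rho -> chart_img phi v.
  by move=> vr; have [] := Hin v 0 vr (leq0n k).
have Hfix v j : `|v - p| <= rho -> (0 < j <= k)%N -> iter j f v = v -> v = p.
  move=> vr /andP[j0 jk] vj; have [_ Hiso] := Ht v (rhot v vr).
  have [_ vi _] := Hin v j vr jk.
  have vx : chart_inv phi v = x.
    by apply: (Hiso j); rewrite ?mem_iota ?j0 ?add1n// -vi vj.
  by rewrite -(chart_invK (Himg v vr)) vx.
have HC v i : `|v - p| <= rho -> (i <= k)%N -> C1_at (iter i f) v.
  move=> vr ik; apply: C1_at_iter => j ji.
  by have [_ ? _] := Hs _ (lt_trans (Hf v j vr (leq_trans (ltnW ji) ik)) s2s).
exists [set u | chart_dom phi u /\ `|phi u - p| < rho].
  have n1 : \forall v \near p, `|v - p| < rho by apply: near_dist_lt; rewrite subrr normr0.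
  exact: near_chart_map dx n1.
move=> U oU Ux UU0.
have [r r0 Hr] : exists2 r : R, 0 < r & forall v, `|v - p| < r ->
    U (chart_inv phi v) /\ `|v - p| < rho.
  apply: near_radius; have n1 := near_chart_inv dx (open_nbhs_nbhs (conj oU Ux)).
  have n2 : \forall v \near p, `|v - p| < rho by apply: near_dist_lt; rewrite subrr normr0.
  by apply: filterS2 n1 n2 => v; split.
have r20 : 0 < r / 2 by rewrite divr_gt0.
have [r1 r10 Hr1] : exists2 r1 : R, 0 < r1 & forall v, `|v - p| < r1 ->
    (forall i, i \in iota 0 k.+1 -> `|iter i f v - p| < r / 2) /\ `|v - p| < r.
  apply: near_radius; have n1 := near_orb _ r20.
  have n2 : \forall v \near p, `|v - p| < r by apply: near_dist_lt; rewrite subrr normr0.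
  by apply: filterS2 n1 n2 => v; split.
pose r2 := r1 / 2; have r2_gt0 : 0 < r2 by rewrite divr_gt0.
have r21 : r2 < r1 by rewrite ltr_pdivrMr// mulr_natr mulr2n ltrDl.
have r1rho v : `|v - p| < r1 -> `|v - p| <= rho by move=> /Hr1[_ /Hr[_ /ltW]].
have enr v : enorm (v - p) <= r2 -> `|v - p| < r1.
  by move=> vr; apply: le_lt_trans (norm_le_enorm _) _; exact: le_lt_trans r21.
(* A compact set containing no fixed point of the iterates of [f] up to [k], hence the lower bound
   [d2] on their displacements. *)
pose ann := [set v : E | `|v - p| <= rho] `&` [set v : E | r2 <= enorm (v - p)].
have cann : compact ann.
  apply: compact_closedI; first exact: compact_cball.
  have c : continuous (fun v : E => enorm (v - p)).
    move=> v; have c1 : {for v, continuous (fun v : E => v - p)}.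
      by apply: continuousB; [exact: cvg_id | exact: cst_continuous].
    by apply: (continuous_comp c1); exact: enorm_continuous.
  have -> : [set v : E | r2 <= enorm (v - p)] = (fun v : E => enorm (v - p)) @^-1` [set t | r2 <= t] by [].
  by apply: closed_comp; [move=> v _; exact: c | exact: closed_ge].
have Hann : \forall e \near (0 : R)^'+, forall j, j \in iota 1 k ->
    forall v, ann v -> e < `|iter j f v - v|.
  apply: near_all_seq => j; rewrite mem_iota add1n ltnS => jk.
  apply: (compact_norm_gt (f := fun v => iter j f v - v) cann).
    apply: continuous_in_subspaceT => v; rewrite inE => -[vr _].
    apply: continuousB; last exact: cvg_id.
    by apply: C1_at_continuous; apply: HC => //; case/andP : jk.
  move=> v [vr vr2]; rewrite subr_eq0; apply/eqP => /(Hfix v j vr jk) vp.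
  by move: vr2; rewrite /= vp subrr enorm0 leNgt r2_gt0.
have [d2 [d20 Hd2]] := filter_ex (filterI (nbhs_right_gt (0 : R)) Hann).
(* [r / 2] keeps the perturbed orbits in [U]; the factor n+1 pays for comparing the sup norm with
   the Euclidean one on the sphere. *)
pose d := Num.min (r / 2) (d2 / n.+1%:R).
have d0 : 0 < d by rewrite lt_min r20 divr_gt0.
have dr : d <= r / 2 by rewrite ge_min lexx.
have dn : n.+1%:R * d <= d2.
  by rewrite mulrC -ler_pdivlMr// ge_min lexx orbT.
have dd2 : d <= d2.
  by apply: le_trans dn; rewrite ler_peMl ?(ltW d0)// ler1n.
pose K := [set v : E | `|v - p| <= s / 2].
have KC v : K v -> {for v, continuous f}.
  by move=> vK; have [_ fvC _] := Hs v (le_lt_trans vK s2s); exact: C1_at_continuous.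
have KHf v i : `|v - p| <= rho -> (i <= k)%N -> K (iter i f v).
  by move=> vr ik; exact: ltW (Hf v i vr ik).
have [e e0 He] := @shadowing f K k d (@compact_cball R n p (s / 2)) KC d0.
exists e => // G [Gclose Gnd]; pose g := in_chart phi G.
have gU v : `|v - p| < r ->
    [/\ chart_dom phi (G (chart_inv phi v)), C1_at g v & `|g v - f v| < e].
  move=> vr; have [Uv vrho] := Hr v vr; have := Gclose _ Uv.
  by rewrite (chart_invK (Himg v (ltW vrho))) => -[].
have shad v i : `|v - p| < r1 -> (i <= k)%N ->
    `|iter i g v - iter i f v| < d /\ `|iter i g v - p| < r.
  move=> vr1; have vrho := r1rho v vr1.
  elim/ltn_ind: i => i IH ik.
  have H : `|iter i g v - iter i f v| < d.
    apply: (He (fun j => iter j g v)) => // j ji; first exact: KHf.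
    have [_ yr] := IH j ji (leq_trans (ltnW ji) ik); have [_ _ ge] := gU _ yr.
    have [_ yrho] := Hr _ yr; split; last exact: ge.
    exact: KHf (ltW yrho) (leq0n k).
  split; first exact: H.
  apply: (@dist_lt_halves _ _ _ (iter i f v)); first exact: lt_le_trans H dr.
  by have [Hi _] := Hr1 v vr1; apply: Hi; rewrite mem_iota.
have ballG v : `|v - p| < r1 -> forall i, (i <= k)%N ->
  [/\ chart_inv phi (iter i g v) = iter i G (chart_inv phi v), U (iter i G (chart_inv phi v)),
      in_chart phi (iter i G) v = iter i g v & C1_at g (iter i g v)].
  move=> vr1 i ik; have vV := Himg v (r1rho v vr1).
  have [|_ E1 E2] := @in_chart_iter _ _ _ phi G i v vV.
    move=> j ji; have [_ yr] := shad v j vr1 (leq_trans (ltnW ji) ik).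
    by have [] := gU _ yr.
  have [_ yr] := shad v i vr1 ik; have [_ gC _] := gU _ yr; have [Uy _] := Hr _ yr.
  split; [exact: E1 | by rewrite -E1 | exact: E2 | exact: gC].
have ball_img v : `|v - p| < r1 -> chart_img phi v by move=> vr; exact: Himg v (r1rho v vr).
have orbitU u : periodic_in U k G u -> chart_dom phi u /\ enorm (phi u - p) < r2.
  move=> [uk uO].
  have uU i : (i <= k)%N -> U (iter i G u).
    rewrite leq_eqVlt => /predU1P[->|ik]; last by apply: uO; exists i.
    by rewrite uk; apply: uO; exists 0%N.
  have [du ur] := UU0 _ (uU 0 (leq0n k)); split=> //.
  (* A point of the annulus that is fixed by [iter k G] is moved by more than [d2] by [iter k f],
     whereas the shadowing error is less than [d], which is at most [d2]. *)
  rewrite ltNge; apply/negP => ur2.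
  have : `|phi (iter k G u) - iter k f (phi u)| < d.
    apply: (He (fun j => phi (iter j G u))) => // [i ik|j jk].
      exact: KHf (ltW ur) ik.
    have [dj rj] := UU0 _ (uU j (ltnW jk)); split; first exact: KHf (ltW rj) (leq0n k).
    have [_ _ + _] := Gclose _ (uU j (ltnW jk)).
    by rewrite in_chart_map.
  rewrite uk distrC; apply/negP; rewrite -leNgt; apply: le_trans dd2 _.
  apply: ltW; apply: (Hd2 k); first by rewrite mem_iota k0 add1n ltnS leqnn.
  by split; [exact: ltW | exact: ur2].
have cnt := @periodic_count R n M phi G U k p r1 r2 k0 r21 ballG ball_img orbitU Gnd
  (fun j => fp_index phi (iter j F) x) x.
apply: cnt => j Y j0 jk uY YP Ynd.
have {}jk : (j <= k)%N := dvdn_leq k0 jk.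
have fE v : `|v - p| < r1 -> in_chart phi (iter j F) v = iter j f v.
  by move=> vr; have [] := Hin v j (r1rho v vr) jk.
have fjC v : `|v - p| < r1 -> C1_at (in_chart phi (iter j F)) v.
  move=> vr; apply: C1_at_near (HC v j (r1rho v vr) jk).
  by apply: filterS (near_dist_lt vr) => w wr; rewrite fE.
have gjC v : `|v - p| < r1 -> C1_at (iter j g) v.
  move=> vr; apply: C1_at_iter => i ij.
  by have [] := ballG v vr i (leq_trans (ltnW ij) jk).
have j0k : (0 < j <= k)%N by rewrite j0.
have HI v : enorm (v - p) <= r2 ->
    C1_at (in_chart phi (iter j F)) v /\ (in_chart phi (iter j F) v = v -> v = p).
  move=> /enr vr; rewrite (fE v vr); split; first exact (fjC v vr).
  exact (Hfix v j (r1rho v vr) j0k).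
rewrite /fp_index (euclidean_index_degree r2_gt0 HI).
have ez z : sphere z -> enorm (p + r2 *: z - p) = r2.
  by move=> zs; rewrite addrC addKr enormZ (zs : enorm z = 1) mulr1 gtr0_norm.
apply: displacement_degree_sum.
- exact: r2_gt0.
- move=> z zs; have zr : enorm (p + r2 *: z - p) <= r2 by rewrite ez.
  exact (fjC _ (enr _ zr)).
- move=> v /enr; exact (gjC v).
- move=> z zs; have := ez z zs; move: (p + r2 *: z) => v vE.
  have vr : `|v - p| < r1 by apply: enr; rewrite vE.
  rewrite (fE v vr); have [H _] := shad v j vr jk.
  apply: le_lt_trans (enorm_le_norm _) _.
  apply: (@lt_le_trans _ _ `|iter j f v - v|); last by rewrite distrC; exact: norm_le_enorm.
  have annv : ann v by split; [exact: r1rho | rewrite /= vE].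
  have := Hd2 j _ v annv; rewrite mem_iota j0 add1n ltnS jk => /(_ isT); apply: le_lt_trans.
  apply: le_trans dn; rewrite ler_wpM2l// distrC; exact: ltW.
- exact: uY.
- exact: YP.
- exact: Ynd.
Qed.

End Counting.

(** * The iterated index *)

Section IteratedIndex.
Variables (R : realType) (n : nat) (M : topologicalType) (phi : chart R n M).

Lemma admissible_le U k (e e' : R) (F G : M -> M) : e <= e' ->
  admissible phi U k e F G -> admissible phi U k e' F G.
Proof.
move=> ee' [GF Gnd]; split=> // y /GF[H1 H2 H3 H4]; split=> //.
  exact: lt_le_trans ee'.
exact: lt_le_trans ee'.
Qed.

(** The count determines the sum for all close perturbations, which gives a value. It is unique
    because perturbations exist: any other candidate is compared with it on one that is close enough
    for both. *)
Lemma iterated_indexE (F : M -> M) (x : M) k (T : int) : (0 < k)%N ->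
  (\forall y \near x, iter k F y = y -> y = x) ->
  (exists2 U0, nbhs x U0 & forall U, open U -> U x -> U `<=` U0 ->
    exists2 e : R, 0 < e & forall G, admissible phi U k e F G ->
      k%:R * \sum_(O \in good_orbits phi U k G) orbit_index phi k G x O = T) ->
  (exists2 U1, nbhs x U1 & forall U, U `<=` U1 -> forall e : R, 0 < e ->
    exists G, admissible phi U k e F G) ->
  k%:R * iterated_index phi k F x = T.
Proof.
move=> k0 iso [U0 xU0 H0] [U1 xU1 H1].
have kn : k%:R != 0 :> int by rewrite pnatr_eq0 -lt0n.
have small V : nbhs x V -> exists U, [/\ open U, U x, U `<=` V & U `<=` U0 `&` U1 `&`
    [set y | iter k F y = y -> y = x]].
  move=> xV; exists (interior (V `&` (U0 `&` U1 `&` [set y | iter k F y = y -> y = x]))).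
  split; first exact: open_interior.
  - by apply: filterI => //; apply: filterI => //; exact: filterI.
  - by move=> y /interior_subset[].
  by move=> y /interior_subset[].
have [U [oU Ux _ UU]] := small setT filterT.
have [e e0 He] := H0 U oU Ux (fun y Uy => (UU y Uy).1.1).
have [G HG] := H1 U (fun y Uy => (UU y Uy).1.2) e e0.
pose m := \sum_(O \in good_orbits phi U k G) orbit_index phi k G x O.
have km : k%:R * m = T := He G HG.
suff -> : iterated_index phi k F x = m by [].
apply: xget_unique.
  exists U0 => // V oV Vx VU0 _; have [e' e'0 He'] := H0 V oV Vx VU0.
  exists e'; [exact: e'0 | move=> G' HG'; apply: (mulfI kn)].
  exact (etrans (He' G' HG') (esym km)).
move=> m' [U0' xU0' Hm'].
have [V [oV Vx VU0' VV]] := small _ xU0'.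
have [e1 e10 He1] := H0 V oV Vx (fun y Vy => (VV y Vy).1.1).
have [e2 e20 He2] := Hm' V oV Vx VU0' (fun y Vy => (VV y Vy).2).
have [|G' HG'] := H1 V (fun y Vy => (VV y Vy).1.2) (Num.min e1 e2).
  by rewrite lt_min e10.
have l1 : Num.min e1 e2 <= e1 by rewrite ge_min lexx.
have l2 : Num.min e1 e2 <= e2 by rewrite ge_min lexx orbT.
have mE := He2 G' (admissible_le l2 HG').
apply: (mulfI kn); rewrite km -mE; exact (He1 G' (admissible_le l1 HG')).
Qed.

End IteratedIndex.

(** * Dimension zero *)

Section DimensionZero.
Variables (R : realType) (M : topologicalType) (phi : chart R 0 M).

Lemma fp_index_dim0 (G : M -> M) x : fp_index phi G x = 1.
Proof.
apply: xget_unique => [|m Hm]; first exact: filterE.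
have {}Hm : \forall r \near (0 : R)^'+, 1 = m by exact: Hm.
by have [] := filter_ex Hm.
Qed.

Lemma chart_dom_dim0 x y : chart_dom phi x -> chart_dom phi y -> y = x.
Proof.
move=> dx dy; rewrite -(chart_mapK dy) -(chart_mapK dx).
by congr chart_inv; rewrite [LHS]thinmx0 [RHS]thinmx0.
Qed.

Lemma num_eigenvalues_dim0 (A : 'M[R]_0) : num_eigenvalues_lt_m1 A = 0%N.
Proof.
apply: fsbig1 => a _; rewrite /char_poly det_mx00.
by apply: mup_eq0; rewrite root1.
Qed.

(** The domain of the chart is a point, so there is one orbit, good and of index 1, and the formula
    becomes the sum of totients. *)
Lemma admissible_count_dim0 (F : M -> M) x k : chart_dom phi x -> (0 < k)%N ->
  forall U, U x -> U `<=` chart_dom phi -> forall G, admissible phi U k 1 F G ->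
    k%:R * \sum_(O \in good_orbits phi U k G) orbit_index phi k G x O =
    \sum_(d <- divisors k) (totient (k %/ d))%:R * fp_index phi (iter d F) x.
Proof.
move=> dx k0 U Ux Udom G [Gclose _].
have [dG _ _ _] := Gclose x Ux.
have Gx : G x = x by exact: chart_dom_dim0 dx dG.
have Gi i : iter i G x = x by elim: i => //= i ->.
have Ox : periodic_orbit k G x = [set x].
  apply/seteqP; split=> y; first by move=> [i _ <-]; rewrite Gi.
  by move=> ->; exists 0%N.
have -> : good_orbits phi U k G = [set [set x]].
  apply/seteqP; split=> O.
    move=> [u [[uk uO] _] <-].
    have -> : u = x by apply: chart_dom_dim0 dx _; apply: Udom; apply: uO; exists 0%N.
    exact: Ox.
  move=> ->; exists x => //; split; last first.
    by move=> [t [_ + _]]; rewrite /odd_point num_eigenvalues_dim0.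
  by split; [exact: Gi | rewrite Ox => y ->].
rewrite fsbig_set1 /orbit_index fp_index_dim0 mulr1.
rewrite (eq_bigr (fun d => (totient (k %/ d))%:R)) => [|d _]; last first.
  by rewrite fp_index_dim0 mulr1.
by rewrite -natr_sum sum_totient_div.
Qed.

Lemma admissible_self_dim0 (F : M -> M) x k (e : R) U : chart_dom phi x -> F x = x ->
  C1_at (in_chart phi F) (phi x) -> U `<=` chart_dom phi -> 0 < e ->
  admissible phi U k e F F.
Proof.
move=> dx Fx fC Udom e0.
have xE u : U u -> u = x by move=> /Udom; exact: chart_dom_dim0.
split.
  move=> u /xE ->; rewrite !subrr !normr0 Fx; split; [exact dx | exact fC | exact e0 | exact e0].
by move=> u _; rewrite /nondegenerate_fixed_point eigenvalue1E det_mx00 oner_eq0.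
Qed.

End DimensionZero.

Theorem theorem2p5 (R : realType) (n : nat) (M : C1_manifold R n)
    (F : M -> M) (x : M) (phi : chart R n M) (kappa : nat)
    (phi_atlas : atlas M phi) (phi_x : chart_dom phi x)
    (F_C1 : C1_germ F x)
    (F_isolated : forall k : nat, (0 < k)%N -> isolated_fixed_point (iter k F) x)
    (kappa_gt0 : (0 < kappa)%N) :
  (iterated_index phi kappa F x)%:~R =
    (kappa%:R)^-1 *
      \sum_(d <- divisors kappa)
        (totient (kappa %/ d))%:R * (fp_index phi (iter d F) x)%:~R :> rat.
Proof.
have [nF fC] := F_C1 phi phi_atlas phi_x.
have Fx : F x = x by have [] := F_isolated 1%N isT.
have iso j : (0 < j)%N -> \forall y \near x, iter j F y = y -> y = x.
  by move=> /F_isolated[].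
have H : kappa%:R * iterated_index phi kappa F x =
    \sum_(d <- divisors kappa) (totient (kappa %/ d))%:R * fp_index phi (iter d F) x.
  clear F_isolated F_C1 phi_atlas.
  apply: (iterated_indexE kappa_gt0 (iso kappa kappa_gt0)).
    (* Label counts need a cube of positive dimension; in dimension 0 the degree is 1 by
       definition. *)
    case: n M F x phi phi_x nF fC Fx iso => [|n] M F x phi phi_x nF fC Fx iso; last first.
      exact (admissible_count phi_x kappa_gt0 Fx nF fC iso).
    exists (chart_dom phi).
      by apply: open_nbhs_nbhs; split => //; exact: chart_dom_open.
    move=> U _ Ux Udom; exists 1; first exact: ltr01.
    exact (admissible_count_dim0 (F := F) phi_x kappa_gt0 Ux Udom).
  case: n M F x phi phi_x nF fC Fx iso => [|n] M F x phi phi_x nF fC Fx iso; last first.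
    exact (admissible_exists phi_x kappa_gt0 Fx fC).
  exists (chart_dom phi).
    by apply: open_nbhs_nbhs; split => //; exact: chart_dom_open.
  by move=> U Udom e e0; exists F; exact (admissible_self_dim0 kappa phi_x Fx fC Udom e0).
have kn : kappa%:R != 0 :> rat by rewrite pnatr_eq0 -lt0n.
apply: (mulfI kn); rewrite mulrA divff// mul1r.
have := congr1 (fun m : int => m%:~R : rat) H.
rewrite rmorphM rmorph_nat rmorph_sum /= => ->.
by apply: eq_bigr => d _; rewrite rmorphM rmorph_nat.
Qed.
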